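(* Suppose $|v_{ij}(x)|\lesssim\langle x\rangle^{-2-\epsilon}$ for some $\epsilon>0$ and all $i,j$. Fix $\phi=Uv\psi\in S_1(L^2\times L^2)$, where $\psi=c_0(1,0)^T-\mathcal G_0v^*\phi$ and $c_0=\langle(a,c)^T,T\phi\rangle/\|(a,c)^T\|_2^2$. Then $\phi\in S_2(L^2\times L^2)$ if and only if $\psi\in L^p\times L^p(\mathbb R^2)$ for all $p\in(2,\infty]$, that is, if and only if $c_0=0$.
   Context: Let $m>0$ and let $V:\mathbb R^2\to\mathbb C^{2\times2}$ be self-adjoint-matrix valued. Matrices: $\alpha_1=\begin{pmatrix}0&1\\1&0\end{pmatrix}$, $\alpha_2=\begin{pmatrix}0&-i\\i&0\end{pmatrix}$, $\alpha\cdot\nabla=\alpha_1\partial_1+\alpha_2\partial_2$; $\langle x\rangle=(1+|x|^2)^{1/2}$. Write $V=B^*\,\mathrm{diag}(\lambda_1,\lambda_2)\,B$ pointwise with $B(x)$ unitary and $\lambda_j(x)$ real, $\eta_j=|\lambda_j|^{1/2}$, $U=\mathrm{diag}(\mathrm{sign}\lambda_1,\mathrm{sign}\lambda_2)$ (convention $\mathrm{sign}(0)=1$), $v=\mathrm{diag}(\eta_1,\eta_2)B=\begin{pmatrix}a&b\\c&d\end{pmatrix}$, so $V=v^*Uv$. Assume $(a,c)^T$ is not identically zero. Let $I_1=\mathrm{diag}(1,0)$, $G_0f(x)=-\frac1{2\pi}\int_{\mathbb R^2}\log|x-y|f(y)\,dy$, $\mathcal G_0=-i\alpha\cdot\nabla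 G_0+2mG_0I_1$, $T=U+v\mathcal G_0v^*$; $P$ is the orthogonal projection in $L^2\times L^2$ onto the span of $(a,c)^T$, $Q=1-P$. $S_1$ is the (orthogonal) Riesz projection onto the kernel of $QTQ$ on $Q(L^2\times L^2)$; every $\phi\in S_1(L^2\times L^2)$ satisfies $\phi=Uv\psi$ for the $\psi$ defined in the claim. $T_1=S_1TPTS_1$, and $S_2$ is the (orthogonal) Riesz projection onto the kernel of $T_1$ on $S_1(L^2\times L^2)$. The inner product in $c_0$ is linear in the second slot: $\langle(a,c)^T,T\phi\rangle=\int(\overline a\,(T\phi)_1+\overline c\,(T\phi)_2)dx$. *)

(* Defs.v *)
From HB Require Import structures.
From mathcomp Require Import all_boot all_order all_algebra.
From mathcomp Require Import all_classical all_reals all_analysis.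
From mathcomp Require Export complex.

Set Implicit Arguments.
Unset Strict Implicit.
Unset Printing Implicit Defensive.

Import Order.TTheory GRing.Theory Num.Theory.
Import numFieldNormedType.Exports.

Local Open Scope classical_set_scope.
Local Open Scope ring_scope.
Local Open Scope complex_scope.
Local Open Scope sesquilinear_scope.

Definition leb2 (R : realType) :
    {measure set (measurableTypeR R * measurableTypeR R) -> \bar R} :=
  (@lebesgue_measure R \x @lebesgue_measure R)%E.
Arguments leb2 : clear implicits.

(* The library norm on R * R is the sup norm, hence this one. *)
Definition enorm (R : realType) (x : R * R) : R :=
  Num.sqrt (x.1 ^+ 2 + x.2 ^+ 2).

Definition japanese (R : realType) (x : R * R) : R :=
  Num.sqrt (1 + enorm x ^+ 2).

Definition basis2 (R : realType) (j : 'I_2) : R * R :=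
  if j == 0 then (1, 0) else (0, 1).

(* Only meaningful when the real and imaginary parts of f are integrable. *)
Definition cintegral (R : realType) (f : R * R -> R[i]) : R[i] :=
  (\int[leb2 R]_x complex.Re (f x)) +i* (\int[leb2 R]_x complex.Im (f x)).

Definition cmeasurable (R : realType) (f : R * R -> R[i]) : Prop :=
  measurable_fun [set: R * R] (fun x => complex.Re (f x)) /\
  measurable_fun [set: R * R] (fun x => complex.Im (f x)).

Definition clocally_integrable (R : realType) (f : R * R -> R[i]) : Prop :=
  cmeasurable f /\
  forall K : set (R * R), compact K ->
    (leb2 R).-integrable K (fun x => (complex.Re (f x))%:E) /\
    (leb2 R).-integrable K (fun x => (complex.Im (f x))%:E).

Definition Lp2 (R : realType) (p : \bar R) (f : R * R -> 'cV[R[i]]_2) : Prop :=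
  forall i : 'I_2,
    (fun x => complex.Re (f x i 0)) \in Lfun (leb2 R) p /\
    (fun x => complex.Im (f x i 0)) \in Lfun (leb2 R) p.

Definition inner (R : realType) (f g : R * R -> 'cV[R[i]]_2) : R[i] :=
  cintegral (fun x => ((f x)^t* *m g x) 0 0).

Definition test_function (R : realType) (h : R * R -> R) : Prop :=
  [/\ continuous h,
      (forall (j : 'I_2) x, derivable h x (basis2 R j)),
      (forall j : 'I_2, continuous (fun x => 'D_(basis2 R j) h x)) &
      compact (closure [set x | h x != 0])].

(* g is the distributional derivative of u in the j-th coordinate, tested
   against compactly supported C^1 functions. *)
Definition is_weak_partial (R : realType) (j : 'I_2)
    (u g : R * R -> R[i]) : Prop :=
  [/\ clocally_integrable u, clocally_integrable g &
      forall h, test_function h ->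
        cintegral (fun x => u x * ('D_(basis2 R j) h x)%:C) =
        - cintegral (fun x => g x * (h x)%:C)].

(* A representative of the almost-everywhere class; 0 if there is none. *)
Definition weak_partial (R : realType) (j : 'I_2) (u : R * R -> R[i]) :
    R * R -> R[i] :=
  xget (fun=> 0) [set g | is_weak_partial j u g].

(* Entry (i, j) of alpha_1 is 1 off the diagonal; alpha_2 has -i above and
   i below the diagonal. *)
Definition alpha (R : realType) (k : 'I_2) : 'M[R[i]]_2 :=
  \matrix_(i, j) if i == j then 0
                 else if k == 0 then 1
                 else if i == 0 then 0 -i* 1 else 0 +i* 1.

Definition I1 (R : realType) : 'M[R[i]]_2 := delta_mx 0 0.

Definition G0 (R : realType) (u : R * R -> R[i]) (x : R * R) : R[i] :=
  (- (2 * pi)^-1)%:C * cintegral (fun y => (ln (enorm (x - y)))%:C * u y).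

(* -i alpha.grad (G_0 f) + 2 m G_0 (I_1 f), with G_0 acting componentwise.
   For f locally in L^2 the gradient of G_0 f is only a weak one. *)
Definition calG0 (R : realType) (m : R) (f : R * R -> 'cV[R[i]]_2)
    (x : R * R) : 'cV[R[i]]_2 :=
  (0 -i* 1) *: (\sum_(k < 2) alpha R k *m
             \col_i weak_partial k (G0 (fun y => f y i 0)) x)
  + (2 * m)%:C *: \col_i G0 (fun y => (I1 R *m f y) i 0) x.

Definition sign1 (R : realType) (t : R) : R := if 0 <= t then 1 else -1.

Definition Umx (R : realType) (lam : 'I_2 -> R * R -> R) (x : R * R) :
    'M[R[i]]_2 :=
  diag_mx (\row_j (sign1 (lam j x))%:C).

Definition vmx (R : realType) (lam : 'I_2 -> R * R -> R)
    (B : R * R -> 'M[R[i]]_2) (x : R * R) : 'M[R[i]]_2 :=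
  diag_mx (\row_j (`|lam j x| `^ 2^-1)%:C) *m B x.

(* The function (a, c)^T. *)
Definition vcol1 (R : realType) (lam : 'I_2 -> R * R -> R)
    (B : R * R -> 'M[R[i]]_2) (x : R * R) : 'cV[R[i]]_2 :=
  col 0 (vmx lam B x).

Definition vadj (R : realType) (lam : 'I_2 -> R * R -> R)
    (B : R * R -> 'M[R[i]]_2) (f : R * R -> 'cV[R[i]]_2) (x : R * R) :
    'cV[R[i]]_2 :=
  (vmx lam B x)^t* *m f x.

Definition Top (R : realType) (m : R) (lam : 'I_2 -> R * R -> R)
    (B : R * R -> 'M[R[i]]_2) (f : R * R -> 'cV[R[i]]_2) (x : R * R) :
    'cV[R[i]]_2 :=
  Umx lam x *m f x + vmx lam B x *m calG0 m (vadj lam B f) x.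

Definition c0 (R : realType) (m : R) (lam : 'I_2 -> R * R -> R)
    (B : R * R -> 'M[R[i]]_2) (phi : R * R -> 'cV[R[i]]_2) : R[i] :=
  inner (vcol1 lam B) (Top m lam B phi) / inner (vcol1 lam B) (vcol1 lam B).

Definition psi_of (R : realType) (m : R) (lam : 'I_2 -> R * R -> R)
    (B : R * R -> 'M[R[i]]_2) (phi : R * R -> 'cV[R[i]]_2) (x : R * R) :
    'cV[R[i]]_2 :=
  c0 m lam B phi *: delta_mx 0 0 - calG0 m (vadj lam B phi) x.

(* Operators act on functions; all identities in L^2 x L^2 are taken almost
   everywhere, so nothing is asserted about S f when f is not in L^2 x L^2. *)
Definition is_orthproj (R : realType) (M : set (R * R -> 'cV[R[i]]_2))
    (S : (R * R -> 'cV[R[i]]_2) -> (R * R -> 'cV[R[i]]_2)) : Prop :=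
  forall f, Lp2 2%:E f ->
    M (S f) /\ forall g, M g -> inner g (fun x => f x - S f x) = 0.

Definition L2range (R : realType)
    (S : (R * R -> 'cV[R[i]]_2) -> (R * R -> 'cV[R[i]]_2)) :
    set (R * R -> 'cV[R[i]]_2) :=
  [set g | Lp2 2%:E g /\ exists2 f, Lp2 2%:E f & g = S f %[ae leb2 R]].

Definition L2span (R : realType) (w : R * R -> 'cV[R[i]]_2) :
    set (R * R -> 'cV[R[i]]_2) :=
  [set g | Lp2 2%:E g /\ exists z : R[i], g = (fun x => z *: w x) %[ae leb2 R]].

(* The kernel of A on the subspace S (L^2 x L^2). *)
Definition ker_on (R : realType)
    (S A : (R * R -> 'cV[R[i]]_2) -> (R * R -> 'cV[R[i]]_2)) :
    set (R * R -> 'cV[R[i]]_2) :=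
  [set g | L2range S g /\ A g = (fun=> 0) %[ae leb2 R]].

Definition oppproj (R : realType)
    (P : (R * R -> 'cV[R[i]]_2) -> (R * R -> 'cV[R[i]]_2))
    (f : R * R -> 'cV[R[i]]_2) (x : R * R) : 'cV[R[i]]_2 :=
  f x - P f x.

Definition QTQ (R : realType) (m : R) (lam : 'I_2 -> R * R -> R)
    (B : R * R -> 'M[R[i]]_2)
    (P : (R * R -> 'cV[R[i]]_2) -> (R * R -> 'cV[R[i]]_2))
    (f : R * R -> 'cV[R[i]]_2) : R * R -> 'cV[R[i]]_2 :=
  oppproj P (Top m lam B (oppproj P f)).

Definition T1op (R : realType) (m : R) (lam : 'I_2 -> R * R -> R)
    (B : R * R -> 'M[R[i]]_2)
    (P S1 : (R * R -> 'cV[R[i]]_2) -> (R * R -> 'cV[R[i]]_2))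
    (f : R * R -> 'cV[R[i]]_2) : R * R -> 'cV[R[i]]_2 :=
  S1 (Top m lam B (P (Top m lam B (S1 f)))).

(* Main.v *)
Require Import Defs.
From HB Require Import structures.
From mathcomp Require Import all_boot all_order all_algebra.
From mathcomp Require Import all_classical all_reals all_analysis.
From mathcomp Require Import measurable_realfun ess_sup_inf.
From mathcomp Require Import ring lra.

(** Write G for the operator calG0 and u = v^* phi, so that
    psi = c0 (1, 0)^T - G u. Two facts carry the theorem.

    The first one is algebraic: within the range of S1, belonging to the range of
    S2 is the vanishing of the scalar c0. A function g in the range of S1 is
    orthogonal to (a, c)^T, and QTQ g = 0 forces T g to be a multiple of (a, c)^T,
    the factor being c0 (Top_range_S1). As T is symmetric (inner_Top), pairing
    T1 g with g gives |c0|^2 |(a, c)^T|^2, whence T1 g = 0 exactly when c0 = 0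
    (T1op_eq0, L2range_S2).

    The second one is analytic: G u is almost everywhere bounded by a multiple of
    1 / <x> (zero_mean_decay, calG0_decay). The gradient part of G has a kernel of
    size 1 / |x - y|. The logarithmic part only meets the first component of u,
    whose integral is <(a, c)^T, phi> = 0; so log |x - y| may be replaced by
    log |x - y| - log <x>, which decays as well. The decay of these kernels passes
    to G u as soon as u itself decays pointwise. This is not known beforehand,
    since phi is only square integrable, but phi = U v psi gives
    |u| <= C <x>^(-4 - 2 eps) (1 + |G u|), an inequality that improves itself:
    |G u| is bounded by the integral of s(x, y)^4 <y> |u(y)| with
    s(x, y) = 1 + |x - y|^(-1/4), and a Schur test with the weight
    <x>^(-2 - 2 eps), which integrates s(x, y)^6 uniformly in x, shows that this
    integral is bounded (density_smear4_bounded).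

    Consequently psi = c0 (1, 0)^T + O(1 / <x>), and 1 / <x> is in L^p for all
    p > 2. If c0 = 0 then psi is in all these spaces. Conversely, if psi is in
    L^3, then so is the constant c0, which must be 0 as the plane has infinite
    measure.

    The gradient in G is a weak one, chosen among all weak gradients. It agrees
    almost everywhere with the potential of the gradient of the kernel: that
    potential is a weak gradient by Fubini and integration by parts on lines
    (weak_gradient_potential), and weak gradients are unique because a locally
    integrable function that annihilates all test functions vanishes almost
    everywhere (orthogonal_test_ae0). *)

Set Implicit Arguments.
Unset Strict Implicit.
Unset Printing Implicit Defensive.

Import Order.TTheory GRing.Theory Num.Theory.
Import numFieldNormedType.Exports.

Local Open Scope classical_set_scope.
Local Open Scope ring_scope.
Local Open Scope complex_scope.
Local Open Scope sesquilinear_scope.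

(** * Potentials with a weighted singular kernel *)

Lemma le_of_eq d (T : porderType d) (x y : T) : x = y -> (x <= y)%O.
Proof. by move=> ->. Qed.

Section measurable_inverse.
Context d (X : measurableType d) (R : realType).

Lemma measurable_funV (f : X -> R) : (forall x, 0 <= f x) ->
  measurable_fun [set: X] f -> measurable_fun [set: X] (fun x => (f x)^-1).
Proof.
move=> f0 mf; under eq_fun do rewrite -powR_inv1//.
exact: (measurableT_comp (measurable_powR _) mf).
Qed.

End measurable_inverse.

Section schur.
Context d (X : measurableType d) (R : realType).
Variable mu : {sigma_finite_measure set X -> \bar R}.

(** The data of a Schur test. In the plane s x y is 1 + |x - y|^(-1/4), w is the
    japanese bracket and Om is <x>^(-2 - 2 eps). The sixth power of s stays below
    the critical singularity |x - y|^(-2), so that Om integrates it. *)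
Record schur_weight (s : X -> X -> R) (Om w : X -> R) (A : R) : Prop := SchurWeight {
  schur_const_ge0 : 0 <= A;
  schur_measurable : measurable_fun [set: X * X] (fun z => s z.1 z.2);
  schur_ge1 : forall x y, 1 <= s x y;
  schur_sym : forall x y, s x y = s y x;
  schur_measurable_Om : measurable_fun [set: X] Om;
  schur_Om_gt0 : forall x, 0 < Om x;
  schur_bound : forall x, (\int[mu]_y (s x y ^+ 6 * Om y)%:E <= A%:E)%E;
  schur_measurable_w : measurable_fun [set: X] w;
  schur_w_ge0 : forall x, 0 <= w x }.

Variables (s : X -> X -> R) (Om w : X -> R) (A : R).
Hypothesis SW : schur_weight s Om w A.

Let A_ge0 : 0 <= A. Proof. by case: SW. Qed.
Let ms : measurable_fun [set: X * X] (fun z => s z.1 z.2). Proof. by case: SW. Qed.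
Let s_ge1 x y : 1 <= s x y. Proof. by case: SW. Qed.
Let s_sym x y : s x y = s y x. Proof. by case: SW. Qed.
Let mOm : measurable_fun [set: X] Om. Proof. by case: SW. Qed.
Let Om_gt0 x : 0 < Om x. Proof. by case: SW. Qed.
Let s6Om x : (\int[mu]_y (s x y ^+ 6 * Om y)%:E <= A%:E)%E. Proof. by case: SW. Qed.
Let mw : measurable_fun [set: X] w. Proof. by case: SW. Qed.
Let w_ge0 x : 0 <= w x. Proof. by case: SW. Qed.

Definition wsquare (a : X -> R) (x : X) : R := a x ^+ 2 / Om x.

(** Nonnegative functions in L2 with weight 1 / Om. For square integrable f the
    function w |v^* f| is one of them: this is what the decay of v gives before
    anything is known about f pointwise. *)
Definition density (a : X -> R) : Prop :=
  [/\ measurable_fun [set: X] a, (forall x, 0 <= a x) &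
      (\int[mu]_x (wsquare a x)%:E < +oo)%E].

(** With values in the extended reals, since its finiteness is itself at stake. *)
Definition smear (n : nat) (a : X -> R) (x : X) : \bar R :=
  (\int[mu]_y (s x y ^+ n * a y)%:E)%E.

Implicit Types (a b : X -> R) (x y : X).

Let s_ge0 x y : 0 <= s x y. Proof. exact: le_trans (s_ge1 x y). Qed.
Let Om_ge0 x : 0 <= Om x. Proof. exact: ltW. Qed.

Let msl x : measurable_fun [set: X] (s x).
Proof. exact: (measurableT_comp ms (pair1_measurable x)). Qed.

Lemma wsquare_ge0 a x : 0 <= wsquare a x.
Proof. by rewrite divr_ge0 ?sqr_ge0. Qed.

Lemma measurable_wsquare a :
  measurable_fun [set: X] a -> measurable_fun [set: X] (wsquare a).
Proof.
move=> ma; apply: measurable_funM; first exact: measurable_funX.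
exact: measurable_funV.
Qed.

Lemma smear_ge0 n a x : (forall y, 0 <= a y) -> (0 <= smear n a x)%E.
Proof. by move=> a0; apply: integral_ge0 => y _; rewrite lee_fin mulr_ge0 ?exprn_ge0. Qed.

Lemma measurable_smear n a : measurable_fun [set: X] a -> (forall x, 0 <= a x) ->
  measurable_fun [set: X] (smear n a).
Proof.
move=> ma a0.
apply: (@measurable_fun_fubini_tonelli_F _ _ _ _ _ mu
  (fun z : X * X => (s z.1 z.2 ^+ n * a z.2)%:E)).
  apply/measurable_EFinP/measurable_funM; first exact: measurable_funX.
  exact: measurableT_comp.
by move=> z; rewrite lee_fin mulr_ge0 ?exprn_ge0.
Qed.

(** Tonelli, with the kernel moved to the other variable by symmetry. *)
Lemma smear_swap n a b : measurable_fun [set: X] a -> measurable_fun [set: X] b ->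
  (forall x, 0 <= a x) -> (forall x, 0 <= b x) ->
  (\int[mu]_x ((a x)%:E * smear n b x) = \int[mu]_x ((b x)%:E * smear n a x))%E.
Proof.
move=> ma mb a0 b0.
have E (c e : X -> R) x : measurable_fun [set: X] e -> (forall x, 0 <= c x) -> (forall x, 0 <= e x) ->
    ((c x)%:E * smear n e x = \int[mu]_y (c x * (s x y ^+ n * e y))%:E)%E.
  move=> me c0 e0; rewrite -ge0_integralZl_EFin//.
  - by move=> y _; rewrite lee_fin mulr_ge0 ?exprn_ge0.
  - by apply/measurable_EFinP/measurable_funM => //; exact: measurable_funX.
under eq_integral do rewrite E//.
under [RHS]eq_integral do rewrite E//.
rewrite (fubini_tonelli (fun z : X * X => (a z.1 * (s z.1 z.2 ^+ n * b z.2))%:E))/=.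
- by apply: eq_integral => x _; apply: eq_integral => y _; rewrite (s_sym y x); congr EFin; ring.
- apply/measurable_EFinP/measurable_funM; first exact: measurableT_comp.
  by apply: measurable_funM; [exact: measurable_funX|exact: measurableT_comp].
- by move=> z; rewrite lee_fin !mulr_ge0 ?exprn_ge0.
Qed.

Lemma smearZ n a x (t : R) : measurable_fun [set: X] a -> (forall x, 0 <= a x) -> 0 <= t ->
  (smear n (fun y => t * a y)%R x = t%:E * smear n a x)%E.
Proof.
move=> ma a0 t0; rewrite /smear -ge0_integralZl//.
- by apply: eq_integral => y _; rewrite mulrCA.
- by apply/measurable_EFinP/measurable_funM => //; exact: measurable_funX.
- by move=> y _; rewrite lee_fin mulr_ge0 ?exprn_ge0.
Qed.

Lemma le_smear n m a b x : measurable_fun [set: X] a -> (forall x, 0 <= a x) ->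
    measurable_fun [set: X] b -> (forall y, s x y ^+ n * a y <= s x y ^+ m * b y) ->
  (smear n a x <= smear m b x)%E.
Proof.
move=> ma a0 mb ab; apply: ge0_le_integral => //.
- by move=> y _; rewrite lee_fin mulr_ge0 ?exprn_ge0.
- by apply/measurable_EFinP/measurable_funM => //; exact: measurable_funX.
- by apply/measurable_EFinP/measurable_funM => //; exact: measurable_funX.
- by move=> y _; rewrite lee_fin.
Qed.

Let s_exp n m x y : (n <= m)%N -> s x y ^+ n <= s x y ^+ m.
Proof. by move=> nm; rewrite ler_weXn2l. Qed.

Lemma smear_Om_le n x : (n <= 6)%N -> (smear n Om x <= A%:E)%E.
Proof.
move=> n6; apply: le_trans (s6Om x); apply: le_smear => // y.
by rewrite ler_wpM2r// s_exp.
Qed.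

Lemma integral_Om_le : (\int[mu]_x (Om x)%:E <= A%:E)%E.
Proof.
apply: le_trans (smear_Om_le point (leq0n 6)).
by apply: ge0_le_integral => //; do ?[by move=> y _; rewrite ?expr0 ?mul1r ?lee_fin| by apply/measurable_EFinP]; apply/measurable_EFinP; under eq_fun do rewrite expr0 mul1r.
Qed.

Lemma integral_Om_smear_le n b : (n <= 6)%N ->
    measurable_fun [set: X] b -> (forall x, 0 <= b x) ->
  (\int[mu]_x ((Om x)%:E * smear n b x) <= A%:E * \int[mu]_x (b x)%:E)%E.
Proof.
move=> n6 mb b0; rewrite smear_swap// -ge0_integralZl//; last first.
- by move=> x _; rewrite lee_fin.
- exact/measurable_EFinP.
apply: ge0_le_integral => //.
- by move=> x _; rewrite mule_ge0 ?lee_fin// smear_ge0.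
- apply: emeasurable_funM; first exact/measurable_EFinP.
  exact: measurable_smear.
- apply: emeasurable_funM; [exact: measurable_cst|exact/measurable_EFinP].
- by move=> x _; rewrite muleC lee_wpmul2r ?lee_fin//; exact: smear_Om_le.
Qed.

(** The inequality between the means: the exponent 4 is the mean of 6, which Om
    integrates, and of 2, which leaves room for a further factor of s. The
    parameter t is chosen pointwise in each application. *)
Lemma smear4_le a x (t : R) : measurable_fun [set: X] a -> (forall x, 0 <= a x) -> 0 < t ->
  (smear 4 a x <= t%:E * A%:E + (t^-1)%:E * smear 2 (wsquare a) x)%E.
Proof.
move=> ma a0 t0; have t0' := ltW t0; have ti0 : 0 <= t^-1 by rewrite invr_ge0.
have mW := measurable_wsquare ma; have W0 := wsquare_ge0 a.
have m6 : measurable_fun [set: X] (fun y => (s x y ^+ 6 * (t * Om y))).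
  by apply: measurable_funM; [exact: measurable_funX|exact: measurable_funM].
have m2 : measurable_fun [set: X] (fun y => (s x y ^+ 2 * (t^-1 * wsquare a y))).
  by apply: measurable_funM; [exact: measurable_funX|exact: measurable_funM].
apply: (@le_trans _ _ (smear 6 (fun y => t * Om y)%R x + smear 2 (fun y => t^-1 * wsquare a y)%R x)); last first.
  by rewrite !smearZ// leeD2r// lee_wpmul2l ?lee_fin//; exact: s6Om.
rewrite -ge0_integralD//; last 4 first.
- by move=> y _; rewrite lee_fin; apply: mulr_ge0; [exact: exprn_ge0|exact: mulr_ge0].
- exact/measurable_EFinP.
- by move=> y _; rewrite lee_fin; apply: mulr_ge0; [exact: exprn_ge0|exact: mulr_ge0].
- exact/measurable_EFinP.
apply: ge0_le_integral => //.
- by move=> y _; rewrite lee_fin mulr_ge0 ?exprn_ge0.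
- by apply/measurable_EFinP/measurable_funM => //; exact: measurable_funX.
- by apply/measurable_EFinP/measurable_funD.
- move=> y _; rewrite -EFinD lee_fin /wsquare.
  have -> : t^-1 * (a y ^+ 2 / Om y) = a y ^+ 2 / (t * Om y).
    by rewrite mulrCA invfM.
  have q0 : 0 < t * Om y by rewrite mulr_gt0.
  have -> : s x y ^+ 6 * (t * Om y) + s x y ^+ 2 * (a y ^+ 2 / (t * Om y)) =
      s x y ^+ 2 * ((s x y ^+ 2 * (t * Om y)) ^+ 2 + a y ^+ 2) / (t * Om y).
    by field; rewrite !gt_eqF.
  rewrite ler_pdivlMr//.
  set q := t * Om y; set r := s x y ^+ 2.
  have r0 : 0 <= r by exact: exprn_ge0.
  have -> : s x y ^+ 4 = r * r by rewrite /r; ring.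
  have := mulr_ge0 r0 (sqr_ge0 (2 * (r * q) - a y)).
  by have := mulr_ge0 r0 (sqr_ge0 (a y)); nra.
Qed.

(** The optimal t is the square root of smear 2 (wsquare a) x; adding 1 keeps it
    positive. *)
Lemma smear4_sqr_le a x (p : R) : measurable_fun [set: X] a -> (forall x, 0 <= a x) -> 0 <= p ->
  (p%:E <= smear 4 a x -> (p ^+ 2)%:E <= ((A + 1) ^+ 2)%:E%R * (smear 2 (wsquare a) x + 1))%E.
Proof.
move=> ma a0 p0 pJ.
have A1 : 0 < A + 1 by rewrite ltr_wpDl.
case E : (smear 2 (wsquare a) x) => [b| |].
- have b0 : 0 <= b by rewrite -lee_fin -E smear_ge0// => y; exact: wsquare_ge0.
  have r0 : 0 < Num.sqrt (b + 1) by rewrite sqrtr_gt0 ltr_wpDl.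
  have := le_trans pJ (smear4_le x ma a0 r0).
  rewrite E -!EFinM -!EFinD !lee_fin => pr.
  have {}pr : p <= (A + 1) * Num.sqrt (b + 1).
    apply: (le_trans pr); rewrite mulrDl mul1r [A * _]mulrC lerD2l.
    rewrite mulrC ler_pdivrMr// -expr2 sqr_sqrtr ?addr_ge0//; lra.
  have : p ^+ 2 <= ((A + 1) * Num.sqrt (b + 1)) ^+ 2 by rewrite ler_sqr ?nnegrE// mulr_ge0 ?ltW.
  by rewrite exprMn sqr_sqrtr ?addr_ge0.
- by rewrite gt0_muley ?leey// lte_fin exprn_gt0.
- have := smear_ge0 2 x (wsquare_ge0 a); by rewrite E.
Qed.

Lemma integral_smear_wsquare_lty a : density a ->
  (\int[mu]_x ((Om x)%:E * (smear 2 (wsquare a) x + 1)) < +oo)%E.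
Proof.
move=> [ma a0 fa]; have W0 := wsquare_ge0 a; have mW := measurable_wsquare ma.
under eq_integral do rewrite ge0_muleDr ?smear_ge0// mule1.
rewrite ge0_integralD//; last 4 first.
- by move=> x _; rewrite mule_ge0 ?lee_fin ?smear_ge0.
- apply: emeasurable_funM; [exact/measurable_EFinP|exact: measurable_smear].
- by move=> x _; rewrite lee_fin.
- exact/measurable_EFinP.
apply: lte_add_pinfty.
  apply: (le_lt_trans (integral_Om_smear_le _ mW W0)) => //.
  by rewrite lte_mul_pinfty// lee_fin.
by apply: le_lt_trans integral_Om_le _; rewrite ltry.
Qed.

(** With t = a x / Om x in smear4_le, the product a x * t * A becomes a multiple
    of wsquare a x and a x / t becomes Om x. *)
Lemma density_pair_lty a b : density a -> density b ->
  (\int[mu]_x ((a x)%:E * smear 4 b x) < +oo)%E.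
Proof.
move=> da db; have [mb b0 fb] := db; have [ma a0 fa] := da.
have Wb0 := wsquare_ge0 b; have mWb := measurable_wsquare mb.
have Wa0 := wsquare_ge0 a; have mWa := measurable_wsquare ma.
apply: (@le_lt_trans _ _ (\int[mu]_x (A%:E * (wsquare a x)%:E + (Om x)%:E * (smear 2 (wsquare b) x + 1)))%E).
  apply: ge0_le_integral => //.
  - by move=> x _; rewrite mule_ge0 ?lee_fin ?smear_ge0.
  - apply: emeasurable_funM; [exact/measurable_EFinP|exact: measurable_smear].
  - apply: emeasurable_funD; first by apply: emeasurable_funM => //; exact/measurable_EFinP.
    apply: emeasurable_funM; first exact/measurable_EFinP.
    by apply: emeasurable_funD => //; exact: measurable_smear.
  - move=> x _; have [a0'|an0] := eqVneq (a x) 0.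
      rewrite a0' mul0e; apply: adde_ge0; apply: mule_ge0; rewrite ?lee_fin//.
      by apply: adde_ge0 => //; exact: smear_ge0.
    have ap : 0 < a x by rewrite lt_def an0 a0.
    have t0 : 0 < a x / Om x by rewrite divr_gt0.
    apply: le_trans (lee_wpmul2l _ (smear4_le x mb b0 t0)) _; first by rewrite lee_fin.
    rewrite ge0_muleDr; last 2 first.
    - by rewrite mule_ge0 ?lee_fin// ltW.
    - by rewrite mule_ge0 ?smear_ge0// lee_fin invr_ge0 ltW.
    rewrite !muleA -!EFinM leeD//.
      by rewrite lee_fin /wsquare; apply: le_of_eq; ring.
    have -> : a x / (a x / Om x) = Om x by field; rewrite an0 gt_eqF.
    by rewrite lee_wpmul2l ?lee_fin// leeDl.
rewrite ge0_integralD//; last 4 first.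
- by move=> x _; rewrite mule_ge0 ?lee_fin.
- by apply: emeasurable_funM => //; exact/measurable_EFinP.
- by move=> x _; rewrite mule_ge0 ?lee_fin// adde_ge0// smear_ge0.
- apply: emeasurable_funM; first exact/measurable_EFinP.
  by apply: emeasurable_funD => //; exact: measurable_smear.
rewrite lte_add_pinfty ?integral_smear_wsquare_lty// ge0_integralZl//.
- by rewrite lte_mul_pinfty// lee_fin.
- exact/measurable_EFinP.
- by move=> x _; rewrite lee_fin.
Qed.

Lemma density_Om : density Om.
Proof.
split => //; rewrite (eq_integral (fun x => (Om x)%:E)) => [|x _].
  by apply: le_lt_trans integral_Om_le _; rewrite ltry.
by rewrite /wsquare expr2 -mulrA divff ?mulr1 ?gt_eqF.
Qed.

Lemma ae_smear4_lty b : density b -> {ae mu, forall x, (smear 4 b x < +oo)%E}.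
Proof.
move=> db; have [mb b0 _] := db.
have I : mu.-integrable setT (fun x => (Om x)%:E * smear 4 b x)%E.
  apply/integrableP; split.
    apply: emeasurable_funM; [exact/measurable_EFinP|exact: measurable_smear].
  under eq_integral do rewrite gee0_abs ?mule_ge0 ?smear_ge0 ?lee_fin//.
  exact: (density_pair_lty density_Om db).
have := integrable_ae measurableT I.
apply: filterS => x /(_ Logic.I) /=.
case: (smear 4 b x) => [r| |]//; first by rewrite ltry.
by rewrite gt0_muley ?lte_fin.
Qed.

(** The bootstrap. Inserting the assumed inequality into smear 4 a x leaves the
    integral in z of s x z ^+ 4 * Om z * smear 4 a z. By smear4_le with
    t = s x z ^+ 2 this is at most the integral of A * s x z ^+ 6 * Om z, plus that
    of s x z ^+ 2 * Om z * smear 2 (wsquare a) z. After an exchange of the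
    integrals the second one is the integral of wsquare a y against
    the integral in z of s x z ^+ 2 * s y z ^+ 2 * Om z, which is bounded
    uniformly in x and y. *)
Lemma density_smear4_bounded a (C : R) : density a -> 0 <= C ->
    {ae mu, forall z, ((a z)%:E <= C%:E * ((Om z)%:E * (1 + smear 4 a z)))%E} ->
  exists C', forall x, (smear 4 a x <= C'%:E)%E.
Proof.
move=> da C0 aC; have [ma a0 fa] := da.
have Wa0 := wsquare_ge0 a; have mWa := measurable_wsquare ma.
have Wfin : (\int[mu]_x (wsquare a x)%:E)%E \is a fin_num.
  by rewrite ge0_fin_numE//; apply: integral_ge0 => x _; rewrite lee_fin.
(* The three summands bound the integral in z of s ^+ 4 * Om, that of
   A * s ^+ 6 * Om, and the swapped double integral. *)
exists (C * (A + A * A + (A + A) * fine (\int[mu]_x (wsquare a x)%:E)%E)) => x.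
pose b z := s x z ^+ 2 * Om z.
have mb : measurable_fun [set: X] b by apply: measurable_funM => //; exact: measurable_funX.
have b0 z : 0 <= b z by rewrite mulr_ge0 ?exprn_ge0.
pose c z := s x z ^+ 4 * Om z + A * (s x z ^+ 6 * Om z).
have mc : measurable_fun [set: X] c.
  apply: measurable_funD; first by apply: measurable_funM => //; exact: measurable_funX.
  by apply: measurable_funM => //; apply: measurable_funM => //; exact: measurable_funX.
have c0 z : 0 <= c z by rewrite addr_ge0 ?mulr_ge0 ?exprn_ge0.
have mD : measurable_fun [set: X] (fun z => (c z)%:E + (b z)%:E * smear 2 (wsquare a) z)%E.
  apply: emeasurable_funD; first exact/measurable_EFinP.
  by apply: emeasurable_funM; [exact/measurable_EFinP|exact: measurable_smear].
have D0 z : (0 <= (c z)%:E + (b z)%:E * smear 2 (wsquare a) z)%E.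
  by rewrite adde_ge0 ?mule_ge0 ?lee_fin ?smear_ge0.
apply: (@le_trans _ _ (\int[mu]_z (C%:E * ((c z)%:E + (b z)%:E * smear 2 (wsquare a) z)))%E).
  apply: ae_ge0_le_integral => //.
  - by move=> z _; rewrite lee_fin mulr_ge0 ?exprn_ge0.
  - by apply/measurable_EFinP/measurable_funM => //; exact: measurable_funX.
  - by move=> z _; rewrite mule_ge0 ?lee_fin.
  - exact: emeasurable_funM.
  apply: filterS aC => z az _.
  rewrite EFinM; apply: le_trans (lee_wpmul2l _ az) _; first by rewrite lee_fin exprn_ge0.
  rewrite muleCA lee_wpmul2l ?lee_fin// muleA -EFinM.
  have t0 : 0 < s x z ^+ 2 by rewrite exprn_gt0// (lt_le_trans ltr01).
  apply: (@le_trans _ _ ((s x z ^+ 4 * Om z)%:E * (1 + ((s x z ^+ 2)%:E%R * A%:E + ((s x z ^+ 2)^-1)%:E%R * smear 2 (wsquare a) z)))%E).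
    rewrite lee_wpmul2l ?lee_fin ?mulr_ge0 ?exprn_ge0// leeD2l//; exact: smear4_le.
  rewrite ge0_muleDr ?mule1//; last by rewrite adde_ge0// mule_ge0 ?lee_fin ?smear_ge0 ?invr_ge0 ?exprn_ge0.
  rewrite ge0_muleDr; last 2 first.
  - by rewrite mule_ge0 ?lee_fin ?exprn_ge0.
  - by rewrite mule_ge0 ?lee_fin ?smear_ge0 ?invr_ge0 ?exprn_ge0.
  rewrite addeA muleA -!EFinM -EFinD muleA -EFinM leeD//.
    by rewrite lee_fin /c lerD2l; apply: le_of_eq; ring.
  have -> // : s x z ^+ 4 * Om z / s x z ^+ 2 = b z.
  by rewrite /b; field; rewrite gt_eqF// (lt_le_trans ltr01).
rewrite ge0_integralZl//.
rewrite EFinM lee_wpmul2l ?lee_fin//.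
rewrite ge0_integralD//; last 4 first.
- by move=> z _; rewrite lee_fin.
- exact/measurable_EFinP.
- by move=> z _; rewrite mule_ge0 ?smear_ge0 ?lee_fin.
- by apply: emeasurable_funM; [exact/measurable_EFinP|exact: measurable_smear].
rewrite EFinD; apply: leeD.
  rewrite /c; under eq_integral do rewrite EFinD [X in (_ + X)%E]EFinM.
  have mn n : measurable_fun [set: X] (fun z => (s x z ^+ n * Om z)%:E).
    by apply/measurable_EFinP/measurable_funM => //; exact: measurable_funX.
  rewrite ge0_integralD//; last 3 first.
  - by move=> z _; rewrite lee_fin mulr_ge0 ?exprn_ge0.
  - by move=> z _; rewrite mule_ge0 ?lee_fin ?mulr_ge0 ?exprn_ge0.
  - exact: emeasurable_funM.
  rewrite EFinD leeD//; first exact: (@smear_Om_le 4).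
  rewrite ge0_integralZl//; last first.
    by move=> z _; rewrite lee_fin mulr_ge0 ?exprn_ge0.
  by rewrite EFinM lee_wpmul2l ?lee_fin//; exact: s6Om.
rewrite smear_swap// EFinM fineK// muleC -ge0_integralZr//; last 3 first.
- exact/measurable_EFinP.
- by move=> y _; rewrite lee_fin.
- by rewrite lee_fin addr_ge0.
apply: ge0_le_integral => //.
- by move=> y _; rewrite mule_ge0 ?smear_ge0 ?lee_fin.
- by apply: emeasurable_funM; [exact/measurable_EFinP|exact: measurable_smear].
- by apply: emeasurable_funM => //; exact/measurable_EFinP.
move=> y _; rewrite lee_wpmul2l ?lee_fin// EFinD.
(* The product of two squares of s is at most the sum of their sixth powers. *)
apply: (@le_trans _ _ (smear 6 Om y + smear 6 Om x)%E); last by apply: leeD; exact: s6Om.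
have m6 u : measurable_fun [set: X] (fun z => (s u z ^+ 6 * Om z)%:E).
  by apply/measurable_EFinP/measurable_funM => //; exact: measurable_funX.
have p6 u z : (0 <= (s u z ^+ 6 * Om z)%:E)%E by rewrite lee_fin mulr_ge0 ?exprn_ge0.
rewrite /smear -ge0_integralD//; apply: ge0_le_integral => //.
- by move=> z _; rewrite lee_fin mulr_ge0 ?exprn_ge0.
- by apply/measurable_EFinP/measurable_funM => //; exact: measurable_funX.
- exact: emeasurable_funD.
move=> z _; rewrite -EFinD lee_fin /b mulrA -mulrDl ler_wpM2r//.
have := s_exp y z (isT : (4 <= 6)%N); have := s_exp x z (isT : (4 <= 6)%N).
rewrite -![s _ _ ^+ 4]/(_ ^+ (2 + 2)) !exprD.
have := sqr_ge0 (s y z ^+ 2 - s x z ^+ 2); have := sqr_ge0 (s y z ^+ 2); nra.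
Qed.

Lemma ae_eq_integrable (f g : X -> \bar R) : mu.-integrable setT f ->
  measurable_fun [set: X] g -> ae_eq mu setT f g -> mu.-integrable setT g.
Proof.
move=> /integrableP[mf fi] mg fg; apply/integrableP; split => //.
rewrite (@ge0_ae_eq_integral _ _ _ mu setT _ (fun x => `|f x|%E))//; [exact: measurableT_comp..|].
by apply: filterS fg => x /(_ Logic.I) ->.
Qed.

Definition weighted (u : X -> R) (x : X) : R := w x * `|u x|.

Definition potential (k : X -> X -> R) (u : X -> R) (x : X) : R :=
  \int[mu]_y (k x y * u y).

Definition mkernel (k : X -> X -> R) : Prop :=
  measurable_fun [set: X * X] (fun z => k z.1 z.2).

Implicit Types (k : X -> X -> R) (u : X -> R).

Let mweighted u : measurable_fun [set: X] u -> measurable_fun [set: X] (weighted u).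
Proof. by move=> mu'; apply: measurable_funM => //; exact: measurableT_comp. Qed.

Let weighted_ge0 u x : 0 <= weighted u x.
Proof. by rewrite mulr_ge0. Qed.

Lemma measurable_kernel_mul k u x : mkernel k -> measurable_fun [set: X] u ->
  measurable_fun [set: X] (fun y => k x y * u y).
Proof.
move=> mk mu'; apply: measurable_funM => //.
exact: (measurableT_comp mk (pair1_measurable x)).
Qed.

Lemma measurable_potential k u : mkernel k -> measurable_fun [set: X] u ->
  measurable_fun [set: X] (potential k u).
Proof.
move=> mk mu'; apply: (measurableT_comp (@fine_measurable R setT measurableT)).
have mF : measurable_fun [set: X * X] (fun z => (k z.1 z.2 * u z.2)%:E).
  by apply/measurable_EFinP/measurable_funM => //; exact: measurableT_comp.
under eq_fun do rewrite integralE.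
apply: emeasurable_funB.
- have : measurable_fun setT (fubini_F mu ((fun z : X * X => (k z.1 z.2 * u z.2)%:E)^\+)%E).
    by apply: measurable_fun_fubini_tonelli_F => //; exact: measurable_funepos.
  apply: eq_measurable_fun => x _; apply: eq_integral => y _.
  by rewrite ?funepos.unlock ?funeneg.unlock.
- have : measurable_fun setT (fubini_F mu ((fun z : X * X => (k z.1 z.2 * u z.2)%:E)^\-)%E).
    by apply: measurable_fun_fubini_tonelli_F => //; exact: measurable_funeneg.
  apply: eq_measurable_fun => x _; apply: eq_integral => y _.
  by rewrite ?funepos.unlock ?funeneg.unlock.
Qed.

(** When f is not integrable the right-hand side is infinite. *)
Lemma normr_Rintegral_le (f : X -> R) : measurable_fun [set: X] f ->
  (`|\int[mu]_y f y|%:E <= \int[mu]_y `|f y|%:E)%E.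
Proof.
move=> mf; have [fin|nfin] := boolP (mu.-integrable setT (EFin \o f)).
  rewrite EFin_normr_Rintegral//.
  by apply: (le_trans (le_abse_integral mu measurableT _)) => //; exact/measurable_EFinP.
suff -> : (\int[mu]_y `|f y|%:E = +oo)%E by rewrite leey.
apply/eqP; rewrite -leye_eq leNgt; apply: contra nfin => fin.
by apply/integrableP; split => //; exact/measurable_EFinP.
Qed.

Lemma ge0_le_integral_Zr (f g : X -> R) (C : R) : measurable_fun [set: X] f ->
    measurable_fun [set: X] g -> (forall y, 0 <= f y) -> (forall y, 0 <= g y) ->
    0 <= C -> {ae mu, forall y, f y <= C * g y} ->
  (\int[mu]_y (f y)%:E <= C%:E * \int[mu]_y (g y)%:E)%E.
Proof.
move=> mf mg f0 g0 C0 fg; rewrite -ge0_integralZl//; last 2 first.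
- exact/measurable_EFinP.
- by move=> y _; rewrite lee_fin.
apply: ae_ge0_le_integral => //.
- by move=> y _; rewrite lee_fin.
- exact/measurable_EFinP.
- by move=> y _; rewrite mule_ge0 ?lee_fin.
- by apply: emeasurable_funM => //; exact/measurable_EFinP.
- by apply: filterS fg => y fgy _; rewrite -EFinM lee_fin.
Qed.

(** A bound on the kernel in the second variable only; c is the bound that
    depends on the first one. *)
Lemma normr_kernel_le k u x (c : R) : mkernel k -> measurable_fun [set: X] u -> 0 <= c ->
    (forall y, `|k x y| <= c * w y * s x y ^+ 4) ->
  (\int[mu]_y `|k x y * u y|%:E <= c%:E * smear 4 (weighted u) x)%E.
Proof.
move=> mk mu' c0 kc; apply: ge0_le_integral_Zr => //.
- by apply: measurableT_comp => //; exact: measurable_kernel_mul.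
- by apply: measurable_funM; [exact: measurable_funX|exact: mweighted].
- by move=> y; rewrite mulr_ge0 ?exprn_ge0.
- apply: nearW => y; rewrite normrM /weighted.
  apply: le_trans (ler_wpM2r _ (kc y)) _ => //.
  by apply: le_of_eq; ring.
Qed.

Lemma normr_potential_le k u x (c : R) : mkernel k -> measurable_fun [set: X] u -> 0 <= c ->
    (forall y, `|k x y| <= c * w y * s x y ^+ 4) ->
  (`|potential k u x|%:E <= c%:E * smear 4 (weighted u) x)%E.
Proof.
move=> mk mu' c0 kc; apply: le_trans (normr_Rintegral_le _) _; first exact: measurable_kernel_mul.
exact: normr_kernel_le.
Qed.

(** The bound is symmetric in both variables, so that pairings of a density with
    the potential of another one converge absolutely. *)
Definition dominated_kernel k : Prop :=
  mkernel k /\ exists2 C, 0 <= C & forall x y, `|k x y| <= C * w x * w y * s x y ^+ 4.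

Lemma dominated_kernel_flip k : dominated_kernel k -> dominated_kernel (fun x y => k y x).
Proof.
move=> [mk [C C0 kC]]; split; first exact: (measurableT_comp mk (@measurable_swap _ _ X X)).
by exists C => // x y; rewrite s_sym; apply: le_trans (kC y x) _; rewrite (mulrAC C).
Qed.

Definition weighted_density u : Prop := measurable_fun [set: X] u /\ density (weighted u).

Lemma ae_integrable_kernel k u : dominated_kernel k -> weighted_density u ->
  {ae mu, forall x, mu.-integrable setT (fun y => (k x y * u y)%:E)}.
Proof.
move=> [mk [C C0 kC]] [mu' du]; apply: filterS (ae_smear4_lty du) => x xoo.
apply/integrableP; split; first by apply/measurable_EFinP; exact: measurable_kernel_mul.
have Cw : 0 <= C * w x by rewrite mulr_ge0.
apply: le_lt_trans (normr_kernel_le mk mu' Cw (kC x)) _.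
by rewrite lte_mul_pinfty// lee_fin.
Qed.

Lemma integrable_pair k u v : dominated_kernel k -> weighted_density u -> weighted_density v ->
  (mu \x mu)%E.-integrable [set: X * X] (fun z => (u z.1 * (k z.1 z.2 * v z.2))%:E).
Proof.
move=> [mk [C C0 kC]] [mu' du] [mv dv]; apply/integrable12ltyP => /=.
  apply/measurable_EFinP/measurable_funM; first exact: measurableT_comp.
  by apply: measurable_funM => //; exact: measurableT_comp.
have [mau au0 _] := du; have [mav av0 _] := dv.
apply: (@le_lt_trans _ _ (\int[mu]_x (C%:E * ((weighted u x)%:E * smear 4 (weighted v) x)))%E).
  apply: ge0_le_integral => //.
  - by move=> x _; exact: integral_ge0.
  - apply: (@measurable_fun_fubini_tonelli_F _ _ _ _ _ mu
      (fun z : X * X => `|(u z.1 * (k z.1 z.2 * v z.2))%:E|%E)) => //.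
    apply/measurableT_comp => //; apply/measurable_EFinP/measurable_funM; first exact: measurableT_comp.
    by apply: measurable_funM => //; exact: measurableT_comp.
  - by apply: emeasurable_funM => //; apply: emeasurable_funM; [exact/measurable_EFinP|exact: measurable_smear].
  - move=> x _; have Cw : 0 <= C * w x by rewrite mulr_ge0.
    have := normr_kernel_le mk mv Cw (kC x).
    have mkv : measurable_fun [set: X] (fun y => `|k x y * v y|%:E).
      by apply/measurable_EFinP; apply: measurableT_comp => //; exact: measurable_kernel_mul.
    move=> /(@lee_wpmul2l R `|u x|%:E); rewrite lee_fin => /(_ (normr_ge0 _)) h.
    apply: le_trans (le_trans h _).
      rewrite -ge0_integralZl//.
      by apply: le_of_eq; apply: eq_integral => y _; rewrite -EFinM -normrM.
    rewrite !muleA -!EFinM lee_wpmul2r ?smear_ge0// lee_fin /weighted.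
    by apply: le_of_eq; ring.
rewrite ge0_integralZl//; last 2 first.
- by apply: emeasurable_funM; [exact/measurable_EFinP|exact: measurable_smear].
- by move=> x _; rewrite mule_ge0 ?lee_fin ?smear_ge0.
by rewrite lte_mul_pinfty ?density_pair_lty.
Qed.

Lemma ae_potential_section k u v : dominated_kernel k -> weighted_density v ->
  ae_eq mu setT (fun x => \int[mu]_y (u x * (k x y * v y))%:E)%E
               (fun x => (u x * potential k v x)%:E).
Proof.
move=> dk dv; apply: filterS (ae_integrable_kernel dk dv) => x ix _.
under eq_integral do rewrite EFinM.
by rewrite integralZl// EFinM /potential fineK// integrable_fin_num.
Qed.

Lemma integrable_potential k u v : dominated_kernel k -> weighted_density u -> weighted_density v ->
  mu.-integrable setT (fun x => (u x * potential k v x)%:E).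
Proof.
move=> dk du dv; have iuv := integrable_pair dk du dv.
apply: (ae_eq_integrable _ _ (ae_potential_section u dk dv)).
  exact: (integrable_fubini_F iuv).
by apply/measurable_EFinP/measurable_funM; [exact: du.1|apply: measurable_potential; [exact: dk.1|exact: dv.1]].
Qed.

(** Fubini for the absolutely convergent double integral of integrable_pair. *)
Lemma Rintegral_potential_swap k u v : dominated_kernel k -> weighted_density u -> weighted_density v ->
  \int[mu]_x (u x * potential k v x) = \int[mu]_x (v x * potential (fun x y => k y x) u x).
Proof.
move=> dk du dv; have iuv := integrable_pair dk du dv; have dk' := dominated_kernel_flip dk.
have mp k' u' v' : dominated_kernel k' -> weighted_density u' -> weighted_density v' ->
    measurable_fun [set: X] (fun x => (u' x * potential k' v' x)%:E).
  move=> dk1 [mu' _] [mv _]; apply/measurable_EFinP/measurable_funM => //; apply: measurable_potential => //.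
  exact: dk1.1.
have E1 : (\int[mu]_x (u x * potential k v x)%:E = \int[mu]_x \int[mu]_y (u x * (k x y * v y))%:E)%E.
  apply/esym/ae_eq_integral => //; [|exact: mp|exact: ae_potential_section].
  exact: (measurable_fubini_F iuv).
have E2 : (\int[mu]_x (v x * potential (fun x y => k y x) u x)%:E =
    \int[mu]_x \int[mu]_y (v x * (k y x * u y))%:E)%E.
  apply/esym/ae_eq_integral => //; [|exact: mp|exact: ae_potential_section].
  exact: (measurable_fubini_F (integrable_pair dk' dv du)).
rewrite /Rintegral E1 E2 (Fubini iuv)/=; congr fine.
apply: eq_integral => y _; apply: eq_integral => x _.
by congr EFin; ring.
Qed.

Lemma weighted_density_le u (K : R) : measurable_fun [set: X] u -> 0 <= K ->
  (forall x, weighted u x <= K * Om x) -> weighted_density u.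
Proof.
move=> mu' K0 uK; split=> //; split => //; first exact: mweighted.
have h x : wsquare (weighted u) x <= K ^+ 2 * Om x.
  rewrite /wsquare ler_pdivrMr// -mulrA -expr2 -exprMn.
  by rewrite ler_pXn2r ?nnegrE ?mulr_ge0.
apply: (@le_lt_trans _ _ ((K ^+ 2)%:E * \int[mu]_x (Om x)%:E)%E).
  apply: ge0_le_integral_Zr => //; [exact/measurable_wsquare/mweighted|exact: wsquare_ge0|exact: sqr_ge0|exact: nearW].
rewrite lte_mul_pinfty ?lee_fin ?sqr_ge0//.
by apply: le_lt_trans integral_Om_le _; rewrite ltry.
Qed.

Lemma integrable_kernel_le k u (K : R) x : dominated_kernel k ->
    measurable_fun [set: X] u -> 0 <= K -> (forall y, weighted u y <= K * Om y) ->
  mu.-integrable setT (fun y => (k x y * u y)%:E).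
Proof.
move=> [mk [C C0 kC]] mu' K0 uK.
apply/integrableP; split; first by apply/measurable_EFinP; exact: measurable_kernel_mul.
have Cw : 0 <= C * w x by rewrite mulr_ge0.
apply: le_lt_trans (normr_kernel_le mk mu' Cw (kC x)) _.
rewrite lte_mul_pinfty ?lee_fin// ?smear_ge0//.
apply: (@le_lt_trans _ _ (K%:E * smear 4 Om x)%E).
  apply: ge0_le_integral_Zr => //.
  - by apply: measurable_funM; [exact: measurable_funX|exact: mweighted].
  - by apply: measurable_funM => //; exact: measurable_funX.
  - by move=> y; rewrite mulr_ge0 ?exprn_ge0.
  - by move=> y; rewrite mulr_ge0 ?exprn_ge0.
  - by apply: nearW => y; rewrite [leRHS]mulrCA ler_wpM2l ?exprn_ge0.
rewrite lte_mul_pinfty ?lee_fin// ?smear_ge0//.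
by apply: le_lt_trans (@smear_Om_le 4 x isT) _; rewrite ltry.
Qed.

(** By smear4_sqr_le the square of the product is at most a multiple of Om times
    smear 2, plus Om, and both are integrable. *)
Lemma weighted_L2_potential k v (q : X -> R) : mkernel k -> weighted_density v ->
    measurable_fun [set: X] q ->
    (exists2 C, 0 < C & forall x y, `|q x| * `|k x y| <= C * Num.sqrt (Om x) * w y * s x y ^+ 4) ->
  (\int[mu]_x ((q x * potential k v x) ^+ 2)%:E < +oo)%E.
Proof.
move=> mk dv mq [C C0 qk]; have [mv [mav av0 _]] := dv.
have mW := measurable_wsquare mav; have W0 := wsquare_ge0 (weighted v).
have mP : measurable_fun [set: X] (fun x => q x * potential k v x).
  by apply: measurable_funM => //; exact: measurable_potential.
pose D x := ((Om x)%:E * (smear 2 (wsquare (weighted v)) x + 1))%E.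
have mD : measurable_fun [set: X] D.
  apply: emeasurable_funM; first exact/measurable_EFinP.
  by apply: emeasurable_funD => //; exact: measurable_smear.
have D0 x : (0 <= D x)%E by rewrite mule_ge0 ?lee_fin// adde_ge0// smear_ge0.
have C2 : 0 <= C ^+ 2 * (A + 1) ^+ 2 by rewrite mulr_ge0 ?sqr_ge0.
have C0' := ltW C0.
apply: (@le_lt_trans _ _ (\int[mu]_x ((C ^+ 2 * (A + 1) ^+ 2)%:E * D x))%E); last first.
  rewrite ge0_integralZl//; apply: lte_mul_pinfty => //.
  exact: (integral_smear_wsquare_lty dv.2).
apply: ge0_le_integral => //.
- by move=> x _; rewrite lee_fin sqr_ge0.
- by apply/measurable_EFinP; exact: measurable_funX.
- exact: emeasurable_funM.
move=> x _; set r := Num.sqrt (Om x).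
have r0 : 0 < r by rewrite sqrtr_gt0.
have Cr : 0 <= C * r by rewrite mulr_ge0// ltW.
have h : (`|q x * potential k v x|%:E <= (C * r)%:E * smear 4 (weighted v) x)%E.
  have mqk : mkernel (fun x y => q x * k x y).
    by apply: measurable_funM => //; exact: measurableT_comp.
  apply: le_trans (normr_kernel_le mqk mv Cr (_ : forall y, `|q x * k x y| <= C * r * w y * s x y ^+ 4)); last first.
    by move=> y; rewrite normrM.
  rewrite normrM EFinM.
  apply: le_trans (lee_wpmul2l _ (normr_Rintegral_le (measurable_kernel_mul x mk mv))) _; first by rewrite lee_fin.
  have mkv : measurable_fun [set: X] (fun y => `|k x y * v y|%:E).
    by apply/measurable_EFinP; apply: measurableT_comp => //; exact: measurable_kernel_mul.
  rewrite -ge0_integralZl//; apply: le_of_eq.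
  by apply: eq_integral => y _; rewrite -EFinM -normrM mulrA.
have Cr0 : 0 <= (C * r)^-1 by rewrite invr_ge0.
have Crp : 0 < C * r by rewrite mulr_gt0.
pose p := `|q x * potential k v x| / (C * r).
have p0 : 0 <= p by rewrite divr_ge0.
have ps : (p%:E <= smear 4 (weighted v) x)%E.
  by rewrite /p mulrC EFinM lee_pdivrMl.
have -> : (q x * potential k v x) ^+ 2 = (C ^+ 2 * Om x) * p ^+ 2.
  have -> : Om x = r ^+ 2 by rewrite sqr_sqrtr.
  rewrite /p expr_div_n -normrX ger0_norm ?sqr_ge0//.
  by field; rewrite !gt_eqF.
rewrite EFinM; apply: le_trans (lee_wpmul2l _ (smear4_sqr_le mav av0 p0 ps)) _.
  by rewrite lee_fin mulr_ge0// exprn_ge0.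
rewrite /D !muleA -!EFinM lee_wpmul2r//; first by rewrite adde_ge0// smear_ge0.
by rewrite lee_fin; apply: le_of_eq; ring.
Qed.

(** The factor w y ^+ 2 lost in the bound of the kernel is paid by the decay of
    u, and Om integrates what remains. *)
Lemma potential_decay k u (C K : R) : mkernel k -> measurable_fun [set: X] u ->
    0 <= C -> 0 <= K ->
    {ae mu, forall y, w y ^+ 2 * `|u y| <= K * Om y} ->
    (forall x y, w x * `|k x y| <= C * w y ^+ 2 * s x y ^+ 4) ->
  forall x, w x * `|potential k u x| <= C * K * A.
Proof.
move=> mk mu' C0 K0 uK kC x; rewrite -lee_fin EFinM.
apply: le_trans (lee_wpmul2l _ (normr_Rintegral_le (measurable_kernel_mul x mk mu'))) _; first by rewrite lee_fin.
have mku : measurable_fun [set: X] (fun y => `|k x y * u y|).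
  by apply: measurableT_comp => //; exact: measurable_kernel_mul.
have mkuE : measurable_fun [set: X] (fun y => `|k x y * u y|%:E) by exact/measurable_EFinP.
rewrite -ge0_integralZl ?lee_fin//.
rewrite [leRHS]EFinM; apply: le_trans (lee_wpmul2l _ (@smear_Om_le 4 x isT)); last by rewrite lee_fin mulr_ge0.
under eq_integral do rewrite -EFinM.
apply: ge0_le_integral_Zr => //.
- by apply: measurable_funM => //; exact: measurable_cst.
- by apply: measurable_funM => //; exact: measurable_funX.
- by move=> y; rewrite mulr_ge0.
- by move=> y; rewrite mulr_ge0 ?exprn_ge0.
- by rewrite mulr_ge0.
- apply: filterS uK => y uy; rewrite normrM mulrA.
  apply: le_trans (ler_wpM2r _ (kC x y)) _ => //.
  have -> : C * w y ^+ 2 * s x y ^+ 4 * `|u y| = C * s x y ^+ 4 * (w y ^+ 2 * `|u y|) by ring.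
  have -> : C * K * (s x y ^+ 4 * Om y) = C * s x y ^+ 4 * (K * Om y) by ring.
  by rewrite ler_wpM2l// mulr_ge0 ?exprn_ge0.
Qed.

End schur.

(** * The plane, its weights and its kernels *)

Lemma measurable_sqrtr (R : realType) : measurable_fun [set: R] (@Num.sqrt R).
Proof. by apply: nondecreasing_measurable => // x y; exact: ler_wsqrtr. Qed.

Section plane_measure.
Context (R : realType).

Lemma leb2_sigma_finite : sigma_finite setT (leb2 R).
Proof.
have /sigma_finiteP[F [TF ndF Foo]] := sigma_finiteT (@lebesgue_measure R).
exists (fun n => F n `*` F n).
  rewrite -setXTT TF predeqE => -[x y]; split.
    move=> [/= [n _ Fnx] [k _ Gky]]; exists (maxn n k) => //; split.
    - by move: x Fnx; exact/subsetPset/ndF/leq_maxl.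
    - by move: y Gky; exact/subsetPset/ndF/leq_maxr.
  by move=> [n _ []/= ? ?]; split; exists n.
move=> k; have [? ?] := Foo k; split; first exact: measurableX.
have -> : leb2 R (F k `*` F k) = (lebesgue_measure (F k) * lebesgue_measure (F k))%E.
  exact: product_measure1E.
by rewrite lte_mul_pinfty// ge0_fin_numE.
Qed.

Definition plane_measure : {sigma_finite_measure set _ -> \bar R} :=
  HB.pack (leb2 R : set _ -> \bar R) (Measure.class (leb2 R))
    (Measure_isSigmaFinite.Build _ _ _ (leb2 R) leb2_sigma_finite).

Definition square (c : R * R) (r : R) : set (R * R) :=
  `[c.1 - r, c.1 + r]%classic `*` `[c.2 - r, c.2 + r]%classic.

Lemma measurable_square c r : measurable (square c r).
Proof. by apply: measurableX; exact: measurable_itv. Qed.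

Lemma leb2_square c r : 0 <= r -> leb2 R (square c r) = (4 * r ^+ 2)%:E.
Proof.
move=> r0.
have E t : lebesgue_measure `[t - r, t + r]%classic = (2 * r)%:E.
  rewrite lebesgue_measure_itv/= lte_fin; case: ltP => [_|h].
    by rewrite -EFinB; congr EFin; ring.
  by have -> : r = 0; [lra|rewrite mulr0].
transitivity (lebesgue_measure `[(c.1 - r)%R, (c.1 + r)%R]%classic * lebesgue_measure `[(c.2 - r)%R, (c.2 + r)%R]%classic)%E.
  by apply: product_measure1E; exact: measurable_itv.
by rewrite !E -EFinM; congr EFin; ring.
Qed.

Lemma squareP c r x : square c r x <-> `|x.1 - c.1| <= r /\ `|x.2 - c.2| <= r.
Proof.
rewrite /square /= !in_itv /= !ler_norml; split.
- by move=> [/andP[? ?] /andP[? ?]]; split; apply/andP; split; lra.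
- by move=> [/andP[? ?] /andP[? ?]]; split; apply/andP; split; lra.
Qed.

Lemma dyadic_scale (p : nat) (t : R) : (1 < p)%N -> 1 <= t ->
  exists n, p%:R ^+ n <= t < p%:R ^+ n.+1.
Proof.
move=> p1 t1; have t0 : 0 <= t by lra.
have /andP[lt1 lt2] := truncn_itv t0.
have m0 : (0 < Num.truncn t)%N by rewrite truncn_gt0.
have /andP[l1 l2] := trunc_log_bounds p1 m0.
exists (trunc_log p (Num.truncn t)); apply/andP; split.
  by apply: le_trans lt1; rewrite -natrX ler_nat.
by apply: (lt_le_trans lt2); rewrite -natrX ler_nat.
Qed.

(** The square of index n contributes at most a n times its area, which is a term
    of a geometric series. *)
Lemma integral_dyadic_le (F : R * R -> R) c (a r : nat -> R) (K q : R) :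
    measurable_fun setT F -> (forall x, 0 <= F x) ->
    (forall n, 0 <= a n) -> (forall n, 0 <= r n) ->
    0 <= K -> 0 <= q < 1 -> (forall n, a n * (4 * r n ^+ 2) <= K * q ^+ n) ->
    (forall x, F x != 0 -> exists2 n, F x <= a n & square c (r n) x) ->
  (\int[leb2 R]_x (F x)%:E <= (K / (1 - q))%:E)%E.
Proof.
move=> mF F0 a0 r0 K0 /andP[q0 q1] arq Fle.
pose G n x : \bar R := (a n * \1_(square c (r n)) x)%:E.
have G0 n x : (0 <= G n x)%E by rewrite lee_fin mulr_ge0.
have mG n : measurable_fun setT (G n).
  apply/measurable_EFinP/measurable_funM => //.
  by apply: measurable_indic; exact: measurable_square.
apply: (@le_trans _ _ (\int[leb2 R]_x \sum_(n <oo) G n x)%E).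
  apply: ge0_le_integral => //.
  - by move=> x _; rewrite lee_fin.
  - exact/measurable_EFinP.
  - by apply: (@ge0_emeasurable_sum _ _ _ setT G predT) => // k _; exact: mG.
  move=> x _; have [->|/Fle[n Fn sn]] := eqVneq (F x) 0.
    exact: nneseries_ge0.
  apply: le_trans (nneseries_lim_ge n.+1 _) => //.
  rewrite big_nat_recr//= -[leLHS]add0e leeD ?sume_ge0//.
  by rewrite /G indicE mem_set// mulr1 lee_fin.
rewrite integral_nneseries//.
have S n : (\int[leb2 R]_x G n x <= (K * q ^+ n)%:E)%E.
  rewrite /G; under eq_integral do rewrite EFinM.
  have ms := measurable_square c (r n).
  rewrite ge0_integralZl_EFin//; last by apply/measurable_EFinP/measurable_indic.
  by rewrite integral_indic// setIT leb2_square// -EFinM lee_fin.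
apply: lime_le.
  by apply: is_cvg_nneseries => n _ _; exact: integral_ge0.
apply: nearW => n.
apply: (@le_trans _ _ (\sum_(0 <= k < n) (K * q ^+ k)%:E)%E); first exact: lee_sum.
rewrite sumEFin lee_fin -mulr_sumr ler_wpM2l//.
have q1' : 0 < 1 - q by rewrite subr_gt0.
rewrite -[leRHS]mul1r ler_pdivlMr// big_mkord.
have -> : (\sum_(i < n) q ^+ i) * (1 - q) = 1 - q ^+ n.
  by rewrite -[RHS]opprB subrX1; ring.
by rewrite lerBlDr lerDl exprn_ge0.
Qed.

Lemma measurable_enorm : measurable_fun [set: R * R] (@enorm R).
Proof.
apply: (measurableT_comp (@measurable_sqrtr R)).
by apply: measurable_funD; apply: measurable_funX.
Qed.

Lemma enorm_ge0 (x : R * R) : 0 <= enorm x. Proof. exact: sqrtr_ge0. Qed.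

Lemma sqr_enorm (x : R * R) : enorm x ^+ 2 = x.1 ^+ 2 + x.2 ^+ 2.
Proof. by rewrite sqr_sqrtr// addr_ge0 ?sqr_ge0. Qed.

Lemma sqr_japanese (x : R * R) : japanese x ^+ 2 = 1 + x.1 ^+ 2 + x.2 ^+ 2.
Proof. by rewrite sqr_sqrtr ?addr_ge0 ?sqr_ge0// sqr_enorm addrA. Qed.

Lemma japanese_ge1 (x : R * R) : 1 <= japanese x.
Proof. by rewrite -[leLHS]sqrtr1 ler_wsqrtr// lerDl sqr_ge0. Qed.

Lemma japanese_gt0 (x : R * R) : 0 < japanese x.
Proof. exact: lt_le_trans (japanese_ge1 x). Qed.

Lemma measurable_japanese : measurable_fun [set: R * R] (@japanese R).
Proof.
apply: (measurableT_comp (@measurable_sqrtr R)).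
by apply: measurable_funD => //; apply: measurable_funX; exact: measurable_enorm.
Qed.

Lemma enorm_eq0 (x : R * R) : enorm x = 0 -> x = 0.
Proof.
move=> x0; have := sqr_enorm x; rewrite x0 expr0n/= => /esym/eqP.
rewrite paddr_eq0 ?sqr_ge0// !sqrf_eq0 => /andP[/eqP x10 /eqP x20].
by case: x x10 x20 {x0} => a b /= -> ->.
Qed.

Lemma le_normr_enorm1 (x : R * R) : `|x.1| <= enorm x.
Proof. by rewrite -sqrtr_sqr ler_wsqrtr// lerDl sqr_ge0. Qed.

Lemma le_normr_enorm2 (x : R * R) : `|x.2| <= enorm x.
Proof. by rewrite -sqrtr_sqr ler_wsqrtr// lerDr sqr_ge0. Qed.

Lemma enormC (x y : R * R) : enorm (x - y) = enorm (y - x).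
Proof. by rewrite /enorm -(sqrrN (x - y).1) -(sqrrN (x - y).2) /= !opprB. Qed.

(** The triangle inequality in the three-dimensional space where the
    japanese bracket is the norm of (1, x1, x2). *)
Lemma japanese_triangle (x y : R * R) : japanese x <= japanese y + enorm (x - y).
Proof.
have jy := japanese_gt0 y; have e0 := enorm_ge0 (x - y).
rewrite -ler_sqr ?nnegrE; last 2 first.
- exact: ltW (japanese_gt0 x).
- by rewrite addr_ge0// ltW.
have cs : (y.1 * (x - y).1 + y.2 * (x - y).2) <= japanese y * enorm (x - y).
  apply: le_trans (ler_norm _) _.
  rewrite -ler_sqr ?nnegrE ?mulr_ge0 ?(ltW jy)// -normrX ger0_norm ?sqr_ge0// exprMn.
  rewrite sqr_japanese sqr_enorm.
  set a := (x - y).1; set b := (x - y).2.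
  have := sqr_ge0 (y.1 * b - y.2 * a); have := sqr_ge0 a; have := sqr_ge0 b; nra.
rewrite sqrrD sqr_enorm !sqr_japanese.
have -> : x.1 = y.1 + (x - y).1 by rewrite /=; ring.
have -> : x.2 = y.2 + (x - y).2 by rewrite /=; ring.
move: cs; set a := (x - y).1; set b := (x - y).2; nra.
Qed.

Lemma enorm_triangle (x y : R * R) : enorm (x - y) <= japanese x + japanese y.
Proof.
have jx := japanese_gt0 x; have jy := japanese_gt0 y.
rewrite -ler_sqr ?nnegrE ?addr_ge0 ?enorm_ge0 ?ltW//.
have cs : - (x.1 * y.1 + x.2 * y.2) <= japanese x * japanese y.
  apply: le_trans (ler_norm _) _; rewrite normrN.
  rewrite -ler_sqr ?nnegrE ?mulr_ge0 ?(ltW jy) ?(ltW jx)// -normrX ger0_norm ?sqr_ge0// exprMn.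
  rewrite !sqr_japanese.
  by have := sqr_ge0 (x.1 * y.2 - x.2 * y.1); have := sqr_ge0 x.1; have := sqr_ge0 x.2;
     have := sqr_ge0 y.1; have := sqr_ge0 y.2; nra.
rewrite sqrrD sqr_enorm !sqr_japanese /=; nra.
Qed.

(** The shell where 2^n <= <x> < 2^(n+1) has area of order 4^n. *)
Lemma integral_japanese_le (p : R) : 2 < p ->
  (\int[leb2 R]_x (japanese x `^ (- p))%:E <= (16 / (1 - 2 `^ (2 - p)))%:E)%E.
Proof.
move=> p2.
apply: (@integral_dyadic_le _ 0 (fun n => (2 ^+ n) `^ (- p)) (fun n => 2 ^+ n.+1)) => //.
- by apply: (measurableT_comp (measurable_powR _)); exact: measurable_japanese.
- by move=> x; exact: powR_ge0.
- rewrite powR_ge0/= /powR pnatr_eq0/= -[ltRHS]expR0 ltr_expR.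
  by have : 0 < ln 2 :> R; [rewrite ln_gt0// ltr1n|nra].
- move=> n.
  have -> : (2 `^ (2 - p)) ^+ n = (2 ^+ n) ^+ 2 * (2 ^+ n) `^ (- p) :> R.
    rewrite -(powR_mulrn n (powR_ge0 2 (2 - p))) -powRrM.
    rewrite -(powR_mulrn 2 (exprn_ge0 n (ler0n R 2))) -(powR_mulrn n (ler0n R 2)) -!powRrM.
    by rewrite -powRD ?pnatr_eq0 ?implybT//; congr (_ `^ _); ring.
  apply: le_of_eq; rewrite [2 ^+ n.+1]exprS.
  by set b := (2 ^+ n : R); set c := b `^ _; ring.
- move=> x _; have [n /andP[n1 n2]] := dyadic_scale (isT : (1 < 2)%N) (japanese_ge1 x).
  exists n.
    have j0 := japanese_gt0 x.
    rewrite !powRN lef_pV2 ?posrE ?powR_gt0 ?exprn_gt0//.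
    apply: ge0_ler_powR; rewrite ?nnegrE ?exprn_ge0 ?(ltW j0)//; lra.
  have jn : enorm x <= 2 ^+ n.+1.
    apply: le_trans (ltW n2); rewrite -ler_sqr ?nnegrE ?enorm_ge0 ?(ltW (japanese_gt0 _))//.
    by rewrite sqr_japanese sqr_enorm; lra.
  apply/squareP; rewrite !subr0; split.
    exact: le_trans (le_normr_enorm1 x) jn.
  exact: le_trans (le_normr_enorm2 x) jn.
Qed.

(** The fourth root makes the fourth power of sker comparable with 1 / |x - y|
    near the diagonal, while its sixth power remains locally integrable. *)
Definition invroot (x : R * R) : R := (Num.sqrt (Num.sqrt (enorm x)))^-1.

Definition sker (x y : R * R) : R := 1 + invroot (x - y).

Lemma invroot_ge0 x : 0 <= invroot x.
Proof. by rewrite invr_ge0 sqrtr_ge0. Qed.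

Lemma measurable_invroot : measurable_fun [set: R * R] invroot.
Proof.
apply: measurable_funV => [x|]; first exact: sqrtr_ge0.
apply: (measurableT_comp (@measurable_sqrtr R)).
apply: (measurableT_comp (@measurable_sqrtr R)); exact: measurable_enorm.
Qed.

Lemma invroot4 x : invroot x ^+ 4 = (enorm x)^-1.
Proof.
by rewrite exprVn -[4%N]/(2 * 2)%N exprM !sqr_sqrtr ?sqrtr_ge0 ?enorm_ge0.
Qed.

Lemma measurable_subz : measurable_fun [set: (R * R) * (R * R)] (fun z => z.1 - z.2).
Proof.
by apply/measurable_fun_pairP; split; apply: measurable_funB; apply: measurableT_comp => //.
Qed.

Definition singular6 (x y : R * R) : R :=
  if enorm (x - y) < 1 then invroot (x - y) ^+ 6 else 0.

(** Where |x - y| is between 16^(-n-1) and 16^(-n), the function is at most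
    2^(6 (n+1)), on an area of order 16^(-2 n): the terms decrease like 4^(-n). *)
Lemma integral_singular6_le x : (\int[leb2 R]_y (singular6 x y)%:E <= (256 / (1 - 4^-1))%:E)%E.
Proof.
apply: (@integral_dyadic_le _ x (fun n => (2 ^+ n.+1) ^+ 6) (fun n => 16^-1 ^+ n)).
- have mx : measurable_fun [set: R * R] (fun y => x - y).
    exact: (measurableT_comp measurable_subz (pair1_measurable x)).
  apply: measurable_fun_ifT => //.
    by apply: measurable_fun_ltr => //; exact: (measurableT_comp measurable_enorm mx).
  by apply: measurable_funX; exact: (measurableT_comp measurable_invroot mx).
- by move=> y; rewrite /singular6; case: ifP => // _; rewrite exprn_ge0 ?invroot_ge0.
- by move=> n; rewrite !exprn_ge0.
- by move=> n; rewrite exprn_ge0.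
- exact: ler0n.
- by apply/andP; split; lra.
- move=> n; apply: le_of_eq.
  have -> : (16^-1 ^+ n : R) = 2^-1 ^+ n ^+ 4 by rewrite exprAC; congr (_ ^+ n); lra.
  have -> : (4^-1 ^+ n : R) = 2^-1 ^+ n ^+ 2 by rewrite exprAC; congr (_ ^+ n); lra.
  have a0 : 2^-1 ^+ n != 0 :> R by rewrite expf_neq0// invr_neq0.
  have -> : 2 ^+ n.+1 = 2 * (2^-1 ^+ n)^-1 :> R by rewrite exprS -exprVn invrK.
  by set a := 2^-1 ^+ n in a0 *; field.
- move=> y; rewrite /singular6; case: ifPn; last by rewrite eqxx.
  move=> r1 i0.
  have r0 : 0 < enorm (x - y).
    rewrite lt_def enorm_ge0 andbT; apply: contra i0 => /eqP r0.
    by rewrite /invroot r0 !sqrtr0 invr0 expr0n.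
  have ri1 : 1 <= (enorm (x - y))^-1 by rewrite invf_ge1// ltW.
  have [n /andP[n1 n2]] := dyadic_scale (isT : (1 < 16)%N) ri1.
  exists n.
    rewrite ler_pXn2r ?nnegrE ?invroot_ge0 ?exprn_ge0//.
    rewrite -(@ler_pXn2r _ 4%N)// ?nnegrE ?invroot_ge0 ?exprn_ge0// invroot4.
    apply: (le_trans (ltW n2)); apply: le_of_eq.
    by rewrite exprAC; congr (_ ^+ _); rewrite -natrX.
  have rn : enorm (x - y) <= 16^-1 ^+ n.
    by rewrite exprVn -[leLHS]invrK lef_pV2 ?posrE ?invr_gt0 ?exprn_gt0.
  apply/squareP; split; apply: le_trans rn; rewrite enormC.
    exact: le_trans (le_normr_enorm1 (y - x)) _.
  exact: le_trans (le_normr_enorm2 (y - x)) _.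
Qed.

Lemma sker6_le x y : sker x y ^+ 6 <= 64 * (1 + singular6 x y).
Proof.
rewrite /singular6 /sker.
have q0 := invroot_ge0 (x - y); have := invroot4 (x - y).
set q := invroot (x - y) in q0 *; set r := enorm (x - y).
have r0 : 0 <= r by exact: enorm_ge0.
have e2 : (2 : R) ^+ 6 = 64 by rewrite -natrX.
case: ltP => r1 q4; last first.
  have q1 : q <= 1.
    rewrite -(@ler_pXn2r _ 4%N)// ?nnegrE// q4 expr1n invf_le1//.
    exact: lt_le_trans r1.
  rewrite addr0 mulr1 -e2 ler_pXn2r ?nnegrE ?addr_ge0//; lra.
have [q0'|qn0] := eqVneq q 0.
  by rewrite q0' addr0 expr1n expr0n addr0; lra.
have q1 : 1 <= q.
  rewrite -(@ler_pXn2r _ 4%N)// ?nnegrE// expr1n q4 invf_ge1 ?ltW//.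
  rewrite lt_def r0 andbT; apply: contra qn0 => /eqP r00.
  by rewrite /q /invroot -/r r00 !sqrtr0 invr0.
apply: (@le_trans _ _ ((2 * q) ^+ 6)).
  by rewrite ler_pXn2r ?nnegrE ?addr_ge0 ?mulr_ge0//; lra.
rewrite exprMn e2 ler_pM2l//; lra.
Qed.

Lemma sker_ge1 x y : 1 <= sker x y.
Proof. by rewrite lerDl invroot_ge0. Qed.

Lemma skerC x y : sker x y = sker y x.
Proof. by rewrite /sker /invroot enormC. Qed.

Lemma measurable_sker : measurable_fun [set: (R * R) * (R * R)] (fun z => sker z.1 z.2).
Proof.
apply: measurable_funD => //.
exact: (measurableT_comp measurable_invroot measurable_subz).
Qed.

Variable eps : R.
Hypothesis eps_gt0 : 0 < eps.

Definition Omega (x : R * R) : R := japanese x `^ (- (2 + 2 * eps)).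

Lemma Omega_gt0 x : 0 < Omega x.
Proof. by rewrite powR_gt0// japanese_gt0. Qed.

Lemma Omega_le1 x : Omega x <= 1.
Proof. by rewrite /Omega -[leRHS](powRr0 (japanese x)) ler_powR ?japanese_ge1//; move: eps_gt0; lra. Qed.

Lemma measurable_Omega : measurable_fun [set: R * R] Omega.
Proof. by apply: (measurableT_comp (measurable_powR _)); exact: measurable_japanese. Qed.

Definition schur_const : R := 64 * (16 / (1 - 2 `^ (2 - (2 + 2 * eps))) + 256 / (1 - 4^-1)).

(** Away from the diagonal the kernel is bounded and Om integrates it; near the
    diagonal Om is at most 1 and integral_singular6_le applies. *)
Lemma plane_schur : schur_weight plane_measure sker Omega (@japanese R) schur_const.
Proof.
have main x : (\int[leb2 R]_y (sker x y ^+ 6 * Omega y)%:E <= schur_const%:E)%E.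
  have ms6 : measurable_fun [set: R * R] (singular6 x).
    have mx : measurable_fun [set: R * R] (fun y => x - y).
      exact: (measurableT_comp measurable_subz (pair1_measurable x)).
    apply: measurable_fun_ifT => //.
      by apply: measurable_fun_ltr => //; exact: (measurableT_comp measurable_enorm mx).
    by apply: measurable_funX; exact: (measurableT_comp measurable_invroot mx).
  have s60 y : 0 <= singular6 x y.
    by rewrite /singular6; case: ifP => // _; rewrite exprn_ge0 ?invroot_ge0.
  have mO := measurable_Omega.
  have O0 y := ltW (Omega_gt0 y).
  apply: (@le_trans _ _ (\int[leb2 R]_y ((64%:E * (Omega y)%:E) + (64%:E * (singular6 x y)%:E)))%E).
    apply: ge0_le_integral => //.
    - by move=> y _; rewrite lee_fin mulr_ge0// exprn_ge0// (le_trans ler01)// sker_ge1.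
    - apply/measurable_EFinP/measurable_funM => //; apply: measurable_funX.
      exact: (measurableT_comp measurable_sker (pair1_measurable x)).
    - by apply: emeasurable_funD; apply: emeasurable_funM => //; exact/measurable_EFinP.
    - move=> y _; rewrite -!EFinM -EFinD lee_fin.
      apply: le_trans (ler_wpM2r (O0 y) (sker6_le x y)) _.
      by have := Omega_le1 y; have := s60 y; have := O0 y; nra.
  rewrite ge0_integralD//; last 4 first.
  - by move=> y _; rewrite mule_ge0 ?lee_fin.
  - by apply: emeasurable_funM => //; exact/measurable_EFinP.
  - by move=> y _; rewrite mule_ge0 ?lee_fin.
  - by apply: emeasurable_funM => //; exact/measurable_EFinP.
  rewrite !ge0_integralZl//; last 4 first.
  - exact/measurable_EFinP.
  - by move=> y _; rewrite lee_fin.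
  - exact/measurable_EFinP.
  - by move=> y _; rewrite lee_fin.
  have -> : schur_const%:E = (64%:E * (16 / (1 - 2 `^ (2 - (2 + 2 * eps))))%:E +
      64%:E * (256 / (1 - 4^-1))%:E)%E.
    by rewrite -!EFinM -EFinD -mulrDr.
  apply: leeD; rewrite lee_wpmul2l ?lee_fin//.
    by apply: integral_japanese_le; move: eps_gt0; lra.
  exact: integral_singular6_le.
split => //.
- rewrite -lee_fin; apply: le_trans (main 0); apply: integral_ge0 => y _.
  by rewrite lee_fin mulr_ge0 ?(ltW (Omega_gt0 y))// exprn_ge0// (le_trans ler01)// sker_ge1.
- exact: measurable_sker.
- exact: sker_ge1.
- exact: skerC.
- exact: measurable_Omega.
- exact: Omega_gt0.
- exact: measurable_japanese.
- by move=> x; exact: ltW (japanese_gt0 x).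
Qed.

Definition lnker (x y : R * R) : R := ln (enorm (x - y)).

Definition gradker (j : 'I_2) (x y : R * R) : R :=
  (if j == 0 then (x - y).1 else (x - y).2) / enorm (x - y) ^+ 2.

(** Differs from lnker by a function of x alone, which a density with integral 0
    does not see; unlike lnker it decays in x. *)
Definition relker (x y : R * R) : R := ln (enorm (x - y)) - ln (japanese x).

Lemma ge1_sker4 x y : 1 <= sker x y ^+ 4.
Proof. by rewrite exprn_ege1// sker_ge1. Qed.

Lemma invr_enorm_le x y : (enorm (x - y))^-1 <= sker x y ^+ 4.
Proof.
rewrite -invroot4 ler_pXn2r ?nnegrE ?invroot_ge0 ?(le_trans ler01 (sker_ge1 _ _))//.
by rewrite /sker lerDr.
Qed.

Lemma ln_le_subr1 (t : R) : 0 < t -> ln t <= t - 1.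
Proof.
move=> t0; have := @le_ln1Dx R (t - 1); rewrite addrCA subrr addr0; apply; lra.
Qed.

Lemma normr_lnker_le x y : `|lnker x y| <= 3 * japanese x * japanese y * sker x y ^+ 4.
Proof.
have := enorm_ge0 (x - y); have := invr_enorm_le x y; have := enorm_triangle x y.
have := japanese_ge1 x; have := japanese_ge1 y; have := ge1_sker4 x y; rewrite /lnker.
set a := japanese x; set b := japanese y; set S := sker x y ^+ 4; set r := enorm _.
move=> S1 b1 a1 rab rS; have [a0 b0 S0] : [/\ 0 <= a, 0 <= b & 0 <= S] by split; lra.
rewrite le_eqVlt => /orP[/eqP <-|r0].
  by rewrite ln0// normr0 (mulr_ge0 (mulr_ge0 (mulr_ge0 _ a0) b0) S0).
have h1 := ln_le_subr1 r0.
have h2 : - ln r <= r^-1 - 1 by rewrite -lnV ?posrE// ln_le_subr1// invr_gt0.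
have ri0 : 0 < r^-1 by rewrite invr_gt0.
have aS : a + b + S <= 3 * a * b * S.
  have ab : a * b <= a * b * S by rewrite ler_peMr// mulr_ge0//; lra.
  have Sab : S <= a * b * S by rewrite ler_peMl ?mulr_ege1//; lra.
  nra.
apply: le_trans aS; rewrite ler_norml; apply/andP; split; lra.
Qed.

Lemma normr_gradker_le j x y : `|gradker j x y| <= (enorm (x - y))^-1.
Proof.
have r0 := enorm_ge0 (x - y).
have -> : (enorm (x - y))^-1 = enorm (x - y) / enorm (x - y) ^+ 2.
  have [->|rn] := eqVneq (enorm (x - y)) 0; first by rewrite invr0 mul0r.
  by rewrite expr2 invfM mulrA divff// mul1r.
rewrite /gradker normrM [`|_^-1|]ger0_norm ?invr_ge0 ?sqr_ge0// ler_wpM2r ?invr_ge0 ?sqr_ge0//.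
by case: ifP => _; [exact: le_normr_enorm1|exact: le_normr_enorm2].
Qed.

Lemma normr_gradker_le_sker j x y : `|gradker j x y| <= sker x y ^+ 4.
Proof. exact: le_trans (normr_gradker_le j x y) (invr_enorm_le x y). Qed.

(** From <x> <= <y> + |x - y|. *)
Lemma gradker_decay j x y : japanese x * `|gradker j x y| <= 2 * japanese y ^+ 2 * sker x y ^+ 4.
Proof.
have := enorm_ge0 (x - y); have := invr_enorm_le x y; have := japanese_triangle x y.
have := normr_gradker_le j x y.
have := japanese_ge1 x; have := japanese_ge1 y; have := ge1_sker4 x y.
set a := japanese x; set b := japanese y; set S := sker x y ^+ 4; set r := enorm _.
move=> S1 b1 a1 gr abr rS r0.
have ri0 : 0 <= r^-1 by rewrite invr_ge0.
apply: (@le_trans _ _ (a * r^-1)); first by rewrite ler_wpM2l//; lra.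
apply: (@le_trans _ _ ((b + r) * r^-1)); first by rewrite ler_wpM2r.
have rr : r * r^-1 <= 1.
  have [->|rn] := eqVneq r 0; first by rewrite mul0r.
  by rewrite divff.
have h1 : b * r^-1 <= b * S by rewrite ler_wpM2l//; lra.
have h2 : b * S <= b ^+ 2 * S.
  by rewrite expr2 -mulrA ler_peMl// mulr_ge0//; lra.
have h3 : 1 <= b ^+ 2 * S by rewrite mulr_ege1// exprn_ege1.
rewrite mulrDl; nra.
Qed.

(** From ln t <= t - 1 for the ratio of |x - y| and <x> and for its inverse:
    both numbers differ by at most <y>. *)
Lemma normr_relker_mul_le x y :
  (`|relker x y| <= 2 * japanese y * sker x y ^+ 4) /\
  (japanese x * `|relker x y| <= 3 * japanese y ^+ 2 * sker x y ^+ 4).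
Proof.
have := enorm_ge0 (x - y); have := invr_enorm_le x y.
have := japanese_triangle x y; have := japanese_triangle y x; rewrite (enormC y x).
have := enorm_triangle x y; rewrite /relker.
have := japanese_ge1 x; have := japanese_ge1 y; have := ge1_sker4 x y.
have := @enorm_eq0 (x - y).
set a := japanese x; set b := japanese y; set S := sker x y ^+ 4; set r := enorm _.
move=> r00 S1 b1 a1 rab bar abr rS; rewrite le_eqVlt => /orP[/eqP r0|r0].
  have ab : a = b.
    by move: (r00 (esym r0)) => /eqP; rewrite subr_eq0 => /eqP xy; rewrite /a /b xy.
  rewrite -r0 ln0// sub0r normrN ger0_norm ?ln_ge0// ab.
  have lb : ln b <= b by have : 0 < b; [lra|move=> /ln_le_subr1; lra].
  have lb0 : 0 <= ln b by rewrite ln_ge0.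
  have bS : b <= b * S by rewrite ler_peMr//; lra.
  have b2S : b ^+ 2 <= b ^+ 2 * S by rewrite ler_peMr// sqr_ge0.
  split; first by lra.
  have : b * ln b <= b ^+ 2 by rewrite expr2 ler_wpM2l//; lra.
  by have := sqr_ge0 b; lra.
have a0 : 0 < a by lra.
have ri0 : 0 < r^-1 by rewrite invr_gt0.
have ai0 : 0 < a^-1 by rewrite invr_gt0.
have ai1 : a^-1 <= 1 by rewrite invf_le1.
have h1 : ln r - ln a <= b * (r^-1 + a^-1).
  rewrite -ln_div ?posrE//; apply: le_trans (ln_le_subr1 _) _; first by rewrite divr_gt0.
  have -> : r / a - 1 = (r - a) * a^-1 by field; rewrite gt_eqF.
  apply: (@le_trans _ _ (b * a^-1)); first by rewrite ler_wpM2r//; lra.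
  rewrite ler_wpM2l//; lra.
have h2 : ln a - ln r <= b * (r^-1 + a^-1).
  rewrite -ln_div ?posrE//; apply: le_trans (ln_le_subr1 _) _; first by rewrite divr_gt0.
  have -> : a / r - 1 = (a - r) * r^-1 by field; rewrite gt_eqF.
  apply: (@le_trans _ _ (b * r^-1)); first by rewrite ler_wpM2r//; lra.
  rewrite ler_wpM2l//; lra.
have h : `|ln r - ln a| <= b * (r^-1 + a^-1) by rewrite ler_norml; apply/andP; split; lra.
split.
  apply: (le_trans h); rewrite -mulrA mulrCA ler_wpM2l//; lra.
apply: (@le_trans _ _ (a * (b * (r^-1 + a^-1)))); first by rewrite ler_wpM2l//; lra.
have -> : a * (b * (r^-1 + a^-1)) = b * (a * r^-1 + 1) by field; rewrite !gt_eqF.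
have h3 : a * r^-1 <= b * S + 1.
  apply: (@le_trans _ _ ((b + r) * r^-1)); first by rewrite ler_wpM2r//; lra.
  rewrite mulrDl divff ?gt_eqF// lerD2r ler_wpM2l//; lra.
have bS : 1 <= b * S by rewrite mulr_ege1.
apply: (@le_trans _ _ (b * (3 * (b * S)))); first by rewrite ler_wpM2l//; lra.
by apply: le_of_eq; ring.
Qed.

Lemma mkernel_lnker : mkernel lnker.
Proof.
apply: (measurableT_comp (@measurable_ln R)).
exact: (measurableT_comp measurable_enorm measurable_subz).
Qed.

Lemma mkernel_gradker j : mkernel (gradker j).
Proof.
have mr := measurableT_comp measurable_enorm measurable_subz.
apply: measurable_funM.
  by case: (j == 0); [exact: (measurableT_comp _ measurable_subz)|exact: (measurableT_comp _ measurable_subz)].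
by apply: measurable_funV => [x|]; [exact: sqr_ge0|exact: measurable_funX].
Qed.

Lemma mkernel_relker : mkernel relker.
Proof.
apply: measurable_funB; first exact: mkernel_lnker.
apply: (measurableT_comp (@measurable_ln R)).
by apply: (measurableT_comp measurable_japanese).
Qed.

Lemma dominated_lnker : dominated_kernel sker (@japanese R) lnker.
Proof. by split; [exact: mkernel_lnker|exists 3 => // x y; exact: normr_lnker_le]. Qed.

Lemma dominated_gradker j : dominated_kernel sker (@japanese R) (gradker j).
Proof.
split; [exact: mkernel_gradker|exists 1 => // x y].
apply: le_trans (normr_gradker_le_sker j x y) _.
have := ge1_sker4 x y; have := japanese_ge1 x; have := japanese_ge1 y => b1 a1 S1.
by rewrite mul1r ler_peMl ?mulr_ege1//; lra.
Qed.

End plane_measure.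

(** * The weak gradient of a logarithmic potential *)

Section plane_topology.
Context (R : realType).

(** The measurable sets of the plane are generated by products; an open set is a
    union of squares with rational data. *)
Lemma open_measurable2 (O : set (R * R)) : open O -> measurable O.
Proof.
move=> oO.
pose F n : set (R * R) := if @unpickle (rat * rat * nat)%type n is Some (p, q, k) then
  (if `[< square (ratr p, ratr q) k.+1%:R^-1 `<=` O >] then square (ratr p, ratr q) k.+1%:R^-1 else set0)
  else set0.
suff -> : O = \bigcup_n F n.
  apply: bigcupT_measurable => n; rewrite /F.
  case: unpickle => [[[p q] k]|]; last exact: measurable0.
  by case: ifP => _; [exact: measurable_square|exact: measurable0].
apply/seteqP; split => [x Ox|x [n _]]; last first.
  by rewrite /F; case: unpickle => [[[p q] k]|//]; case: asboolP => // h; exact: h.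
have : nbhs x O by exact: open_nbhs_nbhs.
move=> /nbhs_ballP[e /= e0 xeO].
have [k ke] : exists k : nat, k.+1%:R^-1 < e / 2.
  have [k kp] := @ltr_add_invr R 0 (e / 2) (divr_gt0 e0 (ltr0n _ 2)).
  by exists k; rewrite add0r in kp.
have k0 : 0 < k.+1%:R^-1 :> R by rewrite invr_gt0.
have kk (t : R) : t - k.+1%:R^-1 < t + k.+1%:R^-1.
  by move: k0; set d := k.+1%:R^-1; lra.
have [p /=] := rat_in_itvoo (kk x.1).
rewrite in_itv/= => /andP[p1 p2].
have [q /=] := rat_in_itvoo (kk x.2).
rewrite in_itv/= => /andP[q1 q2].
move: k0 ke p1 p2 q1 q2; set dl := k.+1%:R^-1 => k0 ke p1 p2 q1 q2.
exists (pickle (p, q, k)); first exact: Logic.I.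
rewrite /F pickleK -/dl.
case: asboolP => [_|].
  by apply/squareP => /=; rewrite !ler_norml; split; apply/andP; split; lra.
case => y /squareP[/= y1 y2]; apply: xeO; split; rewrite /ball/= ltr_norml;
  move: y1 y2; rewrite !ler_norml => /andP[? ?] /andP[? ?]; apply/andP; split; lra.
Qed.

Lemma continuous_measurable2 (f : R * R -> R) : continuous f -> measurable_fun setT f.
Proof.
move=> cf; apply: (measurability (@RGenOInfty.G R)) => [|/= _ [_] [r] -> <-].
  exact: RGenOInfty.measurableE.
rewrite setTI; apply: open_measurable2; by apply: open_comp.
Qed.

Lemma compact_measurable2 (K : set (R * R)) : compact K -> measurable K.
Proof.
move=> cK; rewrite -(setCK K); apply: measurableC; apply: open_measurable2.
by rewrite openC; apply: compact_closed.
Qed.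

Lemma compact_square (c : R * R) (r : R) : compact (square c r).
Proof. by apply: compact_setX; exact: segment_compact. Qed.

Lemma compact_sub_square (K : set (R * R)) : compact K -> exists2 N, 0 <= N & K `<=` square 0 N.
Proof.
move=> /compact_bounded[M [_ MK]]; exists (`|M| + 1); first by rewrite addr_ge0.
move=> x Kx; have := MK (`|M| + 1) _ x Kx; rewrite ltr_pwDr ?ler_norm// => /(_ isT) xM.
apply/squareP; rewrite !subr0; split; apply: le_trans xM.
  by rewrite {2}/Num.norm/= le_max lexx.
by rewrite {2}/Num.norm/= le_max lexx orbT.
Qed.

Lemma continuous_bounded_square (f : R * R -> R) N : continuous f ->
  exists2 M, 0 <= M & forall x, square 0 N x -> `|f x| <= M.
Proof.
move=> cf; have : compact (f @` square 0 N).
  by apply: continuous_compact; [exact: continuous_subspaceT|exact: compact_square].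
move=> /compact_bounded[M [_ MK]]; exists (`|M| + 1); first by rewrite addr_ge0.
move=> x Nx; apply: (MK (`|M| + 1)); first by rewrite ltr_pwDr ?ler_norm.
by exists x.
Qed.

Lemma continuous_pairl (t : R) : continuous (fun s : R => (s, t)).
Proof.
move=> s U /= [[A B] /= [nA nB] AB].
by apply: filterS nA => s' As'; apply: AB; split => //; exact: nbhs_singleton nB.
Qed.

Lemma continuous_pairr (t : R) : continuous (fun s : R => (t, s)).
Proof.
move=> s U /= [[A B] /= [nA nB] AB].
by apply: filterS nB => s' Bs'; apply: AB; split => //; exact: nbhs_singleton nA.
Qed.

Lemma integral_derive_compact (F f : R -> R) (N : R) :
    (forall t : R, is_derive t (1 : R) F (f t)) -> continuous f ->
    (forall t : R, N < `|t| -> F t = 0) -> (forall t : R, N < `|t| -> f t = 0) ->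
  (\int[@lebesgue_measure R]_t (f t)%:E)%E = 0.
Proof.
move=> dF cf F0 f0; pose M : R := `|N| + 1.
have MN : N < M by rewrite ltr_pwDr ?ler_norm.
have M0 : 0 < M by rewrite ltr_wpDl.
have -> : (\int[@lebesgue_measure R]_t (f t)%:E = \int[@lebesgue_measure R]_(t in `[(- M)%R, M]) (f t)%:E)%E.
  rewrite [RHS]integral_mkcond; apply: eq_integral => t _; rewrite patchE.
  case: ifPn => //; rewrite notin_setE /= in_itv/= => /negP tM.
  rewrite f0//; apply: lt_trans MN _; rewrite ltNge; apply: contra tM.
  by rewrite ler_norml.
have cF : continuous F.
  move=> t; apply/differentiable_continuous/derivable1_diffP; exact: ex_derive.
rewrite (@continuous_FTC2 _ f F); first last.
- by move=> t _; rewrite derive1E; exact: derive_val.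
- split.
  + by move=> t _; exact: ex_derive.
  + by apply: cvg_at_right_filter; exact: cF.
  + by apply: cvg_at_left_filter; exact: cF.
- exact: continuous_subspaceT.
- lra.
by rewrite !F0 ?sube0// ?normrN (gtr0_norm M0).
Qed.

(** The difference quotients along an axis are those of the slice, so that
    partial derivatives in the plane and derivatives on lines coincide. *)
Lemma slice_quotient1 (h : R * R -> R) (t y : R) :
  (fun r : R => r^-1 *: ((h \o shift (t, y)) (r *: ((1, 0) : R * R)) - h (t, y))) =
  (fun r : R => r^-1 *: (((fun s => h (s, y)) \o shift t) (r *: (1 : R)) - h (t, y))).
Proof.
apply/funext => r /=; congr (_ *: (h _ - _)).
by congr pair; rewrite /= ?scaler0 ?add0r.
Qed.

Lemma slice_quotient2 (h : R * R -> R) (t y : R) :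
  (fun r : R => r^-1 *: ((h \o shift (t, y)) (r *: ((0, 1) : R * R)) - h (t, y))) =
  (fun r : R => r^-1 *: (((fun s => h (t, s)) \o shift y) (r *: (1 : R)) - h (t, y))).
Proof.
apply/funext => r /=; congr (_ *: (h _ - _)).
by congr pair; rewrite /= ?scaler0 ?add0r.
Qed.

Lemma is_derive_slice1 (h : R * R -> R) (t y : R) : derivable h (t, y) (1, 0) ->
  is_derive t (1 : R) (fun s => h (s, y)) ('D_(1, 0) h (t, y)).
Proof.
by move=> dh; split; [move: dh; rewrite /derivable slice_quotient1|rewrite /derive slice_quotient1].
Qed.

Lemma is_derive_slice2 (h : R * R -> R) (t y : R) : derivable h (t, y) (0, 1) ->
  is_derive y (1 : R) (fun s => h (t, s)) ('D_(0, 1) h (t, y)).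
Proof.
by move=> dh; split; [move: dh; rewrite /derivable slice_quotient2|rewrite /derive slice_quotient2].
Qed.

Lemma derive_sliceE1 (h : R * R -> R) (t y d : R) : is_derive t (1 : R) (fun s => h (s, y)) d ->
  derivable h (t, y) (1, 0) /\ 'D_(1, 0) h (t, y) = d.
Proof.
by move=> [dh <-]; split; [move: dh; rewrite /derivable slice_quotient1|rewrite /derive slice_quotient1].
Qed.

Lemma derive_sliceE2 (h : R * R -> R) (t y d : R) : is_derive y (1 : R) (fun s => h (t, s)) d ->
  derivable h (t, y) (0, 1) /\ 'D_(0, 1) h (t, y) = d.
Proof.
by move=> [dh <-]; split; [move: dh; rewrite /derivable slice_quotient2|rewrite /derive slice_quotient2].
Qed.

Lemma is_derive_ln_norm (a c t : R) : c != 0 ->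
  is_derive t (1 : R) (fun s => ln (Num.sqrt ((s - a) ^+ 2 + c ^+ 2)))
    ((t - a) / ((t - a) ^+ 2 + c ^+ 2)).
Proof.
move=> c0; set q := (t - a) ^+ 2 + c ^+ 2.
have q0 : 0 < q by rewrite ltr_wpDl ?sqr_ge0// exprn_even_gt0.
have dq : is_derive t (1 : R) (fun s : R => (s - a) ^+ 2 + c ^+ 2) (2 * (t - a)).
  apply: is_derive_eq; rewrite /GRing.scale/=; ring.
have ds := @is_derive1_comp _ Num.sqrt (fun s : R => (s - a) ^+ 2 + c ^+ 2) t _ _ (is_derive1_sqrt q0) dq.
have sq0 : 0 < Num.sqrt q by rewrite sqrtr_gt0.
have := @is_derive1_comp _ (@ln R) (Num.sqrt \o (fun s : R => (s - a) ^+ 2 + c ^+ 2)) t _ _ (is_derive1_ln sq0) ds.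
move=> h; apply: is_derive_eq h _.
have qs : q = Num.sqrt q ^+ 2 by rewrite sqr_sqrtr// ltW.
rewrite [in RHS]qs; field; exact: lt0r_neq0.
Qed.

(** On a line at distance |c| > 0 from the singularity the logarithm is smooth,
    and the integrand is the derivative of its product with H. *)
Lemma line_integration_by_parts (a c N : R) (H H' : R -> R) : c != 0 ->
    (forall t : R, is_derive t (1 : R) H (H' t)) -> continuous H' ->
    (forall t : R, N < `|t| -> H t = 0) -> (forall t : R, N < `|t| -> H' t = 0) ->
  (\int[@lebesgue_measure R]_t (ln (Num.sqrt ((t - a) ^+ 2 + c ^+ 2)) * H' t +
     (t - a) / ((t - a) ^+ 2 + c ^+ 2) * H t)%:E)%E = 0.
Proof.
move=> c0 dH cH' H0 H'0.
pose L (t : R) := ln (Num.sqrt ((t - a) ^+ 2 + c ^+ 2)).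
pose L' (t : R) := (t - a) / ((t - a) ^+ 2 + c ^+ 2).
have dL (t : R) : is_derive t (1 : R) L (L' t) by exact: is_derive_ln_norm.
apply: (@integral_derive_compact (L * H) _ N).
- move=> t; have := is_deriveM (dL t) (dH t) => h; apply: is_derive_eq h _.
  by rewrite /GRing.scale/= /L /L'; ring.
- have cL : continuous L.
    by move=> t; apply/differentiable_continuous/derivable1_diffP; case: (dL t).
  have cH : continuous H.
    by move=> t; apply/differentiable_continuous/derivable1_diffP; case: (dH t).
  have cta : continuous (fun t : R => t - a) by move=> t; apply: cvgB; [exact: cvg_id|exact: cvg_cst].
  have cq : continuous (fun t : R => (t - a) ^+ 2 + c ^+ 2).
    by move=> t; apply: cvgD; [rewrite expr2; apply: cvgM; exact: cta|exact: cvg_cst].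
  move=> t; apply: cvgD; apply: cvgM; [exact: cL|exact: cH'| |exact: cH].
  apply: cvgM; first exact: cta.
  apply: cvgV; last exact: cq.
  by rewrite gt_eqF// ltr_wpDl ?sqr_ge0// exprn_even_gt0.
- by move=> t Nt; rewrite /= fctE H0// mulr0.
- by move=> t Nt; rewrite H0// H'0// !mulr0 addr0.
Qed.

Lemma test_function_support (h : R * R -> R) : test_function h -> exists2 N, 0 <= N &
  forall x, ~ square 0 N x -> h x = 0 /\ forall j, 'D_(@basis2 R j) h x = 0.
Proof.
move=> [ch dh cdh /compact_sub_square[N N0 KN]]; exists N => // x Nx.
have nK : ~ closure [set x | h x != 0] x by move=> /KN.
have nh : \near x, h x = 0.
  have oC : open (~` closure [set x | h x != 0]) by rewrite openC; exact: closed_closure.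
  have : nbhs x (~` closure [set x | h x != 0]) by exact: open_nbhs_nbhs.
  apply: filterS => z nz; apply: contrapT => /eqP hz; apply: nz; exact: subset_closure.
split; first exact: nbhs_singleton nh.
by move=> j; rewrite (near_eq_derive _ (_ : \near x, h x = cst 0 x))// derive_cst.
Qed.

Lemma not_square1 N (x y : R) : N < `|x| -> ~ square 0 N (x, y).
Proof. by move=> Nx /squareP[/=]; rewrite subr0 leNgt Nx. Qed.

Lemma not_square2 N (x y : R) : N < `|y| -> ~ square 0 N (x, y).
Proof. by move=> Ny /squareP[_ /=]; rewrite subr0 leNgt Ny. Qed.

Variable eps : R.
Hypothesis eps_gt0 : 0 < eps.

Local Notation mu := (plane_measure R).
Local Notation Om := (Omega eps).
Local Notation w := (@japanese R).
Local Notation SW := (plane_schur eps_gt0).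

(** On a bounded set w is bounded and Om is bounded away from 0. *)
Lemma weighted_box (f : R * R -> R) N M : 0 <= N -> 0 <= M -> (forall x, ~ square 0 N x -> f x = 0) ->
  (forall x, square 0 N x -> `|f x| <= M) ->
  exists2 K, 0 <= K & forall x, weighted w f x <= K * Om x.
Proof.
move=> N0 M0 f0 fM; pose W := 1 + 2 * N.
have W0 : 0 < W by rewrite /W; lra.
exists (W * M / W `^ (- (2 + 2 * eps))); first by rewrite divr_ge0 ?powR_ge0// mulr_ge0// ltW.
move=> x; have p0 : 0 < W `^ (- (2 + 2 * eps)) by rewrite powR_gt0.
have [Nx|Nx] := pselect (square 0 N x); last first.
  by rewrite /weighted f0// normr0 mulr0 mulr_ge0 ?(ltW (Omega_gt0 _ _))// divr_ge0 ?(ltW p0)// mulr_ge0// ltW.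
have wW : w x <= W.
  rewrite -(@ler_pXn2r _ 2%N)// ?nnegrE ?(ltW W0) ?(ltW (japanese_gt0 x))// sqr_japanese.
  move: Nx => /squareP; rewrite !subr0 => -[x1 x2].
  have h1 : x.1 ^+ 2 <= N ^+ 2 by rewrite -[x.1 ^+ 2]real_normK ?num_real// ler_pXn2r ?nnegrE.
  have h2 : x.2 ^+ 2 <= N ^+ 2 by rewrite -[x.2 ^+ 2]real_normK ?num_real// ler_pXn2r ?nnegrE.
  rewrite /W; nra.
rewrite mulrAC ler_pdivlMr//; apply: ler_pM.
- by rewrite mulr_ge0// ltW// japanese_gt0.
- exact: ltW.
- by apply: ler_pM => //; [exact: ltW (japanese_gt0 x)|exact: fM].
- rewrite /Omega !powRN lef_pV2 ?posrE ?powR_gt0 ?japanese_gt0//.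
  apply: ge0_ler_powR => //; rewrite ?nnegrE ?(ltW W0) ?(ltW (japanese_gt0 x))//.
  by move: eps_gt0; lra.
Qed.

Lemma weighted_test (h : R * R -> R) : test_function h ->
  (exists2 K, 0 <= K & forall x, weighted w h x <= K * Om x) /\
  (forall j, exists2 K, 0 <= K & forall x, weighted w (fun x => 'D_(@basis2 R j) h x) x <= K * Om x).
Proof.
move=> th; have [N N0 h0] := test_function_support th; have [ch dh cdh _] := th.
split.
  have [M M0 hM] := continuous_bounded_square N ch.
  by apply: (weighted_box N0 M0 _ hM) => x /h0[].
move=> j; have [M M0 hM] := continuous_bounded_square N (cdh j).
by apply: (weighted_box N0 M0 _ hM) => x /h0[].
Qed.

Lemma measurable_test (h : R * R -> R) : test_function h ->
  measurable_fun setT h /\ forall j, measurable_fun setT (fun x => 'D_(@basis2 R j) h x).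
Proof.
by move=> [ch _ cdh _]; split; [exact: continuous_measurable2|move=> j; exact: continuous_measurable2].
Qed.

Lemma ae_neq (c : R) : {ae @lebesgue_measure R, forall t, t != c}.
Proof.
exists [set c]; split; [exact: measurable_set1|exact: lebesgue_measure_set1|].
by move=> t /= /negP; rewrite negbK => /eqP.
Qed.

(** Integrate first along the lines of direction j. The line through y, where the
    logarithm is singular, does not contribute. *)
Lemma kernel_integration_by_parts (j : 'I_2) (h : R * R -> R) (y : R * R) : test_function h ->
  \int[leb2 R]_x (lnker x y * 'D_(@basis2 R j) h x) = - \int[leb2 R]_x (gradker j x y * h x).
Proof.
move=> th; have [[K K0 hK] /(_ j)[K' K'0 hK']] := weighted_test th.
have [mh /(_ j) mdh] := measurable_test th.
have [N N0 h0] := test_function_support th; have [ch dh cdh _] := th.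
have i1 : (leb2 R).-integrable setT (fun x => (lnker x y * 'D_(@basis2 R j) h x)%:E).
  exact: (integrable_kernel_le SW y (dominated_kernel_flip SW (dominated_lnker R)) mdh K'0 hK').
have i2 : (leb2 R).-integrable setT (fun x => (gradker j x y * h x)%:E).
  exact: (integrable_kernel_le SW y (dominated_kernel_flip SW (dominated_gradker R j)) mh K0 hK).
apply/eqP; rewrite -addr_eq0 -RintegralD//; apply/eqP.
rewrite /Rintegral.
suff -> : (\int[leb2 R]_x (lnker x y * 'D_(@basis2 R j) h x + gradker j x y * h x)%:E = 0)%E by [].
have i3 : (leb2 R).-integrable setT (fun x => (lnker x y * 'D_(@basis2 R j) h x + gradker j x y * h x)%:E).
  by under eq_fun do rewrite EFinD; exact: integrableD.
(* Lines through y are left out: they form a null set of lines. *)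
have zero2 (G : R -> \bar R) (c : R) : measurable_fun setT G -> (forall t, t != c -> G t = 0) ->
    (\int[@lebesgue_measure R]_t G t = 0)%E.
  move=> mG G0; rewrite -(@integral0 _ _ _ (@lebesgue_measure R) setT).
  apply: ae_eq_integral => //; have [N' [mN' N'0 NE]] := ae_neq c.
  by exists N'; split => // t /= h'; apply: NE => /= tc; apply: h' => _; exact: G0.
have [j0|j1] := eqVneq j 0.
  rewrite -(@integral21_prod_meas1 _ _ _ _ R (@lebesgue_measure R) (@lebesgue_measure R) _ i3).
  apply: (zero2 _ y.2); first exact: measurable_fubini_G i3.
  move=> t ty; rewrite /fubini_G /=.
  have c0 : t - y.2 != 0 by rewrite subr_eq0.
  rewrite -[RHS](@line_integration_by_parts y.1 (t - y.2) N (fun s => h (s, t))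
    (fun s => 'D_(@basis2 R j) h (s, t)) c0).
  - by apply: eq_integral => s _; rewrite /gradker /lnker /enorm j0/= sqr_sqrtr// addr_ge0 ?sqr_ge0.
  - by move=> s; have := dh j (s, t); rewrite j0; exact: is_derive_slice1.
  - move=> s; apply: (@continuous_comp _ _ _ (fun s : R => (s, t)) ('D_(@basis2 R j) h)); last exact: cdh.
    exact: continuous_pairl.
  - by move=> s Ns; case: (h0 (s, t)) => //; exact: not_square1.
  - by move=> s Ns; case: (h0 (s, t)) => [|_]; [exact: not_square1|exact].
have jE : basis2 R j = (0, 1) by rewrite /basis2 (negbTE j1).
rewrite -(@integral12_prod_meas1 _ _ _ _ R (@lebesgue_measure R) (@lebesgue_measure R) _ i3).
apply: (zero2 _ y.1); first exact: measurable_fubini_F i3.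
move=> t ty; rewrite /fubini_F /=.
have c0 : t - y.1 != 0 by rewrite subr_eq0.
rewrite -[RHS](@line_integration_by_parts y.2 (t - y.1) N (fun s => h (t, s))
  (fun s => 'D_(@basis2 R j) h (t, s)) c0).
- apply: eq_integral => s _; rewrite /gradker /lnker /enorm (negbTE j1)/= sqr_sqrtr ?addr_ge0 ?sqr_ge0//.
  by rewrite [(t - y.1) ^+ 2 + _]addrC.
- by move=> s; have := dh j (t, s); rewrite jE; exact: is_derive_slice2.
- move=> s; apply: (@continuous_comp _ _ _ (fun s : R => (t, s)) ('D_(@basis2 R j) h)); last exact: cdh.
  exact: continuous_pairr.
- by move=> s Ns; case: (h0 (t, s)) => //; exact: not_square2.
- by move=> s Ns; case: (h0 (t, s)) => [|_]; [exact: not_square2|exact].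
Qed.

(** Fubini puts the derivative of h and the kernel under one integral in x, where
    kernel_integration_by_parts applies for each y. *)
Lemma weak_gradient_potential (j : 'I_2) (u h : R * R -> R) :
    weighted_density mu Om w u -> test_function h ->
  \int[leb2 R]_x (potential mu (@lnker R) u x * 'D_(@basis2 R j) h x) =
  - \int[leb2 R]_x (potential mu (@gradker R j) u x * h x).
Proof.
move=> du th; have [[K K0 hK] /(_ j)[K' K'0 hK']] := weighted_test th.
have [mh /(_ j) mdh] := measurable_test th.
have dh : weighted_density mu Om w h by exact: (weighted_density_le SW mh K0 hK).
have ddh : weighted_density mu Om w (fun x => 'D_(@basis2 R j) h x).
  exact: (weighted_density_le SW mdh K'0 hK').
under eq_Rintegral do rewrite mulrC.
under [in RHS]eq_Rintegral do rewrite mulrC.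
rewrite [LHS](Rintegral_potential_swap SW (dominated_lnker R) ddh du).
rewrite [in RHS](Rintegral_potential_swap SW (dominated_gradker R j) dh du).
have E x : potential mu (fun x y => lnker y x) (fun x => 'D_(@basis2 R j) h x) x =
    - potential mu (fun x y => gradker j y x) h x.
  exact: kernel_integration_by_parts.
under eq_Rintegral do rewrite E mulrN.
under eq_Rintegral do rewrite -mulN1r.
rewrite RintegralZl// ?mulN1r//.
exact: (integrable_potential SW (dominated_kernel_flip SW (dominated_gradker R j)) du dh).
Qed.

End plane_topology.

(** * Uniqueness of weak derivatives *)

(** The sets over which an integrable g has integral 0 form a Dynkin system; the
    map p transports a generating pi-system, so that one coordinate can be
    treated at a time. *)
Lemma integral_pi_system_eq0 d d' (X : measurableType d) (Y : measurableType d') (R : realType)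
    (mu : {measure set X -> \bar R}) (g : X -> \bar R) (E : set X) (p : X -> Y) (G : set (set Y)) :
    mu.-integrable setT g -> measurable E -> measurable_fun setT p ->
    @measurable _ Y = <<s G >> -> setI_closed G ->
    (forall B, G B -> \int[mu]_(x in E `&` p @^-1` B) g x = 0)%E ->
    (\int[mu]_(x in E) g x = 0)%E ->
  forall B, measurable B -> (\int[mu]_(x in E `&` p @^-1` B) g x = 0)%E.
Proof.
move=> ig mE mp GE GI G0 E0 B.
have mpB C : measurable C -> measurable (E `&` p @^-1` C).
  by move=> mC; apply: measurableI => //; rewrite -[_ @^-1` _]setTI; exact: mp.
have igS C : measurable C -> mu.-integrable C g.
  by move=> mC; exact: integrableS ig.
rewrite {1}GE; move: B.
apply: (@dynkin_induction _ _ _ (fun B => (\int[mu]_(x in E `&` p @^-1` B) g x = 0)%E) GE GI) => //; first by rewrite preimage_setT setIT.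
- move=> S mS S0.
  have mD := igS _ mE; have D : E = (E `&` p @^-1` S) `|` (E `&` p @^-1` (~` S)).
    by rewrite -setIUr preimage_setC setUv setIT.
  move: E0; rewrite {1}D integral_setU ?S0 ?add0e//.
  + exact: mpB.
  + by apply: mpB; exact: measurableC.
  + by apply: (@measurable_funS _ _ _ _ setT) => //; exact: measurable_int ig.
  + by apply/disj_setPS => x [[_ /= ?] [_ /=]].
- move=> F mF tF F0; rewrite preimage_bigcup setI_bigcupr integral_bigcup.
  + by rewrite eseries0.
  + by apply/trivIsetP => i j _ _ ij; rewrite setIACA setIid -preimage_setI; move/trivIsetP: tF => ->//; rewrite preimage_set0 setI0.
  + by move=> k; exact: mpB.
  + by apply: igS; apply: bigcup_measurable => k _; exact: mpB.
Qed.

Section weak_uniqueness.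
Context (R : realType).

(** Test functions only have to be continuously differentiable, which the square
    of a positive part is. *)
Definition pospart2 (t : R) : R := Num.max t 0 ^+ 2.

Lemma continuous_pos : continuous (fun t : R => Num.max t 0).
Proof. by move=> t; apply: continuous_max; [exact: cvg_id|exact: cvg_cst]. Qed.

Lemma is_derive_pospart2 (t : R) : is_derive t (1 : R) pospart2 (2 * Num.max t 0).
Proof.
have [t0|t0|t0] := ltgtP t 0.
- apply: (@near_eq_is_derive _ _ _ (cst 0)).
    near=> s; rewrite /pospart2 max_r ?expr0n//.
    by apply: ltW; near: s; exact: lt_nbhsl.
  rewrite mulr0; exact: is_derive_cst.
- apply: (@near_eq_is_derive _ _ _ (fun s : R => s ^+ 2)).
    near=> s; rewrite /pospart2 max_l//.
    by apply: ltW; near: s; exact: lt_nbhsr.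
  by apply: is_derive_eq; rewrite /GRing.scale/=; ring.
- rewrite t0 mulr0; apply/is_derive1_caratheodory; exists (fun z => Num.max z 0); split.
  + move=> z; rewrite /pospart2 maxxx expr0n/= !subr0.
    by case: (leP z 0) => z0; rewrite ?expr0n ?mul0r// expr2.
  + exact: continuous_pos.
  + by rewrite maxxx.
Unshelve. all: by end_near. Qed.

Definition bump (a b t : R) : R := pospart2 ((t - a) * (b - t)).

Definition bump' (a b t : R) : R := 2 * Num.max ((t - a) * (b - t)) 0 * (a + b - 2 * t).

Lemma is_derive_bump (a b t : R) : is_derive t (1 : R) (bump a b) (bump' a b t).
Proof.
have dq : is_derive t (1 : R) (fun s : R => (s - a) * (b - s)) (a + b - 2 * t).
  by apply: is_derive_eq; rewrite /GRing.scale/=; ring.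
exact: (@is_derive1_comp _ pospart2 (fun s : R => (s - a) * (b - s)) t _ _ (is_derive_pospart2 _) dq).
Qed.

Lemma continuous_bump' (a b : R) : continuous (bump' a b).
Proof.
have cq : continuous (fun t : R => (t - a) * (b - t)).
  move=> t; apply: cvgM; apply: cvgB; [exact: cvg_id|exact: cvg_cst|exact: cvg_cst|exact: cvg_id].
move=> t; apply: cvgM.
  apply: cvgM; first exact: cvg_cst.
  exact: (@continuous_comp _ _ _ (fun t : R => (t - a) * (b - t)) _ t (cq t) (@continuous_pos _)).
apply: cvgB; first exact: cvg_cst.
by apply: cvgM; [exact: cvg_cst|exact: cvg_id].
Qed.

Lemma bump_ge0 (a b t : R) : 0 <= bump a b t.
Proof. exact: sqr_ge0. Qed.

Lemma bump_eq0 (a b t : R) : a < b -> (bump a b t == 0) = ~~ (a < t < b).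
Proof.
move=> ab; rewrite /bump /pospart2 sqrf_eq0; apply/eqP/negP => [|tab].
  move=> m0 /andP[ta tb]; have q0 : 0 < (t - a) * (b - t) by rewrite mulr_gt0//; lra.
  by move: m0; rewrite max_l; lra.
apply: max_r; rewrite leNgt; apply/negP => h; apply: tab.
have [at'|ta] := ltP a t.
  by move: h; rewrite pmulr_rgt0; lra.
by exfalso; nra.
Qed.

(** Tends to the indicator of the open interval as delta tends to 0. *)
Definition cutoff (delta a b t : R) : R := bump a b t / (bump a b t + delta).

Definition cutoff' (delta a b t : R) : R := delta * (bump a b t + delta) ^- 2 * bump' a b t.

Lemma is_derive_cutoff (delta a b t : R) : 0 < delta ->
  is_derive t (1 : R) (cutoff delta a b) (cutoff' delta a b t).
Proof.
move=> d0; have B0 := bump_ge0 a b.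
have Bd s : bump a b s + delta != 0 by rewrite gt_eqF// ltr_wpDl.
have -> : cutoff delta a b = (fun s : R => 1 - delta * (bump a b s + delta)^-1).
  apply/funext => s; rewrite /cutoff; have := Bd s; set q := bump a b s => q0; by field.
have dB := is_derive_bump a b t.
have dBd : is_derive t (1 : R) (fun s : R => bump a b s + delta) (bump' a b t).
  by apply: is_derive_eq; rewrite addr0.
have dV := @is_deriveV _ (fun s : R => bump a b s + delta) t _ _ (Bd t) dBd.
apply: is_derive_eq; rewrite /GRing.scale/= /cutoff'; ring.
Qed.

Lemma continuous_cutoff (delta a b : R) : 0 < delta -> continuous (cutoff delta a b).
Proof.
by move=> d0 t; apply/differentiable_continuous/derivable1_diffP; case: (is_derive_cutoff a b t d0).
Qed.

Lemma continuous_cutoff' (delta a b : R) : 0 < delta -> continuous (cutoff' delta a b).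
Proof.
move=> d0 t; have B0 := bump_ge0 a b.
have cB : continuous (bump a b).
  by move=> s; apply/differentiable_continuous/derivable1_diffP; case: (is_derive_bump a b s).
have cBd : continuous (fun s => bump a b s + delta) by move=> s; apply: cvgD; [exact: cB|exact: cvg_cst].
apply: cvgM; last exact: continuous_bump'.
apply: cvgM; first exact: cvg_cst.
apply: cvgV; first by rewrite expf_neq0// gt_eqF// ltr_wpDl.
by rewrite expr2; apply: cvgM; exact: cBd.
Qed.

Lemma cutoff_ge0_le1 (delta a b t : R) : 0 < delta -> 0 <= cutoff delta a b t <= 1.
Proof.
move=> d0; have B0 := bump_ge0 a b t; have q0 : 0 < bump a b t + delta by rewrite ltr_wpDl.
by rewrite /cutoff divr_ge0 ?(ltW q0)//= ler_pdivrMr// mul1r lerDl ltW.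
Qed.

Lemma cutoff_eq0 (delta a b t : R) : a < b -> ~~ (a < t < b) -> cutoff delta a b t = 0.
Proof. by move=> ab tab; move: tab; rewrite -bump_eq0// /cutoff => /eqP ->; rewrite mul0r. Qed.

Lemma cvg_cutoff (a b t : R) : a < b ->
  cutoff (n.+1%:R^-1) a b t @[n --> \oo] --> (\1_(`]a, b[%classic) t : R).
Proof.
move=> ab; rewrite indicE.
have [tab|tab] := boolP (a < t < b).
  have -> : t \in `]a, b[%classic by rewrite inE/= in_itv/=.
  have B0 : bump a b t != 0 by rewrite bump_eq0// negbK.
  rewrite -[X in _ --> X](_ : bump a b t / (bump a b t + 0) = 1); last by rewrite addr0 divff.
  apply: cvgM; first exact: cvg_cst.
  apply: cvgV; first by rewrite addr0.
  by apply: cvgD; [exact: cvg_cst|exact: cvg_harmonic].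
have -> : (t \in `]a, b[%classic) = false.
  by apply/negbTE; rewrite notin_setE/= in_itv/=; exact/negP.
apply: cvg_near_cst; apply: nearW => n; exact: cutoff_eq0.
Qed.

Lemma test_function_cutoff (delta a b c d : R) : 0 < delta -> a < b -> c < d ->
  test_function (fun x : R * R => cutoff delta a b x.1 * cutoff delta c d x.2).
Proof.
move=> d0 ab cd; set h := fun x : R * R => _.
have c1 (f : R -> R) : continuous f -> continuous (fun x : R * R => f x.1).
  by move=> cf x; apply: (@continuous_comp _ _ _ fst f x); [exact: cvg_fst|exact: cf].
have c2 (f : R -> R) : continuous f -> continuous (fun x : R * R => f x.2).
  by move=> cf x; apply: (@continuous_comp _ _ _ snd f x); [exact: cvg_snd|exact: cf].
have D1 (x : R * R) : derivable h x (1, 0) /\ 'D_(1, 0) h x = cutoff' delta a b x.1 * cutoff delta c d x.2.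
  case: x => t y; apply: derive_sliceE1; rewrite /h /=.
  have dc := is_derive_cutoff a b t d0.
  by apply: is_derive_eq; rewrite /GRing.scale/=; ring.
have D2 (x : R * R) : derivable h x (0, 1) /\ 'D_(0, 1) h x = cutoff delta a b x.1 * cutoff' delta c d x.2.
  case: x => t y; apply: derive_sliceE2; rewrite /h /=.
  have dc := is_derive_cutoff c d y d0.
  by apply: is_derive_eq; rewrite /GRing.scale/=; ring.
split.
- move=> x; apply: cvgM; [apply: c1|apply: c2]; exact: continuous_cutoff.
- by move=> j x; rewrite /basis2; case: ifP => _; [case: (D1 x)|case: (D2 x)].
- move=> j; rewrite /basis2; case: ifP => _.
    have -> : (fun x => 'D_(1, 0) h x) = (fun x => cutoff' delta a b x.1 * cutoff delta c d x.2).
      by apply/funext => x; case: (D1 x).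
    move=> x; apply: cvgM; [apply: c1|apply: c2]; [exact: continuous_cutoff'|exact: continuous_cutoff].
  have -> : (fun x => 'D_(0, 1) h x) = (fun x => cutoff delta a b x.1 * cutoff' delta c d x.2).
    by apply/funext => x; case: (D2 x).
  move=> x; apply: cvgM; [apply: c1|apply: c2]; [exact: continuous_cutoff|exact: continuous_cutoff'].
- pose K : set (R * R) := `[a, b]%classic `*` `[c, d]%classic.
  have cK : compact K by apply: compact_setX; exact: segment_compact.
  apply: (subclosed_compact _ cK); first exact: closed_closure.
  have clK : closed K by exact: compact_closed.
  rewrite [K](closure_id K).1//; apply: closureS => x /=; rewrite /h => hx.
  split => /=; rewrite in_itv/=; apply: contraT => xab.
    rewrite cutoff_eq0 ?mul0r ?eqxx// in hx.
    by apply: contra xab => /andP[? ?]; apply/andP; split; exact: ltW.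
  rewrite [X in _ * X]cutoff_eq0 ?mulr0 ?eqxx// in hx.
  by apply: contra xab => /andP[? ?]; apply/andP; split; exact: ltW.
Qed.

Definition compact_integrable (g : R * R -> R) : Prop :=
  forall K : set (R * R), compact K -> (leb2 R).-integrable K (EFin \o g).

Definition open_box (a b c d : R) : set (R * R) := `]a, b[%classic `*` `]c, d[%classic.

Lemma measurable_open_box a b c d : measurable (open_box a b c d).
Proof. by apply: measurableX; exact: measurable_itv. Qed.

(** Dominated convergence along products of cutoffs. *)
Lemma orthogonal_test_open_box (g : R * R -> R) a b c d : measurable_fun setT g -> compact_integrable g ->
    (forall h, test_function h -> \int[leb2 R]_x (g x * h x) = 0) ->
  (\int[leb2 R]_(x in open_box a b c d) (g x)%:E = 0)%E.
Proof.
move=> mg ig g0.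
have [ab|ba] := ltP a b; last first.
  by rewrite /open_box set_itv_ge ?set0X ?integral_set0// bnd_simp -leNgt.
have [cd|dc] := ltP c d; last first.
  by rewrite /open_box [X in _ `*` X]set_itv_ge ?setX0 ?integral_set0// bnd_simp -leNgt.
pose K : set (R * R) := `[a, b]%classic `*` `[c, d]%classic.
have cK : compact K by apply: compact_setX; exact: segment_compact.
have mK : measurable K by exact: compact_measurable2.
pose h n (x : R * R) := cutoff n.+1%:R^-1 a b x.1 * cutoff n.+1%:R^-1 c d x.2.
have n0 n : 0 < n.+1%:R^-1 :> R by rewrite invr_gt0.
have th n : test_function (h n) by exact: test_function_cutoff.
have mh n : measurable_fun setT (h n).
  by apply: continuous_measurable2; case: (th n).
have hK n x : `|h n x| <= \1_K x.
  rewrite /h.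
  have /andP[k0 k1] := cutoff_ge0_le1 a b x.1 (n0 n); have /andP[l0 l1] := cutoff_ge0_le1 c d x.2 (n0 n).
  rewrite (ger0_norm (mulr_ge0 k0 l0)) indicE.
  have [xK|xK] := boolP (x \in K); first by rewrite mulr_ile1.
  have [xab|xab] := boolP (a < x.1 < b); last by rewrite cutoff_eq0// mul0r.
  have [xcd|xcd] := boolP (c < x.2 < d); last by rewrite [X in _ * X]cutoff_eq0// mulr0.
  exfalso; move: xK; rewrite notin_setE; apply; split => /=; rewrite in_itv/=.
    by move/andP: xab => [? ?]; apply/andP; split; exact: ltW.
  by move/andP: xcd => [? ?]; apply/andP; split; exact: ltW.
pose f_ n x := (g x * h n x)%:E.
pose f x := (g x * \1_(open_box a b c d) x)%:E.
pose G x := `|(g x * \1_K x)%:E|%E.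
have mf_ n : measurable_fun setT (f_ n) by apply/measurable_EFinP/measurable_funM.
have mf : measurable_fun setT f.
  apply/measurable_EFinP/measurable_funM => //; apply: measurable_indic; exact: measurable_open_box.
have iG : (leb2 R).-integrable setT G.
  apply: integrable_abse.
  have igK : (leb2 R).-integrable setT ((EFin \o g) \_ K).
    by rewrite -integrable_mkcond//; exact: ig.
  by apply: eq_integrable igK => // x _; rewrite patchE indicE; case: ifP => _ /=; rewrite ?mulr1 ?mulr0.
have cvf : {ae leb2 R, forall x, setT x -> f_ n x @[n --> \oo] --> f x}.
  apply: nearW => x _; apply: cvg_EFin; first exact: nearW.
  apply: cvgM; first exact: cvg_cst.
  have -> : \1_(open_box a b c d) x = (\1_(`]a, b[%classic) x.1 * \1_(`]c, d[%classic) x.2 : R).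
    rewrite !indicE /open_box; case: x => s t /=.
    by rewrite in_setX /= mulr_natr; case: (s \in _); case: (t \in _).
  by apply: cvgM; exact: cvg_cutoff.
have fG : {ae leb2 R, forall x n, setT x -> (`|f_ n x| <= G x)%E}.
  apply: nearW => x n _; rewrite /f_ /G !abse_EFin lee_fin (normrM (g x)) (normrM (g x)) ler_wpM2l//.
  by apply: le_trans (hK n x) _; exact: ler_norm.
have [_ _] := @dominated_convergence _ _ R (leb2 R) setT measurableT f_ f G mf_ mf cvf iG fG.
have -> : (fun n => \int[leb2 R]_x f_ n x)%E = cst 0%E.
  apply/funext => n /=; have := g0 _ (th n); rewrite /Rintegral.
  have if_ : (leb2 R).-integrable setT (f_ n).
    apply: (le_integrable _ _ _ iG); [by []|exact: mf_|].
    move=> x _; rewrite /f_ /G abse_id !abse_EFin lee_fin (normrM (g x)) (normrM (g x)) ler_wpM2l//.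
    by apply: le_trans (hK n x) _; exact: ler_norm.
  by move=> h0; rewrite -[LHS]fineK ?h0//; exact: integrable_fin_num.
have -> : (\int[leb2 R]_(x in open_box a b c d) (g x)%:E = \int[leb2 R]_x f x)%E.
  rewrite integral_mkcond; apply: eq_integral => x _; rewrite patchE /f indicE.
  by case: ifP => _; rewrite ?mulr1 ?mulr0.
by move=> /(cvg_lim (@ereal_hausdorff _)) <-; apply: lim_cst; exact: ereal_hausdorff.
Qed.

Lemma ray_setI (a b : R) : `]a, +oo[%classic `&` `]b, +oo[%classic = `]Num.max a b, +oo[%classic.
Proof.
apply/seteqP; split => t /=; rewrite !in_itv/= !andbT.
  by move=> [at' bt]; rewrite gt_max at' bt.
by rewrite gt_max => /andP[].
Qed.

(** From boxes to measurable sets: half lines generate the Borel sets in each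
    coordinate, then rectangles generate those of the plane. *)
Lemma orthogonal_test_box0 (g : R * R -> R) N : 0 < N -> measurable_fun setT g -> compact_integrable g ->
    (forall h, test_function h -> \int[leb2 R]_x (g x * h x) = 0) ->
  forall E, measurable E -> (\int[leb2 R]_(x in open_box (- N) N (- N) N `&` E) (g x)%:E = 0)%E.
Proof.
move=> N0 mg ig g0.
pose D := open_box (- N) N (- N) N; have mD : measurable D by exact: measurable_open_box.
have iD : (leb2 R).-integrable D (EFin \o g).
  have := ig (square 0 N) (@compact_square R 0 N); apply: integrableS => //; first exact: measurable_square.
  move=> x [/=]; rewrite !in_itv/= => /andP[? ?] /andP[? ?].
  by apply/squareP; rewrite !subr0 !ler_norml; split; apply/andP; split; exact: ltW.
pose gD := (EFin \o g) \_ D.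
have igD : (leb2 R).-integrable setT gD by rewrite -integrable_mkcond.
have gDE E : (\int[leb2 R]_(x in E) gD x = \int[leb2 R]_(x in D `&` E) (g x)%:E)%E.
  by rewrite /gD -integral_mkcondr setIC.
have DE (a b : R) : D `&` (`]a, +oo[%classic `*` `]b, +oo[%classic) = open_box (Num.max a (- N)) N (Num.max b (- N)) N.
  apply/seteqP; split => -[s t] /=; rewrite /D /open_box /= !in_itv/= !andbT !gt_max.
    by move=> [[/andP[-> ->] /andP[-> ->]] [-> ->]].
  by move=> [/andP[/andP[-> ->] ->] /andP[/andP[-> ->] ->]].
have DEl (a : R) : D `&` (`]a, +oo[%classic `*` setT) = open_box (Num.max a (- N)) N (- N) N.
  apply/seteqP; split => -[s t] /=; rewrite /D /open_box /= !in_itv/= !andbT !gt_max.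
    by move=> [[/andP[-> ->] /andP[-> ->]] [-> _]].
  by move=> [/andP[/andP[-> ->] ->] /andP[-> ->]].
have DEr (b : R) : D `&` (setT `*` `]b, +oo[%classic) = open_box (- N) N (Num.max b (- N)) N.
  apply/seteqP; split => -[s t] /=; rewrite /D /open_box /= !in_itv/= !andbT !gt_max.
    by move=> [[/andP[-> ->] /andP[-> ->]] [_ ->]].
  by move=> [/andP[-> ->] /andP[/andP[-> ->] ->]].
have ob a b c d : (\int[leb2 R]_(x in open_box a b c d) (g x)%:E = 0)%E by exact: orthogonal_test_open_box.
pose G : set (set R) := [set A | exists x, A = `]x, +oo[%classic].
have GE : @measurable _ (measurableTypeR R) = <<s G >> by exact: RGenOInfty.measurableE.
have GI : setI_closed G.
  by move=> A B [a ->] [b ->]; exists (Num.max a b); rewrite ray_setI.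
have mfst : measurable_fun setT (fst : R * R -> measurableTypeR R) by exact: measurable_fst.
have msnd : measurable_fun setT (snd : R * R -> measurableTypeR R) by exact: measurable_snd.
have mray a : measurable (`]a, +oo[%classic : set (measurableTypeR R)) by exact: measurable_itv.
(* Each extension from half lines to Borel sets needs the integral over the
   whole line in that coordinate, hence the strips. *)
have strip A : measurable A -> (\int[leb2 R]_(x in A `*` setT) gD x = 0)%E.
  move=> mA; have := @integral_pi_system_eq0 _ _ _ _ _ (leb2 R) gD setT fst G igD measurableT mfst GE GI _ _ A mA.
  rewrite !setTI -setXT; apply; last by rewrite gDE setIT ob.
  by move=> B [a ->]; rewrite setTI -setXT gDE DEl ob.
have S1 a A : measurable A -> (\int[leb2 R]_(x in A `*` `]a, +oo[%classic) gD x = 0)%E.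
  move=> mA; pose E := [set: R] `*` `]a, +oo[%classic.
  have mE : measurable E by apply: measurableX.
  have := @integral_pi_system_eq0 _ _ _ _ _ (leb2 R) gD E fst G igD mE mfst GE GI _ _ A mA.
  have EE B : E `&` fst @^-1` B = B `*` `]a, +oo[%classic.
    by apply/seteqP; split => -[s t] /= => [[[_ ?] ?]|[? ?]].
  rewrite EE; apply; last by rewrite gDE DEr ob.
  by move=> B [b ->]; rewrite EE gDE DE ob.
have S2 A B : measurable A -> measurable B -> (\int[leb2 R]_(x in A `*` B) gD x = 0)%E.
  move=> mA mB; pose E := A `*` [set: R].
  have mE : measurable E by apply: measurableX.
  have := @integral_pi_system_eq0 _ _ _ _ _ (leb2 R) gD E snd G igD mE msnd GE GI _ _ B mB.
  have EE C : E `&` snd @^-1` C = A `*` C.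
    by apply/seteqP; split => -[s t] /= => [[[? _] ?]|[? ?]].
  rewrite EE; apply; last exact: strip.
  by move=> C [b ->]; rewrite EE S1.
move=> E mE; rewrite -gDE.
have := @integral_pi_system_eq0 _ _ _ _ _ (leb2 R) gD setT id _ igD measurableT (@measurable_id _ _ _) (measurable_prod_measurableType _ _) _ _ _ E mE.
rewrite setTI; apply.
- move=> _ _ [A mA [B mB <-]] [A' mA' [B' mB' <-]]; rewrite -setXI.
  by exists (A `&` A'); [exact: measurableI|exists (B `&` B') => //; exact: measurableI].
- by move=> _ [A mA [B mB <-]]; rewrite setTI; exact: S2.
- by rewrite gDE setIT ob.
Qed.

(** The fundamental lemma of the calculus of variations, on an exhaustion of the
    plane by boxes. *)
Lemma orthogonal_test_ae0 (g : R * R -> R) : measurable_fun setT g -> compact_integrable g ->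
    (forall h, test_function h -> \int[leb2 R]_x (g x * h x) = 0) ->
  {ae leb2 R, forall x, g x = 0}.
Proof.
move=> mg ig g0.
pose D (n : nat) := open_box (- n.+1%:R) n.+1%:R (- n.+1%:R) n.+1%:R.
have mD n : measurable (D n) by exact: measurable_open_box.
have iD n : (leb2 R).-integrable (D n) (EFin \o g).
  have := ig (square 0 n.+1%:R) (@compact_square R 0 n.+1%:R); apply: integrableS => //; [exact: measurable_square|exact: mD|].
  move=> x [/=]; rewrite !in_itv/= => /andP[? ?] /andP[? ?].
  by apply/squareP; rewrite !subr0 !ler_norml; split; apply/andP; split; exact: ltW.
have aeD n : ae_eq (leb2 R) (D n) (EFin \o g) (cst 0%E).
  apply: (@integral_ae_eq _ _ R (leb2 R) (D n) (mD n) _ _ (iD n)) => // E ED mE.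
  rewrite integral0.
  have := @orthogonal_test_box0 g n.+1%:R (ltr0Sn _ _) mg ig g0 E mE.
  by rewrite setIC; move/setIidPl: ED => ->.
pose N n := ~` [set x | D n x -> (EFin \o g) x = cst 0%E x].
have : (leb2 R).-negligible (\bigcup_n N n) by apply: negligible_bigcup => n; exact: aeD.
apply: negligibleS => x /= gx0.
have [n xn] : exists n, D n x.
  exists (Num.truncn (`|x.1| + `|x.2|)).
  have h := truncnS_gt (`|x.1| + `|x.2|).
  have [h1 h2] : `|x.1| < (Num.truncn (`|x.1| + `|x.2|)).+1%:R /\ `|x.2| < (Num.truncn (`|x.1| + `|x.2|)).+1%:R.
    by split; apply: le_lt_trans h; rewrite ?lerDl ?lerDr.
  by split => /=; rewrite in_itv/= -ltr_norml.
exists n => //= h; apply: gx0; have /= := h xn; by case.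
Qed.

End weak_uniqueness.

(** * Complex-valued functions *)

Section square_integrable.
Context d (X : measurableType d) (R : realType) (mu : {measure set X -> \bar R}).
Implicit Types f g h q : X -> R.

Definition sqint f : Prop :=
  measurable_fun [set: X] f /\ (\int[mu]_x (f x ^+ 2)%:E < +oo)%E.

Lemma Lfun2P f : f \in Lfun mu 2%:E <-> sqint f.
Proof.
have E : measurable_fun [set: X] f -> (\int[mu]_x (f x ^+ 2)%:E = \int[mu]_x (`|(f x)%:E| `^ 2))%E.
  move=> mf; apply: eq_integral => x _; rewrite abse_EFin poweR_EFin powR_mulrn//.
  by rewrite real_normK ?num_real.
split=> [|[mf f2]].
  rewrite inE => /andP[+ +]; rewrite !inE/= => mf; rewrite /finite_norm unlock => f2.
  split => //; rewrite E//; rewrite (@lty_poweRy _ _ 2^-1)//.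
rewrite inE; apply/andP; rewrite !inE/=; split => //.
by rewrite /finite_norm unlock poweR_lty//= -E.
Qed.

Lemma sqint_bounded_le f g (K : R) : measurable_fun [set: X] f -> sqint g ->
  {ae mu, forall x, f x ^+ 2 <= K * g x ^+ 2} -> 0 <= K -> sqint f.
Proof.
move=> mf [mg g2] fg K0; split => //.
apply: (@le_lt_trans _ _ (K%:E * \int[mu]_x (g x ^+ 2)%:E)%E); last first.
  by rewrite lte_mul_pinfty ?lee_fin.
have mg2 : measurable_fun [set: X] (fun x => (g x ^+ 2)%:E).
  by apply/measurable_EFinP; exact: measurable_funX.
have mf2 : measurable_fun [set: X] (fun x => (f x ^+ 2)%:E).
  by apply/measurable_EFinP; exact: measurable_funX.
rewrite -ge0_integralZl//; last by move=> x _; rewrite lee_fin sqr_ge0.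
apply: ae_ge0_le_integral => //.
- by move=> x _; rewrite lee_fin sqr_ge0.
- by move=> x _; rewrite mule_ge0 ?lee_fin ?sqr_ge0.
- exact: emeasurable_funM.
- by apply: filterS fg => x fgx _; rewrite -EFinM lee_fin.
Qed.

Lemma sqintD f g : sqint f -> sqint g -> sqint (fun x => f x + g x).
Proof.
move=> [mf f2] [mg g2]; split; first exact: measurable_funD.
have m2 h : measurable_fun [set: X] h -> measurable_fun [set: X] (fun x => (2 * h x ^+ 2)%:E).
  by move=> mh; apply/measurable_EFinP; apply: measurable_funM => //; exact: measurable_funX.
apply: (@le_lt_trans _ _ (\int[mu]_x ((2 * f x ^+ 2)%:E + (2 * g x ^+ 2)%:E))%E).
  apply: ge0_le_integral => //.
  - by move=> x _; rewrite lee_fin sqr_ge0.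
  - by apply/measurable_EFinP; apply: measurable_funX; exact: measurable_funD.
  - by apply: emeasurable_funD; exact: m2.
  - by move=> x _; rewrite -EFinD lee_fin; have := sqr_ge0 (f x - g x); nra.
have p2 h x : (0 <= (2 * h x ^+ 2)%:E)%E by rewrite lee_fin mulr_ge0 ?sqr_ge0.
rewrite ge0_integralD//; [|exact: m2|exact: m2].
have z2 h : measurable_fun [set: X] h -> (\int[mu]_x (h x ^+ 2)%:E < +oo)%E ->
    (\int[mu]_x (2 * h x ^+ 2)%:E < +oo)%E.
  move=> mh h2; under eq_integral do rewrite EFinM.
  rewrite ge0_integralZl//; first by rewrite lte_mul_pinfty ?lee_fin.
    by apply/measurable_EFinP; exact: measurable_funX.
  by move=> x _; rewrite lee_fin sqr_ge0.
by rewrite lte_add_pinfty// z2.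
Qed.

Lemma sqintM f q (K : R) : sqint f -> measurable_fun [set: X] q -> (forall x, `|q x| <= K) ->
  sqint (fun x => q x * f x).
Proof.
move=> sf mq qK; apply: (@sqint_bounded_le _ f (K ^+ 2)) => //.
- by apply: measurable_funM => //; case: sf.
- apply: nearW => x; rewrite exprMn ler_wpM2r ?sqr_ge0// -[q x ^+ 2]real_normK ?num_real//.
  by rewrite ler_pXn2r ?nnegrE// (le_trans _ (qK x)).
- exact: sqr_ge0.
Qed.

Lemma sqintZ f (K : R) : sqint f -> sqint (fun x => K * f x).
Proof. by move=> sf; apply: (@sqintM _ (cst K) `|K|) => //. Qed.

Lemma sqint_mul f g : sqint f -> sqint g -> mu.-integrable setT (fun x => (f x * g x)%:E).
Proof.
move=> /Lfun2P sf /Lfun2P sg; have := Lfun2_mul_Lfun1 sf sg.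
by move=> /Lfun1_integrable.
Qed.

End square_integrable.

Section ae_plane.
Context (R : realType).
Implicit Types P Q : R * R -> Prop.

Lemma ae_plane_sub P Q : (forall x, P x -> Q x) ->
  {ae leb2 R, forall x, P x} -> {ae leb2 R, forall x, Q x}.
Proof. by move=> PQ; apply: negligibleS => x /= nQ Px; apply: nQ; exact: PQ. Qed.

Lemma ae_plane_and P Q : {ae leb2 R, forall x, P x} -> {ae leb2 R, forall x, Q x} ->
  {ae leb2 R, forall x, P x /\ Q x}.
Proof.
move=> aP aQ; have : (leb2 R).-negligible (~` [set x | P x] `|` ~` [set x | Q x]).
  exact: negligibleU.
apply: negligibleS => x /= nPQ.
by have [Px|nPx] := pselect (P x); [right => Qx; exact: nPQ|left].
Qed.

Lemma ae_plane_all P : (forall x, P x) -> {ae leb2 R, forall x, P x}.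
Proof. by move=> aP; apply/negligibleP; rewrite (_ : ~` _ = set0) ?measure0//; apply/seteqP; split => // x /=; apply. Qed.

End ae_plane.

Section plane_complex.
Context (R : realType).
Local Notation mu := (plane_measure R).
Local Notation w := (@japanese R).
Local Notation Re := (@complex.Re R).
Local Notation Im := (@complex.Im R).
Implicit Types (z : R[i]) (u v : R * R -> R[i]).

Lemma ReM z1 z2 : Re (z1 * z2) = Re z1 * Re z2 - Im z1 * Im z2.
Proof. by case: z1; case: z2. Qed.

Lemma ImM z1 z2 : Im (z1 * z2) = Re z1 * Im z2 + Im z1 * Re z2.
Proof. by case: z1; case: z2. Qed.

Lemma ReD z1 z2 : Re (z1 + z2) = Re z1 + Re z2.
Proof. by case: z1; case: z2. Qed.

Lemma ImD z1 z2 : Im (z1 + z2) = Im z1 + Im z2.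
Proof. by case: z1; case: z2. Qed.

Lemma ReN z : Re (- z) = - Re z. Proof. by case: z. Qed.
Lemma ImN z : Im (- z) = - Im z. Proof. by case: z. Qed.

Lemma Re_conj z : Re (Num.conj z) = Re z. Proof. by case: z. Qed.
Lemma Im_conj z : Im (Num.conj z) = - Im z. Proof. by case: z. Qed.

Lemma complex_eq z1 z2 : Re z1 = Re z2 -> Im z1 = Im z2 -> z1 = z2.
Proof. by case: z1; case: z2 => a b c e /= -> ->. Qed.

Definition cintegrable u : Prop :=
  (leb2 R).-integrable setT (fun x => (Re (u x))%:E) /\
  (leb2 R).-integrable setT (fun x => (Im (u x))%:E).

Lemma cintegrableD u v : cintegrable u -> cintegrable v -> cintegrable (fun x => u x + v x).
Proof.
move=> [iu ju] [iv jv]; split.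
- by under eq_fun do rewrite ReD EFinD; exact: integrableD.
- by under eq_fun do rewrite ImD EFinD; exact: integrableD.
Qed.

Let integrableZ (f : R * R -> R) (k : R) : (leb2 R).-integrable setT (EFin \o f) ->
  (leb2 R).-integrable setT (fun x => (k * f x)%:E).
Proof. by move=> h; under eq_fun do rewrite EFinM; exact: integrableZl. Qed.

Lemma cintegrableZ z u : cintegrable u -> cintegrable (fun x => z * u x).
Proof.
move=> [iu ju]; split.
- under eq_fun do rewrite ReM EFinB; apply: integrableB => //; exact: integrableZ.
- under eq_fun do rewrite ImM EFinD; apply: integrableD => //; exact: integrableZ.
Qed.

Lemma cintegrable_conj u : cintegrable u -> cintegrable (fun x => Num.conj (u x)).
Proof.
move=> [iu ju]; split; first by under eq_fun do rewrite Re_conj.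
by under eq_fun do rewrite Im_conj -mulN1r; exact: integrableZ.
Qed.

Lemma cintegralD u v : cintegrable u -> cintegrable v ->
  cintegral (fun x => u x + v x) = cintegral u + cintegral v.
Proof.
move=> [iu ju] [iv jv]; apply: complex_eq; rewrite /cintegral /=.
- by under eq_Rintegral do rewrite ReD; rewrite RintegralD.
- by under eq_Rintegral do rewrite ImD; rewrite RintegralD.
Qed.

Lemma cintegralZ z u : cintegrable u -> cintegral (fun x => z * u x) = z * cintegral u.
Proof.
move=> [iu ju]; apply: complex_eq; rewrite ?ReM ?ImM /cintegral /=.
- under eq_Rintegral do rewrite ReM; rewrite RintegralB//; last 2 first.
  + exact: integrableZ.
  + exact: integrableZ.
  by rewrite !RintegralZl.
- under eq_Rintegral do rewrite ImM; rewrite RintegralD//; last 2 first.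
  + exact: integrableZ.
  + exact: integrableZ.
  by rewrite !RintegralZl.
Qed.

Lemma cintegral_conj u : cintegrable u ->
  cintegral (fun x => Num.conj (u x)) = Num.conj (cintegral u).
Proof.
move=> [iu ju]; apply: complex_eq; rewrite ?Re_conj ?Im_conj /cintegral /=.
- by apply: eq_Rintegral => x _; rewrite Re_conj.
- under eq_Rintegral do rewrite Im_conj -mulN1r.
  by rewrite RintegralZl// mulN1r.
Qed.

Lemma cmeasurableD u v : cmeasurable u -> cmeasurable v -> cmeasurable (fun x => u x + v x).
Proof.
move=> [iu ju] [iv jv]; split.
- by under eq_fun do rewrite ReD; exact: measurable_funD.
- by under eq_fun do rewrite ImD; exact: measurable_funD.
Qed.

Lemma cmeasurableM u v : cmeasurable u -> cmeasurable v -> cmeasurable (fun x => u x * v x).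
Proof.
move=> [iu ju] [iv jv]; split.
- by under eq_fun do rewrite ReM; apply: measurable_funB; exact: measurable_funM.
- by under eq_fun do rewrite ImM; apply: measurable_funD; exact: measurable_funM.
Qed.

Lemma cmeasurable_cst z : cmeasurable (fun=> z).
Proof. by split; exact: measurable_cst. Qed.

Lemma cmeasurable_conj u : cmeasurable u -> cmeasurable (fun x => Num.conj (u x)).
Proof.
move=> [iu ju]; split; first by under eq_fun do rewrite Re_conj.
by under eq_fun do rewrite Im_conj; exact: measurable_funN.
Qed.

Lemma ae_eq_cintegral u v : cmeasurable u -> cmeasurable v ->
  {ae leb2 R, forall x, u x = v x} -> cintegral u = cintegral v.
Proof.
move=> [mu1 mu2] [mv1 mv2] uv; rewrite /cintegral /Rintegral; congr (fine _ +i* fine _).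
- apply: ae_eq_integral => //; [exact/measurable_EFinP|exact/measurable_EFinP|].
  by apply: (ae_plane_sub _ uv) => x -> _.
- apply: ae_eq_integral => //; [exact/measurable_EFinP|exact/measurable_EFinP|].
  by apply: (ae_plane_sub _ uv) => x -> _.
Qed.

Definition csqint u : Prop :=
  sqint (leb2 R) (fun x => Re (u x)) /\ sqint (leb2 R) (fun x => Im (u x)).

Lemma csqint_cmeasurable u : csqint u -> cmeasurable u.
Proof. by move=> [[? _] [? _]]. Qed.

Lemma csqintD u v : csqint u -> csqint v -> csqint (fun x => u x + v x).
Proof.
move=> [iu ju] [iv jv]; split.
- by under eq_fun do rewrite ReD; exact: sqintD.
- by under eq_fun do rewrite ImD; exact: sqintD.
Qed.

Lemma csqintZ z u : csqint u -> csqint (fun x => z * u x).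
Proof.
move=> [iu ju]; split.
- by under eq_fun do rewrite ReM -mulNr; apply: sqintD; exact: sqintZ.
- by under eq_fun do rewrite ImM; apply: sqintD; exact: sqintZ.
Qed.

Lemma csqint_conj_mul u v : csqint u -> csqint v -> cintegrable (fun x => Num.conj (u x) * v x).
Proof.
move=> [iu ju] [iv jv]; split.
- under eq_fun do rewrite ReM Re_conj Im_conj mulNr opprK EFinD.
  by apply: integrableD => //; exact: sqint_mul.
- under eq_fun do rewrite ImM Re_conj Im_conj mulNr EFinB.
  by apply: integrableB => //; exact: sqint_mul.
Qed.

Variable eps : R.
Hypothesis eps_gt0 : 0 < eps.
Local Notation Om := (Omega eps).
Local Notation SW := (plane_schur eps_gt0).
Local Notation dens := (weighted_density mu Om w).

Definition cdens u : Prop := dens (fun x => Re (u x)) /\ dens (fun x => Im (u x)).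

Definition cpotential (k : R * R -> R * R -> R) u (x : R * R) : R[i] :=
  potential mu k (fun y => Re (u y)) x +i* potential mu k (fun y => Im (u y)) x.

Lemma cdens_cmeasurable u : cdens u -> cmeasurable u.
Proof. by move=> [[? _] [? _]]. Qed.

Lemma cmeasurable_potential k u : mkernel k -> cmeasurable u -> cmeasurable (cpotential k u).
Proof.
move=> mk [mu1 mu2]; split.
- exact: (@measurable_potential _ _ R mu k _ mk mu1).
- exact: (@measurable_potential _ _ R mu k _ mk mu2).
Qed.

Lemma cintegrable_pairing k u v : dominated_kernel (@sker R) w k -> cdens u -> cdens v ->
  cintegrable (fun x => Num.conj (u x) * cpotential k v x).
Proof.
move=> dk [du1 du2] [dv1 dv2]; split.
- under eq_fun do rewrite ReM Re_conj Im_conj mulNr opprK EFinD.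
  by apply: integrableD => //; exact: (integrable_potential SW).
- under eq_fun do rewrite ImM Re_conj Im_conj mulNr EFinB.
  by apply: integrableB => //; exact: (integrable_potential SW).
Qed.

Lemma cpairing_swap k u v : dominated_kernel (@sker R) w k -> cdens u -> cdens v ->
  cintegral (fun x => Num.conj (u x) * cpotential k v x) =
  cintegral (fun x => Num.conj (cpotential (fun x y => k y x) u x) * v x).
Proof.
move=> dk [du1 du2] [dv1 dv2]; have dk' := dominated_kernel_flip SW dk.
have sw a b : dens a -> dens b ->
    \int[leb2 R]_x (a x * potential mu k b x) = \int[leb2 R]_x (potential mu (fun x y => k y x) a x * b x).
  move=> da db; rewrite (Rintegral_potential_swap SW dk da db).
  by apply: eq_Rintegral => x _; rewrite mulrC.
have i1 a b : dens a -> dens b -> (leb2 R).-integrable setT (fun x => (a x * potential mu k b x)%:E).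
  by move=> da db; exact: (integrable_potential SW).
have i2 a b : dens a -> dens b ->
    (leb2 R).-integrable setT (fun x => (potential mu (fun x y => k y x) a x * b x)%:E).
  move=> da db; under eq_fun do rewrite mulrC; exact: (integrable_potential SW).
apply: complex_eq; rewrite /cintegral /=.
- under eq_Rintegral do rewrite ReM Re_conj Im_conj mulNr opprK.
  under [RHS]eq_Rintegral do rewrite ReM Re_conj Im_conj mulNr opprK.
  by rewrite /= !RintegralD//= ?sw//; (try exact: i1); exact: i2.
- under eq_Rintegral do rewrite ImM Re_conj Im_conj mulNr.
  under [RHS]eq_Rintegral do rewrite ImM Re_conj Im_conj mulNr.
  by rewrite /= !RintegralB//= ?sw//; (try exact: i1); exact: i2.
Qed.

Let kappa : R := - (2 * pi)^-1.

Lemma G0E u : G0 u = (fun x => kappa%:C * cpotential (@lnker R) u x).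
Proof.
apply/funext => x; rewrite /G0; congr (_ * _); apply: complex_eq; rewrite /cintegral /=.
- by apply: eq_Rintegral => y _; rewrite ReM /= mul0r subr0.
- by apply: eq_Rintegral => y _; rewrite ImM /= mul0r addr0.
Qed.

Lemma clocally_integrable_potential k u (c : R) : dominated_kernel (@sker R) w k -> cdens u ->
  clocally_integrable (fun x => c%:C * cpotential k u x).
Proof.
move=> dk du; have mk : mkernel k by case: dk.
have mp := cmeasurable_potential mk (cdens_cmeasurable du).
split; first by apply: cmeasurableM => //; exact: cmeasurable_cst.
move=> K cK; have mK := compact_measurable2 cK.
have [N N0 KN] := compact_sub_square cK.
have m1 : measurable_fun setT (\1_K : R * R -> R) by exact: measurable_indic.
have [C C0 hC] : exists2 C, 0 <= C & forall x, weighted w (\1_K : R * R -> R) x <= C * Om x.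
  apply: (weighted_box eps_gt0 N0 ler01).
  - move=> x Nx; rewrite indicE; case: (boolP (x \in K)) => //.
    by rewrite inE => /KN.
  - by move=> x _; rewrite indicE; case: (x \in K); rewrite ?normr1 ?normr0.
have d1 : dens (\1_K : R * R -> R) by exact: (weighted_density_le SW m1 C0 hC).
have loc a : dens a -> (leb2 R).-integrable K (fun x => (c * potential mu k a x)%:E).
  move=> da; have i1 := integrable_potential SW dk d1 da.
  rewrite integrable_mkcond//; have := integrableZl measurableT c i1.
  apply: eq_integrable => // x _; rewrite patchE indicE -EFinM.
  by case: ifP => _; rewrite ?mul1r ?mul0r ?mulr0.
case: du => du1 du2; split.
- by under eq_fun do rewrite ReM /= mul0r subr0; exact: loc.
- by under eq_fun do rewrite ImM /= mul0r addr0; exact: loc.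
Qed.

Lemma is_weak_partial_G0 j u : cdens u ->
  is_weak_partial j (G0 u) (fun x => kappa%:C * cpotential (@gradker R j) u x).
Proof.
move=> du; rewrite G0E; split.
- apply: clocally_integrable_potential => //; exact: dominated_lnker.
- apply: clocally_integrable_potential => //; exact: dominated_gradker.
move=> h th; case: du => du1 du2.
have main a : dens a ->
    \int[leb2 R]_x (kappa * potential mu (@lnker R) a x * 'D_(@basis2 R j) h x) =
    - \int[leb2 R]_x (kappa * potential mu (@gradker R j) a x * h x).
  move=> da; have [[K K0 hK] /(_ j)[K' K'0 hK']] := weighted_test eps_gt0 th.
  have [mh /(_ j) mdh] := measurable_test th.
  have dh : dens h by exact: (weighted_density_le SW mh K0 hK).
  have ddh : dens (fun x => 'D_(@basis2 R j) h x) by exact: (weighted_density_le SW mdh K'0 hK').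
  under eq_Rintegral do rewrite -mulrA.
  under [in RHS]eq_Rintegral do rewrite -mulrA.
  rewrite !RintegralZl//.
  - by rewrite (weak_gradient_potential eps_gt0 j da th) mulrN.
  - have := integrable_potential SW (dominated_gradker R j) dh da.
    by apply: eq_integrable => // x _; rewrite /= mulrC.
  - have := integrable_potential SW (dominated_lnker R) ddh da.
    by apply: eq_integrable => // x _; rewrite /= mulrC.
apply: complex_eq; rewrite ?ReN ?ImN /cintegral /=.
- under eq_Rintegral do rewrite !mul0r !mulr0 !subr0.
  under [in RHS]eq_Rintegral do rewrite !mul0r !mulr0 !subr0.
  exact: main.
- under eq_Rintegral do rewrite !mul0r !mulr0 ?add0r ?addr0.
  under [in RHS]eq_Rintegral do rewrite !mul0r !mulr0 ?add0r ?addr0.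
  exact: main.
Qed.

Lemma boxint_test (g h : R * R -> R) : measurable_fun setT g -> compact_integrable g -> test_function h ->
  (leb2 R).-integrable setT (fun x => (g x * h x)%:E).
Proof.
move=> mg bg th; have [N N0 h0] := test_function_support th; have [ch _ _ _] := th.
have [M M0 hM] := continuous_bounded_square N ch.
have mh := continuous_measurable2 ch.
have mN := measurable_square (0 : R * R) N.
have iN : (leb2 R).-integrable setT ((EFin \o g) \_ (square 0 N)).
  by rewrite -integrable_mkcond//; apply: bg; exact: compact_square.
have iM := integrableZl measurableT M iN.
apply: (le_integrable _ _ _ iM); [by []|by apply/measurable_EFinP; exact: measurable_funM|].
move=> x _; rewrite patchE; have [Nx|Nx] := boolP (x \in square 0 N).
  change (`|(g x * h x)%:E| <= `|M%:E * (g x)%:E|)%E; rewrite -EFinM !abse_EFin lee_fin !normrM (ger0_norm M0) mulrC ler_wpM2r//.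
  by apply: hM; rewrite inE in Nx.
have -> : h x = 0 by apply: (h0 x _).1; move: Nx; rewrite notin_setE.
by rewrite mulr0 abse0 abse_ge0.
Qed.

(** The difference is locally integrable and annihilates all test functions. *)
Lemma weak_partial_unique j u g g' : is_weak_partial j u g -> is_weak_partial j u g' ->
  {ae leb2 R, forall x, g x = g' x}.
Proof.
move=> [_ [[mg1 mg2] lg] wg] [_ [[mg1' mg2'] lg'] wg'].
have main (a b : R * R -> R) : measurable_fun setT a -> measurable_fun setT b -> compact_integrable a -> compact_integrable b ->
    (forall h, test_function h -> \int[leb2 R]_x (a x * h x) = \int[leb2 R]_x (b x * h x)) ->
    {ae leb2 R, forall x, a x = b x}.
  move=> ma mb ba bb ab.
  have : {ae leb2 R, forall x, a x - b x = 0}.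
    apply: orthogonal_test_ae0.
    - exact: measurable_funB.
    - move=> K cK; have := @integrableB _ _ R (leb2 R) K (compact_measurable2 cK) _ _ (ba K cK) (bb K cK).
      by apply: eq_integrable => //; exact: compact_measurable2.
    - move=> h th; under eq_Rintegral do rewrite mulrBl.
      by rewrite RintegralB// ?ab ?subrr//; exact: boxint_test.
  by apply: ae_plane_sub => x /eqP; rewrite subr_eq0 => /eqP.
have Reh f h : (fun x => Re (f x * (h x)%:C)) = (fun x => Re (f x) * h x).
  by apply/funext => x; rewrite ReM /= mulr0 subr0.
have Imh f h : (fun x => Im (f x * (h x)%:C)) = (fun x => Im (f x) * h x).
  by apply/funext => x; rewrite ImM /= mulr0 add0r.
have eqh h : test_function h -> cintegral (fun x => g x * (h x)%:C) = cintegral (fun x => g' x * (h x)%:C).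
  by move=> th; apply: oppr_inj; rewrite -wg// -wg'.
have ae1 : {ae leb2 R, forall x, Re (g x) = Re (g' x)}.
  apply: main => //; [by move=> K /lg[]|by move=> K /lg'[]|move=> h th].
  by have /(congr1 Re) := eqh h th; rewrite /cintegral !Reh.
have ae2 : {ae leb2 R, forall x, Im (g x) = Im (g' x)}.
  apply: main => //; [by move=> K /lg[]|by move=> K /lg'[]|move=> h th].
  by have /(congr1 Im) := eqh h th; rewrite /cintegral !Imh.
by apply: ae_plane_sub (ae_plane_and ae1 ae2) => x [e1 e2]; exact: complex_eq.
Qed.

Lemma weak_partial_G0 j u : cdens u ->
  cmeasurable (weak_partial j (G0 u)) /\
  {ae leb2 R, forall x, weak_partial j (G0 u) x = kappa%:C * cpotential (@gradker R j) u x}.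
Proof.
move=> du; have h := is_weak_partial_G0 j du.
have h' : is_weak_partial j (G0 u) (weak_partial j (G0 u)).
  by rewrite /weak_partial; apply: (@xgetPex _ (fun=> 0) (is_weak_partial j (G0 u))); eexists; exact: h.
by split; [case: h' => _ [] |exact: weak_partial_unique h' h].
Qed.

End plane_complex.

(** * The operator T *)

Section complex_weights.
Context (R : realType).
Variable eps : R.
Hypothesis eps_gt0 : 0 < eps.
Local Notation mu := (plane_measure R).
Local Notation w := (@japanese R).
Local Notation Re := (@complex.Re R).
Local Notation Im := (@complex.Im R).
Local Notation Om := (Omega eps).
Local Notation SW := (plane_schur eps_gt0).
Local Notation dens := (weighted_density mu Om w).
Local Notation cdens := (cdens eps).
Implicit Types (z u v : R * R -> R[i]).

Definition decay (x : R * R) : R := w x `^ (- 2 - eps).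

Lemma decay_gt0 x : 0 < decay x.
Proof. by rewrite powR_gt0 ?japanese_gt0. Qed.

(** Om is chosen for this identity: w times the decay of v is the square root of
    the weight of the densities. *)
Lemma japanese_decay x : w x * decay x = Num.sqrt (Om x).
Proof.
have w0 := japanese_gt0 x.
have -> : Om x = (w x * decay x) ^+ 2.
  rewrite /Omega /decay -{2}(powRr1 (ltW w0)) -powRD; last by rewrite (gt_eqF w0) implybT.
  rewrite -powR_mulrn ?powR_ge0// -powRrM; congr (_ `^ _); lra.
by rewrite sqrtr_sqr ger0_norm// mulr_ge0// ?ltW ?decay_gt0.
Qed.

Lemma sqr_japanese_decay x : (w x * decay x) ^+ 2 = Om x.
Proof. by rewrite japanese_decay sqr_sqrtr// ltW ?Omega_gt0. Qed.

Lemma measurable_decay : measurable_fun [set: R * R] decay.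
Proof. by apply: (measurableT_comp (measurable_powR _)); exact: measurable_japanese. Qed.

(** Because of japanese_decay, (w a)^2 / Om is (a / decay)^2. *)
Lemma weighted_densityP (a : R * R -> R) :
  dens a <-> measurable_fun [set: R * R] a /\ sqint (leb2 R) (fun x => a x / decay x).
Proof.
have E : (\int[mu]_x (wsquare Om (weighted w a) x)%:E = \int[leb2 R]_x ((a x / decay x) ^+ 2)%:E)%E.
  apply: eq_integral => x _; congr EFin; have d0 := lt0r_neq0 (decay_gt0 x); have w0 := lt0r_neq0 (japanese_gt0 x).
  rewrite /wsquare /weighted -sqr_japanese_decay !exprMn real_normK ?num_real// exprVn.
  by field; rewrite d0 w0.
split=> [[ma [_ _ a2]]|[ma [_ a2]]].
  split=> //; split; last exact: eq_ind _ (fun t => (t < +oo)%E) a2 _ E.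
  apply: measurable_funM => //; apply: measurable_funV.
    by move=> x; rewrite ltW ?decay_gt0.
  exact: measurable_decay.
split=> //; split; last exact: eq_ind _ (fun t => (t < +oo)%E) a2 _ (esym E).
  by apply: measurable_funM; [exact: measurable_japanese|exact: measurableT_comp].
by move=> x; rewrite mulr_ge0// ltW ?japanese_gt0.
Qed.

Lemma weighted_density_mul (q f : R * R -> R) (C : R) : measurable_fun setT q ->
  (forall x, `|q x| <= C * decay x) -> sqint (leb2 R) f -> dens (fun x => q x * f x).
Proof.
move=> mq qC sf; have [mf _] := sf; apply/weighted_densityP; split; first exact: measurable_funM.
under eq_fun do rewrite mulrAC; apply: (@sqintM _ _ R (leb2 R) _ _ C sf).
  apply: measurable_funM => //; apply: measurable_funV; last exact: measurable_decay.
  by move=> x; rewrite ltW ?decay_gt0.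
by move=> x; rewrite normrM normfV (gtr0_norm (decay_gt0 x)) ler_pdivrMr ?decay_gt0.
Qed.

Lemma weighted_densityD (a b : R * R -> R) : dens a -> dens b -> dens (fun x => a x + b x).
Proof.
move=> /weighted_densityP[ma sa] /weighted_densityP[mb sb]; apply/weighted_densityP.
by split; [exact: measurable_funD|under eq_fun do rewrite mulrDl; exact: sqintD].
Qed.

Lemma cdensD u v : cdens u -> cdens v -> cdens (fun x => u x + v x).
Proof.
move=> [u1 u2] [v1 v2]; split.
- by under eq_fun do rewrite ReD; exact: weighted_densityD.
- by under eq_fun do rewrite ImD; exact: weighted_densityD.
Qed.

(** The entries of v and of v^* have this property. *)
Definition cdecaying (z : R * R -> R[i]) : Prop := cmeasurable z /\
  exists2 C, 0 < C & forall x, `|Re (z x)| <= C * decay x /\ `|Im (z x)| <= C * decay x.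

Lemma cdecaying_conj z : cdecaying z -> cdecaying (fun x => Num.conj (z x)).
Proof.
move=> [mz [C C0 zC]]; split; first exact: cmeasurable_conj.
by exists C => // x; rewrite Re_conj Im_conj normrN; exact: zC.
Qed.

Lemma cdens_mul z (f : R * R -> R[i]) : cdecaying z -> csqint f -> cdens (fun x => z x * f x).
Proof.
move=> [[mz1 mz2] [C C0 zC]] [f1 f2].
have z1 x := (zC x).1; have z2 x := (zC x).2.
have d (g h : R * R -> R) : measurable_fun setT g -> (forall x, `|g x| <= C * decay x) ->
    sqint (leb2 R) h -> dens (fun x => g x * h x).
  by move=> mg gC sh; exact: weighted_density_mul gC sh.
have dN (g h : R * R -> R) : measurable_fun setT g -> (forall x, `|g x| <= C * decay x) ->
    sqint (leb2 R) h -> dens (fun x => - g x * h x).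
  move=> mg gC sh; apply: d => //; first exact: measurable_funN.
  by move=> x; rewrite normrN.
split.
- under eq_fun do rewrite ReM -mulNr; apply: weighted_densityD; [exact: d|exact: dN].
- under eq_fun do rewrite ImM; apply: weighted_densityD; exact: d.
Qed.

(** Multiplication by an entry of v brings a potential back into L2. *)
Lemma csqint_mul_potential k z u : dominated_kernel (@sker R) w k -> cdecaying z -> cdens u ->
  csqint (fun x => z x * cpotential k u x).
Proof.
move=> dk [[mz1 mz2] [C C0 zC]] [u1 u2].
have z1 x := (zC x).1; have z2 x := (zC x).2.
have [mk [C' C'0 kC]] := dk.
have d (g a : R * R -> R) : measurable_fun setT g -> (forall x, `|g x| <= C * decay x) ->
    dens a -> sqint (leb2 R) (fun x => g x * potential mu k a x).
  move=> mg gC da; split.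
    apply: measurable_funM => //; apply: (@measurable_potential _ _ R mu k a mk).
    by case: da.
  apply: (weighted_L2_potential SW mk da mg).
  exists (C * (C' + 1)); first by rewrite mulr_gt0// ltr_wpDl.
  move=> x y; rewrite -japanese_decay.
  have p0 : 0 <= w x * w y * sker x y ^+ 4.
    have s0 : 0 <= sker x y := le_trans ler01 (sker_ge1 x y).
    by rewrite mulr_ge0 ?exprn_ge0// mulr_ge0// ltW ?japanese_gt0.
  have k1 : `|k x y| <= (C' + 1) * (w x * w y * sker x y ^+ 4).
    apply: (le_trans (kC x y)); rewrite -!mulrA ler_wpM2r//; last by rewrite lerDl.
    by rewrite mulrA.
  apply: (le_trans (ler_pM (normr_ge0 _) (normr_ge0 _) (gC x) k1)).
  by apply: le_of_eq; ring.
have dN (g a : R * R -> R) : measurable_fun setT g -> (forall x, `|g x| <= C * decay x) ->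
    dens a -> sqint (leb2 R) (fun x => - g x * potential mu k a x).
  move=> mg gC sh; apply: d => //; first exact: measurable_funN.
  by move=> x; rewrite normrN.
split.
- under eq_fun do rewrite ReM -mulNr; apply: sqintD; [exact: d|exact: dN].
- under eq_fun do rewrite ImM; apply: sqintD; exact: d.
Qed.

Lemma csqint_bounded_mul (q f : R * R -> R[i]) (K : R) : cmeasurable q ->
  (forall x, `|Re (q x)| <= K /\ `|Im (q x)| <= K) -> csqint f -> csqint (fun x => q x * f x).
Proof.
move=> [m1 m2] qK [f1 f2].
have q1 x := (qK x).1; have q2 x := (qK x).2.
split.
- under eq_fun do rewrite ReM -mulNr; apply: sqintD; first exact: (sqintM f1 m1 q1).
  apply: (sqintM f2 (measurable_funN m2) (K := K)) => x; by rewrite normrN.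
- under eq_fun do rewrite ImM; apply: sqintD; first exact: (sqintM f2 m1 q1).
  exact: (sqintM f1 m2 q2).
Qed.

Lemma ae_eq_csqint u v : cmeasurable u -> csqint v -> {ae leb2 R, forall x, u x = v x} -> csqint u.
Proof.
move=> [mu1 mu2] [v1 v2] uv; split.
- apply: (@sqint_bounded_le _ _ R (leb2 R) _ _ 1 mu1 v1 _ ler01).
  by apply: ae_plane_sub uv => x ->; rewrite mul1r.
- apply: (@sqint_bounded_le _ _ R (leb2 R) _ _ 1 mu2 v2 _ ler01).
  by apply: ae_plane_sub uv => x ->; rewrite mul1r.
Qed.

End complex_weights.

Section vector_potentials.
Context (R : realType).
Variable eps : R.
Hypothesis eps_gt0 : 0 < eps.
Local Notation mu := (plane_measure R).
Local Notation w := (@japanese R).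
Local Notation Re := (@complex.Re R).
Local Notation Im := (@complex.Im R).
Local Notation cdens := (cdens eps).
Local Notation vfun := (R * R -> 'cV[R[i]]_2).
Implicit Types (a b : vfun) (k : R * R -> R * R -> R) (c : 'M[R[i]]_2).

Lemma sum2 (V : nmodType) (F : 'I_2 -> V) : \sum_i F i = F 0 + F 1.
Proof. by rewrite big_ord_recl big_ord1; congr (_ + F _); apply/val_inj. Qed.

Lemma ord2P (P : 'I_2 -> Prop) : P 0 -> P 1 -> forall i, P i.
Proof.
move=> P0 P1 i; case: i => -[|[|//]] lt2.
- by rewrite (_ : Ordinal lt2 = 0)//; exact/val_inj.
- by rewrite (_ : Ordinal lt2 = 1)//; exact/val_inj.
Qed.

Lemma cV2_eq (x y : 'cV[R[i]]_2) : x 0 0 = y 0 0 -> x 1 0 = y 1 0 -> x = y.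
Proof. by move=> e0 e1; apply/matrixP => i j; rewrite ord1; move: i; exact: ord2P. Qed.

Definition vmeasurable a := forall i, cmeasurable (fun x => a x i 0).
Definition vdens a := forall i, cdens (fun x => a x i 0).

Lemma vdens_measurable a : vdens a -> vmeasurable a.
Proof. by move=> da i; exact: cdens_cmeasurable (da i). Qed.

Lemma Lp2P a : Lp2 2%:E a <-> forall i, csqint (fun x => a x i 0).
Proof.
split=> h i; have [h1 h2] := h i.
- by split; exact/Lfun2P.
- by split; exact/Lfun2P.
Qed.

Lemma Lp2_measurable a : Lp2 2%:E a -> vmeasurable a.
Proof. by move=> /Lp2P h i; exact: csqint_cmeasurable (h i). Qed.

Lemma ae_plane_forall2 (P : 'I_2 -> R * R -> Prop) :
  (forall i, {ae leb2 R, forall x, P i x}) -> {ae leb2 R, forall x i, P i x}.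
Proof.
move=> h; apply: ae_plane_sub (ae_plane_and (h 0) (h 1)) => x [h0 h1].
exact: ord2P.
Qed.

Lemma cmeasurable_sum (F : 'I_2 -> R * R -> R[i]) : (forall i, cmeasurable (F i)) ->
  cmeasurable (fun x => \sum_i F i x).
Proof. by move=> h; under eq_fun do rewrite sum2; exact: cmeasurableD. Qed.

Lemma csqint_sum (F : 'I_2 -> R * R -> R[i]) : (forall i, csqint (F i)) ->
  csqint (fun x => \sum_i F i x).
Proof. by move=> h; under eq_fun do rewrite sum2; exact: csqintD. Qed.

Lemma cdens_sum (F : 'I_2 -> R * R -> R[i]) : (forall i, cdens (F i)) ->
  cdens (fun x => \sum_i F i x).
Proof. by move=> h; under eq_fun do rewrite sum2; exact: cdensD. Qed.

Lemma cintegrable_sum (F : 'I_2 -> R * R -> R[i]) : (forall i, cintegrable (F i)) ->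
  cintegrable (fun x => \sum_i F i x).
Proof. by move=> h; under eq_fun do rewrite sum2; exact: cintegrableD. Qed.

Lemma cintegral_sum (F : 'I_2 -> R * R -> R[i]) : (forall i, cintegrable (F i)) ->
  cintegral (fun x => \sum_i F i x) = \sum_i cintegral (F i).
Proof.
move=> h; rewrite sum2; under eq_fun do rewrite sum2; exact: cintegralD.
Qed.

Lemma dotE (x y : 'cV[R[i]]_2) : (x^t* *m y) 0 0 = \sum_i Num.conj (x i 0) * y i 0.
Proof. by rewrite mxE; apply: eq_bigr => i _; rewrite !mxE. Qed.

(** The operator whose definition involves G0 and its weak gradient is a sum of
    three of these: two for the components of the gradient, one for the
    logarithm. *)
Definition vpotential k c b (x : R * R) : 'cV[R[i]]_2 :=
  c *m \col_j cpotential k (fun y => b y j 0) x.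

Lemma vpotentialE k c b x i :
  vpotential k c b x i 0 = \sum_j c i j * cpotential k (fun y => b y j 0) x.
Proof. by rewrite mxE; apply: eq_bigr => j _; rewrite mxE. Qed.

Lemma vmeasurable_vpotential k c b : mkernel k -> vmeasurable b -> vmeasurable (vpotential k c b).
Proof.
move=> mk mb i; under eq_fun do rewrite vpotentialE.
apply: cmeasurable_sum => j; apply: cmeasurableM; first exact: cmeasurable_cst.
exact: cmeasurable_potential.
Qed.

Lemma cintegrable_vpotential k c a b : dominated_kernel (@sker R) w k -> vdens a -> vdens b ->
  cintegrable (fun x => ((a x)^t* *m vpotential k c b x) 0 0).
Proof.
move=> dk da db; under eq_fun do rewrite dotE.
apply: cintegrable_sum => i.
under eq_fun do rewrite vpotentialE mulr_sumr.
apply: cintegrable_sum => j; under eq_fun do rewrite mulrCA.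
by apply: cintegrableZ; exact: (cintegrable_pairing eps_gt0).
Qed.

(** When the positive and the negative part are both infinite, both sides are 0. *)
Lemma Rintegral_opp (f : R * R -> R) : \int[leb2 R]_x (- f x) = - \int[leb2 R]_x f x.
Proof.
rewrite /Rintegral integralE [in RHS]integralE -/(comp _ _).
rewrite (_ : (fun x => (- f x)%:E) = (\- (EFin \o f))%E)// funeposN funenegN.
have := @integral_ge0 _ _ R (leb2 R) setT _ (fun x _ => funepos_ge0 (EFin \o f) x).
have := @integral_ge0 _ _ R (leb2 R) setT _ (fun x _ => funeneg_ge0 (EFin \o f) x).
case: (integral _ _ _) => [p| |]; case: (integral _ _ _) => [q| |] //= _ _; rewrite ?oppr0//.
by rewrite opprB.
Qed.

(** The sign that the kernel takes when its arguments are exchanged compensates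
    the one that its matrix takes under adjunction. The gradient kernels are odd
    and their matrices, real multiples of -i alpha_k, are skew-adjoint; for the
    logarithm there is no sign on either side. *)
Lemma inner_vpotential k c (s : bool) a b : dominated_kernel (@sker R) w k -> vdens a -> vdens b ->
    (forall x y, k y x = (-1) ^+ s * k x y) -> (forall i j, Num.conj (c j i) = (-1) ^+ s * c i j) ->
  inner a (vpotential k c b) = inner (vpotential k c a) b.
Proof.
move=> dk da db ks cs; have mk : mkernel k by case: dk.
have flip u : cpotential (fun x y => k y x) u = (fun x => (-1) ^+ s * cpotential k u x).
  apply/funext => x; rewrite /cpotential.
  have e f : potential mu (fun x y => k y x) f x = (-1) ^+ s * potential mu k f x.
    rewrite /potential; under eq_Rintegral do rewrite ks.
    case: s {ks cs}; rewrite ?expr0 ?expr1 ?mul1r ?mulN1r -?Rintegral_opp;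
      by apply: eq_Rintegral => y _; rewrite ?mul1r ?mulN1r ?mulNr.
  rewrite !e; case: s {ks cs e} => /=; rewrite ?expr0 ?expr1 ?mul1r// !mulN1r.
  by apply: complex_eq.
have intk i j : cintegrable (fun x => Num.conj (a x i 0) * cpotential k (fun y => b y j 0) x).
  exact: (cintegrable_pairing eps_gt0).
rewrite /inner.
transitivity (\sum_i \sum_j c i j * cintegral (fun x => Num.conj (a x i 0) * cpotential k (fun y => b y j 0) x)).
  under eq_fun do rewrite dotE.
  rewrite cintegral_sum.
    apply: eq_bigr => i _; under eq_fun do rewrite vpotentialE mulr_sumr.
    rewrite cintegral_sum.
      apply: eq_bigr => j _; under eq_fun do rewrite mulrCA.
      by rewrite cintegralZ.
    by move=> j; under eq_fun do rewrite mulrCA; exact: cintegrableZ.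
  move=> i; under eq_fun do rewrite vpotentialE mulr_sumr.
  by apply: cintegrable_sum => j; under eq_fun do rewrite mulrCA; exact: cintegrableZ.
have intk' i j : cintegrable (fun x => Num.conj (cpotential k (fun y => a y i 0) x) * b x j 0).
  under eq_fun do rewrite -[b _ j 0]conjCK -rmorphM mulrC.
  by apply: cintegrable_conj; exact: (cintegrable_pairing eps_gt0).
have sw i j : cintegral (fun x => Num.conj (a x i 0) * cpotential k (fun y => b y j 0) x) =
    (-1) ^+ s * cintegral (fun x => Num.conj (cpotential k (fun y => a y i 0) x) * b x j 0).
  rewrite (cpairing_swap eps_gt0 dk (da i) (db j)) flip -(cintegralZ _ (intk' i j)).
  congr cintegral; apply/funext => x; rewrite rmorphM mulrA.
  by case: s {ks cs flip}; rewrite ?expr0 ?expr1 ?rmorphN ?rmorph1.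
have E x : ((vpotential k c a x)^t* *m b x) 0 0 = \sum_j \sum_i (Num.conj (c j i) * (Num.conj (cpotential k (fun y => a y i 0) x) * b x j 0)).
  rewrite dotE; apply: eq_bigr => j _; rewrite vpotentialE rmorph_sum mulr_suml.
  by apply: eq_bigr => i _; rewrite rmorphM mulrA.
under [in RHS]eq_fun do rewrite E.
rewrite cintegral_sum; last first.
  by move=> j; apply: cintegrable_sum => i; exact: cintegrableZ.
rewrite exchange_big; apply: eq_bigr => j _; rewrite cintegral_sum; last first.
  by move=> i; exact: cintegrableZ.
apply: eq_bigr => i _; rewrite [RHS]cintegralZ// cs sw.
by rewrite mulrCA mulrA.
Qed.

End vector_potentials.

Section dirac_operator.
Context (R : realType).
Variable eps : R.
Hypothesis eps_gt0 : 0 < eps.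
Local Notation mu := (plane_measure R).
Local Notation w := (@japanese R).
Local Notation Re := (@complex.Re R).
Local Notation Im := (@complex.Im R).
Local Notation cdens := (cdens eps).
Local Notation vdens := (vdens eps).
Local Notation vfun := (R * R -> 'cV[R[i]]_2).
Implicit Types (a b f g : vfun).

Lemma Re_le_normc (z : R[i]) (r : R) : `|z| <= r%:C -> `|Re z| <= r /\ `|Im z| <= r.
Proof.
rewrite normc_def lecR => h; split; apply: le_trans h.
- by rewrite -sqrtr_sqr ler_sqrt ?addr_ge0 ?sqr_ge0// lerDl sqr_ge0.
- by rewrite -sqrtr_sqr ler_sqrt ?addr_ge0 ?sqr_ge0// lerDr sqr_ge0.
Qed.

Variables (m : R) (lam : 'I_2 -> R * R -> R) (B : R * R -> 'M[R[i]]_2).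

Definition grad_coef (k : 'I_2) : 'M[R[i]]_2 :=
  ((0 -i* 1) * (- (2 * pi)^-1)%:C) *: alpha R k.

Definition ln_coef : 'M[R[i]]_2 := ((2 * m)%:C * (- (2 * pi)^-1)%:C) *: I1 R.

Lemma grad_coef_conj k i j : Num.conj (grad_coef k j i) = (-1) ^+ true * grad_coef k i j.
Proof.
rewrite expr1 mulN1r; move: i j; apply: ord2P; apply: ord2P; rewrite /grad_coef !mxE /=;
  case: (k == 0); apply: complex_eq; rewrite ?Re_conj ?Im_conj ?ReN ?ImN ?ReM ?ImM /=; ring.
Qed.

Lemma ln_coef_conj i j : Num.conj (ln_coef j i) = (-1) ^+ false * ln_coef i j.
Proof.
rewrite expr0 mul1r; move: i j; apply: ord2P; apply: ord2P; rewrite /ln_coef !mxE /=;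
  apply: complex_eq; rewrite ?Re_conj ?Im_conj ?ReN ?ImN ?ReM ?ImM /=; ring.
Qed.

Lemma gradker_anti k x y : gradker k y x = (-1) ^+ true * gradker k x y :> R.
Proof.
by rewrite expr1 mulN1r /gradker enormC /=; case: ifP => _; rewrite -mulNr opprB.
Qed.

Lemma lnkerC x y : lnker y x = (-1) ^+ false * lnker x y :> R.
Proof. by rewrite expr0 mul1r /lnker enormC. Qed.

Lemma grad_termE k b x : (forall i, weak_partial k (G0 (fun y => b y i 0)) x =
    (- (2 * pi)^-1)%:C * cpotential (@gradker R k) (fun y => b y i 0) x) ->
  (0 -i* 1) *: (alpha R k *m \col_i weak_partial k (G0 (fun y => b y i 0)) x) =
  vpotential (@gradker R k) (grad_coef k) b x.
Proof.
move=> h; apply/matrixP => i j; rewrite ord1 vpotentialE mxE [X in _ * X]mxE mulr_sumr.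
apply: eq_bigr => l _; rewrite [X in _ * (_ * X)]mxE h [grad_coef _ _ _]mxE; ring.
Qed.

Lemma vmeasurableD f g : vmeasurable f -> vmeasurable g -> vmeasurable (fun x => f x + g x).
Proof. by move=> mf mg i; under eq_fun do rewrite mxE; exact: cmeasurableD. Qed.

(** Only almost everywhere, because weak derivatives are representatives of
    classes. *)
Lemma calG0_vpotential b : vdens b -> {ae leb2 R, forall x, calG0 m b x =
  vpotential (@gradker R 0) (grad_coef 0) b x + vpotential (@gradker R 1) (grad_coef 1) b x
  + vpotential (@lnker R) ln_coef b x}.
Proof.
move=> db.
have h k : {ae leb2 R, forall x i, weak_partial k (G0 (fun y => b y i 0)) x =
    (- (2 * pi)^-1)%:C * cpotential (@gradker R k) (fun y => b y i 0) x}.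
  by apply: ae_plane_forall2 => i; exact: (weak_partial_G0 eps_gt0 k (db i)).2.
apply: ae_plane_sub (ae_plane_and (h 0) (h 1)) => x [h0 h1].
rewrite /calG0 sum2 scalerDr; congr (_ + _ + _).
- exact: grad_termE.
- exact: grad_termE.
- apply/matrixP => i j; rewrite ord1 vpotentialE mxE [X in _ * X]mxE G0E mulrA sum2.
  have I1E (y : 'cV[R[i]]_2) l : (I1 R *m y) l 0 = if l == 0 then y 0 0 else 0.
    by rewrite mxE sum2 !mxE /= eqxx andbT andbF mul0r addr0; case: ifP; rewrite ?mul1r ?mul0r.
  have LE l l' : ln_coef l l' = (2 * m)%:C * (- (2 * pi)^-1)%:C * ((l == 0) && (l' == 0))%:R.
    by rewrite !mxE.
  under [X in cpotential _ X]eq_fun do rewrite I1E.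
  rewrite !LE; move: i; apply: ord2P => /=; rewrite ?eqxx /= ?mulr1 ?mulr0 ?mul0r ?addr0//.
  rewrite (_ : cpotential _ _ _ = 0) ?mulr0//.
  rewrite /cpotential /potential; apply: complex_eq => /=;
      by under eq_Rintegral do rewrite mulr0; rewrite /Rintegral integral0.
Qed.

Lemma vmeasurable_calG0 b : vdens b -> vmeasurable (calG0 m b).
Proof.
move=> db i; under eq_fun do rewrite !mxE.
apply: cmeasurableD; apply: cmeasurableM; try exact: cmeasurable_cst.
- rewrite (_ : (fun x => _) = fun x => \sum_k \sum_j alpha R k i j * weak_partial k (G0 (fun y => b y j 0)) x).
    apply: cmeasurable_sum => k; apply: cmeasurable_sum => j; apply: cmeasurableM.
      exact: cmeasurable_cst.
    exact: (weak_partial_G0 eps_gt0 k (db j)).1.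
  apply/funext => x; rewrite summxE; apply: eq_bigr => k _; rewrite mxE.
  by apply: eq_bigr => j _; rewrite [X in _ * X]mxE.
- rewrite G0E; apply: cmeasurableM; first exact: cmeasurable_cst.
  apply: cmeasurable_potential; first exact: mkernel_lnker.
  under eq_fun do rewrite mxE.
  apply: cmeasurable_sum => j; apply: cmeasurableM; first exact: cmeasurable_cst.
  exact: cdens_cmeasurable (db j).
Qed.

Lemma vmeasurable_dot a f : vmeasurable a -> vmeasurable f ->
  cmeasurable (fun x => ((a x)^t* *m f x) 0 0).
Proof.
move=> ma mf; under eq_fun do rewrite dotE.
by apply: cmeasurable_sum => i; apply: cmeasurableM => //; apply: cmeasurable_conj; exact: ma.
Qed.

Lemma ae_eq_inner a a' f f' : vmeasurable a -> vmeasurable a' -> vmeasurable f -> vmeasurable f' ->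
  {ae leb2 R, forall x, a x = a' x} -> {ae leb2 R, forall x, f x = f' x} -> inner a f = inner a' f'.
Proof.
move=> ma ma' mf mf' aa ff; apply: ae_eq_cintegral; try exact: vmeasurable_dot.
by apply: ae_plane_sub (ae_plane_and aa ff) => x [-> ->].
Qed.

Lemma innerD_gen a f g : cintegrable (fun x => ((a x)^t* *m f x) 0 0) ->
    cintegrable (fun x => ((a x)^t* *m g x) 0 0) ->
  inner a (fun x => f x + g x) = inner a f + inner a g.
Proof.
by move=> i1 i2; rewrite /inner -cintegralD//; congr cintegral; apply/funext => x; rewrite mulmxDr mxE.
Qed.

Lemma innerDl_gen a f g : cintegrable (fun x => ((f x)^t* *m a x) 0 0) ->
    cintegrable (fun x => ((g x)^t* *m a x) 0 0) ->
  inner (fun x => f x + g x) a = inner f a + inner g a.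
Proof.
move=> i1 i2; rewrite /inner -cintegralD//; congr cintegral; apply/funext => x.
by rewrite linearD /= map_mxD mulmxDl mxE.
Qed.

Lemma dot_conj (x y : 'cV[R[i]]_2) : (y^t* *m x) 0 0 = Num.conj ((x^t* *m y) 0 0).
Proof.
rewrite !dotE rmorph_sum; apply: eq_bigr => i _.
by rewrite [RHS]rmorphM /= conjCK mulrC.
Qed.

Lemma cintegrable_vpotentiall k c a b : dominated_kernel (@sker R) w k -> vdens a -> vdens b ->
  cintegrable (fun x => ((vpotential k c a x)^t* *m b x) 0 0).
Proof.
move=> dk da db; under eq_fun do rewrite dot_conj; apply: cintegrable_conj.
exact: (cintegrable_vpotential eps_gt0).
Qed.

Lemma inner_calG0 a b : vdens a -> vdens b -> inner a (calG0 m b) = inner (calG0 m a) b.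
Proof.
move=> da db; have ma := vdens_measurable da; have mb := vdens_measurable db.
have dg k := dominated_gradker R k; have dl := dominated_lnker R.
have mv k c u : dominated_kernel (@sker R) w k -> vdens u -> vmeasurable (vpotential k c u).
  by move=> [mk _] du; apply: vmeasurable_vpotential => //; exact: vdens_measurable du.
have mS u : vdens u -> vmeasurable (fun x =>
    vpotential (@gradker R 0) (grad_coef 0) u x + vpotential (@gradker R 1) (grad_coef 1) u x
    + vpotential (@lnker R) ln_coef u x).
  by move=> du; apply: vmeasurableD; [apply: vmeasurableD|]; exact: mv.
have ip k c : dominated_kernel (@sker R) w k -> cintegrable (fun x => ((a x)^t* *m vpotential k c b x) 0 0).
  by move=> dk; exact: (cintegrable_vpotential eps_gt0).
have ipl k c : dominated_kernel (@sker R) w k -> cintegrable (fun x => ((vpotential k c a x)^t* *m b x) 0 0).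
  by move=> dk; exact: cintegrable_vpotentiall.
rewrite (ae_eq_inner ma ma (vmeasurable_calG0 db) (mS _ db) (ae_plane_all (fun _ => erefl)) (calG0_vpotential db)).
rewrite (ae_eq_inner (vmeasurable_calG0 da) (mS _ da) mb mb (calG0_vpotential da) (ae_plane_all (fun _ => erefl))).
rewrite innerD_gen; last exact: ip; last first.
  by under eq_fun do rewrite mulmxDr mxE; apply: cintegrableD; exact: ip.
rewrite innerDl_gen; last exact: ipl; last first.
  by under eq_fun do rewrite linearD /= map_mxD mulmxDl mxE; apply: cintegrableD; exact: ipl.
rewrite innerD_gen; [|exact: ip|exact: ip].
rewrite innerDl_gen; [|exact: ipl|exact: ipl].
congr (_ + _ + _).
- by apply: (@inner_vpotential _ _ eps_gt0 _ _ true) => //; [exact: gradker_anti|exact: grad_coef_conj].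
- by apply: (@inner_vpotential _ _ eps_gt0 _ _ true) => //; [exact: gradker_anti|exact: grad_coef_conj].
- by apply: (@inner_vpotential _ _ eps_gt0 _ _ false) => //; [exact: lnkerC|exact: ln_coef_conj].
Qed.

Hypothesis lam_meas : forall j, measurable_fun [set: R * R] (lam j).
Hypothesis v_meas : forall i j, cmeasurable (fun x => vmx lam B x i j).
Hypothesis v_decay : exists C : R, forall i j x,
  `|vmx lam B x i j| <= (C * japanese x `^ (- 2 - eps))%:C.

Lemma cdecaying_vmx i j : cdecaying eps (fun x => vmx lam B x i j).
Proof.
split => //; have [C hC] := v_decay; exists (`|C| + 1); first by rewrite ltr_wpDl.
move=> x; have /Re_le_normc[h1 h2] := hC i j x.
have le : C * japanese x `^ (- 2 - eps) <= (`|C| + 1) * decay eps x.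
  by rewrite ler_wpM2r ?powR_ge0// (le_trans (ler_norm C))// lerDl.
by split; [exact: le_trans h1 le|exact: le_trans h2 le].
Qed.

Lemma vadjE f x i : vadj lam B f x i 0 = \sum_j Num.conj (vmx lam B x j i) * f x j 0.
Proof.
rewrite /vadj mxE; apply: eq_bigr => j _; congr (_ * _); rewrite mxE; congr (Num.conj _).
by rewrite mxE.
Qed.

Lemma vdens_vadj f : Lp2 2%:E f -> vdens (vadj lam B f).
Proof.
move=> /Lp2P lf i; under eq_fun do rewrite vadjE.
apply: cdens_sum => j.
apply: cdens_mul; last exact: lf.
by apply: cdecaying_conj; exact: cdecaying_vmx.
Qed.

Lemma csqint_vmx k c b i : dominated_kernel (@sker R) w k -> vdens b ->
  csqint (fun x => (vmx lam B x *m vpotential k c b x) i 0).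
Proof.
move=> dk db; under eq_fun do rewrite mxE.
apply: csqint_sum => j; under eq_fun do rewrite vpotentialE mulr_sumr.
apply: csqint_sum => l; under eq_fun do rewrite mulrCA.
apply: csqintZ; apply: (csqint_mul_potential eps_gt0) => //; exact: cdecaying_vmx.
Qed.

Lemma csqint_vmx_calG0 b i : vdens b -> csqint (fun x => (vmx lam B x *m calG0 m b x) i 0).
Proof.
move=> db.
have mv : cmeasurable (fun x => (vmx lam B x *m calG0 m b x) i 0).
  under eq_fun do rewrite mxE; apply: cmeasurable_sum => j; apply: cmeasurableM => //.
  exact: vmeasurable_calG0.
apply: (@ae_eq_csqint _ _ (fun x => (vmx lam B x *m vpotential (@gradker R 0) (grad_coef 0) b x) i 0
  + (vmx lam B x *m vpotential (@gradker R 1) (grad_coef 1) b x) i 0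
  + (vmx lam B x *m vpotential (@lnker R) ln_coef b x) i 0) mv).
  apply: csqintD; first apply: csqintD; apply: csqint_vmx => //.
  - exact: dominated_gradker.
  - exact: dominated_gradker.
  - exact: dominated_lnker.
apply: ae_plane_sub (calG0_vpotential db) => x ->.
by rewrite mulmxDr mxE mulmxDr mxE.
Qed.

Lemma UmxE x (y : 'cV[R[i]]_2) i : (Umx lam x *m y) i 0 = (sign1 (lam i x))%:C * y i 0.
Proof. by rewrite /Umx mul_diag_mx !mxE. Qed.

Lemma csqint_Umx f i : Lp2 2%:E f -> csqint (fun x => (Umx lam x *m f x) i 0).
Proof.
move=> /Lp2P lf; under eq_fun do rewrite UmxE.
apply: (@csqint_bounded_mul _ _ _ 1) => //.
- split; last exact: measurable_cst.
  rewrite /sign1 /=; apply: measurable_fun_ifT => //.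
  exact: measurable_fun_ler.
- move=> x; rewrite /sign1 /= normr0; split => //.
  by case: ifP; rewrite ?normrN normr1.
Qed.

Lemma Lp2_Top f : Lp2 2%:E f -> Lp2 2%:E (Top m lam B f).
Proof.
move=> lf; apply/Lp2P => i; under eq_fun do rewrite mxE.
by apply: csqintD; [exact: csqint_Umx|apply: csqint_vmx_calG0; exact: vdens_vadj].
Qed.

Lemma cintegrable_Lp2 f g : Lp2 2%:E f -> Lp2 2%:E g ->
  cintegrable (fun x => ((f x)^t* *m g x) 0 0).
Proof.
move=> /Lp2P lf /Lp2P lg; under eq_fun do rewrite dotE.
by apply: cintegrable_sum => i; exact: csqint_conj_mul.
Qed.

(** T is symmetric because U is real and diagonal and the potential operator
    between v and v^* is symmetric. *)
Lemma inner_Top f g : Lp2 2%:E f -> Lp2 2%:E g -> inner f (Top m lam B g) = inner (Top m lam B f) g.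
Proof.
move=> lf lg.
have lU h : Lp2 2%:E h -> Lp2 2%:E (fun x => Umx lam x *m h x).
  by move=> lh; apply/Lp2P => i; exact: csqint_Umx.
have lV h : Lp2 2%:E h -> Lp2 2%:E (fun x => vmx lam B x *m calG0 m (vadj lam B h) x).
  by move=> lh; apply/Lp2P => i; apply: csqint_vmx_calG0; exact: vdens_vadj.
transitivity (inner f (fun x => Umx lam x *m g x) +
    inner f (fun x => vmx lam B x *m calG0 m (vadj lam B g) x)).
  exact: (innerD_gen (cintegrable_Lp2 lf (lU _ lg)) (cintegrable_Lp2 lf (lV _ lg))).
transitivity (inner (fun x => Umx lam x *m f x) g +
    inner (fun x => vmx lam B x *m calG0 m (vadj lam B f) x) g); last first.
  by symmetry; exact: (innerDl_gen (cintegrable_Lp2 (lU _ lf) lg) (cintegrable_Lp2 (lV _ lf) lg)).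
congr (_ + _).
- congr cintegral; apply/funext => x; rewrite !dotE; apply: eq_bigr => i _.
  rewrite !UmxE; apply: complex_eq;
    rewrite !(ReM, ImM, Re_conj, Im_conj) /=; ring.
- transitivity (inner (vadj lam B f) (calG0 m (vadj lam B g))).
    congr cintegral; apply/funext => x; rewrite /vadj trmx_mul map_mxM /= -mulmxA.
    by rewrite [in RHS]spectral.trmxCK.
  rewrite inner_calG0; try exact: vdens_vadj.
  congr cintegral; apply/funext => x; rewrite [in RHS]trmx_mul [in RHS]map_mxM.
  by rewrite -[in RHS]mulmxA.
Qed.

End dirac_operator.

(** * Orthogonal projections up to null sets *)

Section hilbert.
Context (R : realType).
Local Notation Re := (@complex.Re R).
Local Notation Im := (@complex.Im R).
Local Notation vfun := (R * R -> 'cV[R[i]]_2).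
Local Notation L2 := (Lp2 2%:E).
Implicit Types (f g h : vfun) (z : R[i]) (M : set vfun) (S : vfun -> vfun).

Definition aeq f g : Prop := {ae leb2 R, forall x, f x = g x}.

Lemma aeqP f g : f = g %[ae leb2 R] <-> aeq f g.
Proof. by split; apply: ae_plane_sub => x h //; exact: h. Qed.

Lemma aeq_refl f : aeq f f. Proof. exact: ae_plane_all. Qed.

Lemma aeq_sym f g : aeq f g -> aeq g f.
Proof. by apply: ae_plane_sub. Qed.

Lemma aeq_trans g f h : aeq f g -> aeq g h -> aeq f h.
Proof. by move=> fg gh; apply: ae_plane_sub (ae_plane_and fg gh) => x [-> ->]. Qed.

Lemma L2D f g : L2 f -> L2 g -> L2 (fun x => f x + g x).
Proof. by move=> /Lp2P lf /Lp2P lg; apply/Lp2P => i; under eq_fun do rewrite mxE; exact: csqintD. Qed.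

Lemma L2Z z f : L2 f -> L2 (fun x => z *: f x).
Proof. by move=> /Lp2P lf; apply/Lp2P => i; under eq_fun do rewrite mxE; exact: csqintZ. Qed.

Lemma L2B f g : L2 f -> L2 g -> L2 (fun x => f x - g x).
Proof.
move=> lf lg; under eq_fun do rewrite -scaleN1r.
by apply: L2D => //; exact: L2Z.
Qed.

Lemma innerC f g : L2 f -> L2 g -> inner g f = Num.conj (inner f g).
Proof.
move=> lf lg; rewrite -cintegral_conj; last exact: cintegrable_Lp2.
by congr cintegral; apply/funext => x; exact: dot_conj.
Qed.

Lemma innerD f g h : L2 f -> L2 g -> L2 h -> inner f (fun x => g x + h x) = inner f g + inner f h.
Proof. by move=> lf lg lh; apply: innerD_gen; exact: cintegrable_Lp2. Qed.

Lemma innerZ z f g : L2 f -> L2 g -> inner f (fun x => z *: g x) = z * inner f g.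
Proof.
move=> lf lg; rewrite -cintegralZ; last exact: cintegrable_Lp2.
by congr cintegral; apply/funext => x; rewrite -scalemxAr mxE.
Qed.

Lemma innerB f g h : L2 f -> L2 g -> L2 h -> inner f (fun x => g x - h x) = inner f g - inner f h.
Proof.
move=> lf lg lh; under [X in inner f X]eq_fun do rewrite -scaleN1r.
by rewrite innerD//; [rewrite innerZ// mulN1r|exact: L2Z].
Qed.

Lemma innerBl f g h : L2 f -> L2 g -> L2 h -> inner (fun x => g x - h x) f = inner g f - inner h f.
Proof.
move=> lf lg lh; rewrite innerC//; last exact: L2B.
by rewrite innerB// rmorphB /= -!innerC.
Qed.

Lemma innerZl z f g : L2 f -> L2 g -> inner (fun x => z *: g x) f = Num.conj z * inner g f.
Proof.
by move=> lf lg; rewrite innerC//; [rewrite innerZ// rmorphM /= -innerC|exact: L2Z].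
Qed.

Lemma ae_inner f f' g g' : L2 f -> L2 f' -> L2 g -> L2 g' -> aeq f f' -> aeq g g' ->
  inner f g = inner f' g'.
Proof. by move=> lf lf' lg lg'; apply: ae_eq_inner; exact: Lp2_measurable. Qed.

Lemma inner_eq0 f : L2 f -> inner f f = 0 -> aeq f (fun=> 0).
Proof.
move=> lf; pose n (x : R * R) := Re (((f x)^t* *m f x) 0 0).
have nE x : n x = \sum_i (Re (f x i 0) ^+ 2 + Im (f x i 0) ^+ 2).
  by rewrite /n dotE !sum2 ReD !ReM !Re_conj !Im_conj; ring.
have [+ _] := cintegrable_Lp2 lf lf; rewrite -/(n _) => intn.
have n0 x : 0 <= n x by rewrite nE sumr_ge0// => i _; rewrite addr_ge0 ?sqr_ge0.
move=> /(congr1 Re); rewrite /inner /cintegral /= => n_eq0.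
have : (\int[leb2 R]_x (n x)%:E = 0)%E.
  by rewrite -(fineK (integrable_fin_num measurableT intn)); congr (_%:E).
have mn : measurable_fun setT (fun x => (n x)%:E) by case/integrableP: intn.
rewrite (_ : (fun x => (n x)%:E) = (fun x => `|(n x)%:E|%E)); last first.
  by apply/funext => x; rewrite gee0_abs ?lee_fin.
move=> /(ae_eq_integral_abs (leb2 R) measurableT mn) nae.
apply: (ae_plane_sub _ nae) => x /(_ I) [] /eqP.
rewrite nE psumr_eq0; last by move=> i _; rewrite addr_ge0 ?sqr_ge0.
move=> /allP h; have {}h i : f x i 0 = 0.
  have := h i (mem_index_enum _); rewrite paddr_eq0 ?sqr_ge0// !sqrf_eq0 => /andP[/eqP a /eqP b].
  exact: complex_eq.
by apply: cV2_eq; rewrite mxE.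
Qed.

Lemma inner0l f g : L2 f -> L2 g -> aeq f (fun=> 0) -> inner f g = 0.
Proof.
move=> lf lg f0; rewrite (@ae_inner f (fun x => 0 *: f x) g g) ?innerZl ?rmorph0 ?mul0r//.
- exact: L2Z.
- by apply: ae_plane_sub f0 => x ->; rewrite scaler0.
- exact: aeq_refl.
Qed.

Lemma inner0r f g : L2 f -> L2 g -> aeq g (fun=> 0) -> inner f g = 0.
Proof. by move=> lf lg g0; rewrite innerC// inner0l// rmorph0. Qed.

Lemma aeq_inner f g : L2 f -> L2 g -> inner f (fun x => f x - g x) = 0 ->
  inner g (fun x => f x - g x) = 0 -> aeq f g.
Proof.
move=> lf lg fd gd; have ld := L2B lf lg.
have : aeq (fun x => f x - g x) (fun=> 0) by apply: (inner_eq0 ld); rewrite (innerBl ld lf lg) fd gd subrr.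
by apply: ae_plane_sub => x /eqP; rewrite subr_eq0 => /eqP.
Qed.

(** A projection is characterized through inner products only, so that each fact
    about its values is proved by testing against its range. *)
Section projection.
Variables (M : set vfun) (S : vfun -> vfun).
Hypothesis MS : is_orthproj M S.
Hypothesis ML2 : forall g, M g -> L2 g.

Lemma orthproj_mem f : L2 f -> M (S f). Proof. by move=> /MS[]. Qed.

Lemma L2_orthproj f : L2 f -> L2 (S f). Proof. by move=> lf; apply: ML2; exact: orthproj_mem. Qed.

Lemma inner_orthproj g f : M g -> L2 f -> inner g (S f) = inner g f.
Proof.
move=> Mg lf; have lg := ML2 Mg; have [_ /(_ _ Mg)] := MS lf.
by rewrite innerB//; [move=> /eqP; rewrite subr_eq0 => /eqP|exact: L2_orthproj].
Qed.

Lemma orthproj_id g : M g -> aeq (S g) g.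
Proof.
move=> Mg; have lg := ML2 Mg; have lS := L2_orthproj lg; have MSg := orthproj_mem lg.
by apply: aeq_inner => //; rewrite innerB// inner_orthproj// subrr.
Qed.

Lemma ae_orthproj f g : L2 f -> L2 g -> aeq f g -> aeq (S f) (S g).
Proof.
move=> lf lg fg; have Sf := L2_orthproj lf; have Sg := L2_orthproj lg.
have e h : M h -> inner h (fun x => S f x - S g x) = 0.
  move=> Mh; have lh := ML2 Mh.
  by rewrite innerB// !inner_orthproj// (ae_inner lh lh lf lg (aeq_refl h) fg) subrr.
by apply: aeq_inner => //; apply: e; exact: orthproj_mem.
Qed.

Lemma orthproj0 f : L2 f -> (forall g, M g -> inner g f = 0) -> aeq (S f) (fun=> 0).
Proof.
move=> lf Mf; have Sf := L2_orthproj lf; apply: inner_eq0 => //.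
by rewrite inner_orthproj ?Mf//; exact: orthproj_mem.
Qed.

Lemma L2range_id g : L2range S g -> aeq (S g) g /\ exists2 g', M g' & aeq g g'.
Proof.
move=> [lg [f lf /aeqP gSf]]; have MSf := orthproj_mem lf; have lSf := ML2 MSf.
split; last by exists (S f).
apply: aeq_trans (ae_orthproj lg lSf gSf) _.
by apply: aeq_trans (orthproj_id MSf) _; exact: aeq_sym.
Qed.

Lemma L2range_mem g : M g -> L2range S g.
Proof.
move=> Mg; have lg := ML2 Mg; split => //; exists g => //.
by apply/aeqP/aeq_sym; exact: orthproj_id.
Qed.

End projection.
End hilbert.

(** * The ranges of S1 and S2 *)

Section spectral_subspaces.
Context (R : realType).
Local Notation Re := (@complex.Re R).
Local Notation Im := (@complex.Im R).
Local Notation vfun := (R * R -> 'cV[R[i]]_2).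
Local Notation L2 := (Lp2 2%:E).
Variables (m eps : R) (lam : 'I_2 -> R * R -> R) (B : R * R -> 'M[R[i]]_2).
Hypothesis eps_gt0 : 0 < eps.
Hypothesis lam_meas : forall j, measurable_fun [set: R * R] (lam j).
Hypothesis v_meas : forall i j, cmeasurable (fun x => vmx lam B x i j).
Hypothesis v_decay : exists C : R, forall i j x,
  `|vmx lam B x i j| <= (C * japanese x `^ (- 2 - eps))%:C.
Hypothesis ac_neq0 : ~ (vcol1 lam B = (fun=> 0) %[ae leb2 R]).
Local Notation T := (Top m lam B).
Local Notation v1 := (vcol1 lam B).
Local Notation c0 := (c0 m lam B).
Implicit Types (f g h : vfun).

Lemma decay_L2 : sqint (leb2 R) (@decay R eps).
Proof.
have md := measurable_decay eps.
split => //; apply: (@le_lt_trans _ _ (\int[leb2 R]_x (Omega eps x)%:E)%E).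
  apply: ge0_le_integral => //.
  - by move=> x _; rewrite lee_fin sqr_ge0.
  - by apply/measurable_EFinP; exact: measurable_funX.
  - by apply/measurable_EFinP; exact: measurable_Omega.
  move=> x _; rewrite lee_fin -sqr_japanese_decay exprMn ler_peMl ?sqr_ge0// exprn_ege1//.
  exact: japanese_ge1.
exact: le_lt_trans (integral_Om_le (plane_schur eps_gt0)) (ltry _).
Qed.

Lemma L2_vcol1 : L2 v1.
Proof.
apply/Lp2P => i; under eq_fun do rewrite mxE.
have [[m1 m2] [C C0 hC]] := cdecaying_vmx v_meas v_decay i 0.
have h (q : R * R -> R) : measurable_fun setT q -> (forall x, `|q x| <= C * decay eps x) ->
    sqint (leb2 R) q.
  move=> mq qC; apply: (@sqint_bounded_le _ _ R (leb2 R) _ _ (C ^+ 2) mq decay_L2 _ (sqr_ge0 C)).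
  apply: ae_plane_all => x; rewrite -exprMn -[q x ^+ 2]real_normK ?num_real//.
  have Cd := mulr_ge0 (ltW C0) (ltW (decay_gt0 eps x)).
  by rewrite ler_pXn2r ?nnegrE ?normr_ge0.
by split; apply: h => // x; case: (hC x).
Qed.

Let L2T f : L2 f -> L2 (T f). Proof. exact: (Lp2_Top eps_gt0 m lam_meas v_meas v_decay). Qed.

Let adjT f g : L2 f -> L2 g -> inner f (T g) = inner (T f) g.
Proof. exact: (inner_Top eps_gt0 m lam_meas v_meas v_decay). Qed.

(** Symmetry reduces this to inner products, which ignore null sets. *)
Let aeT f g : L2 f -> L2 g -> aeq f g -> aeq (T f) (T g).
Proof.
move=> lf lg fg; have lTf := L2T lf; have lTg := L2T lg.
have e k : L2 k -> inner k (fun x => T f x - T g x) = 0.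
  move=> lk; have lTk := L2T lk; apply: (etrans (innerB lk lTf lTg)).
  apply/eqP; rewrite subr_eq0; apply/eqP; apply: (etrans (adjT lk lf)).
  exact: (etrans (ae_inner lTk lTk lf lg (aeq_refl _) fg) (esym (adjT lk lg))).
by apply: (aeq_inner lTf lTg); exact: e.
Qed.

Lemma inner_vcol1_neq0 : inner v1 v1 != 0.
Proof.
by apply/eqP => /(inner_eq0 L2_vcol1) /aeqP.
Qed.

Lemma ae_c0 f g : L2 f -> L2 g -> aeq f g -> c0 f = c0 g.
Proof.
move=> lf lg fg.
exact: (congr1 (fun z => z / inner v1 v1)
  (ae_inner L2_vcol1 L2_vcol1 (L2T lf) (L2T lg) (aeq_refl _) (aeT lf lg fg))).
Qed.

Variables P S1 S2 : vfun -> vfun.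
Hypothesis P_proj : is_orthproj (L2span v1) P.
Hypothesis S1_proj : is_orthproj (ker_on (oppproj P) (QTQ m lam B P)) S1.
Hypothesis S2_proj : is_orthproj (ker_on S1 (T1op m lam B P S1)) S2.

Let span_L2 g : L2span v1 g -> L2 g. Proof. by case. Qed.
Let ker_L2 (S A : vfun -> vfun) g : ker_on S A g -> L2 g. Proof. by case=> -[]. Qed.

Let span_v1 z : L2span v1 (fun x => z *: v1 x).
Proof. by split; [exact: L2Z L2_vcol1|exists z; apply/aeqP; exact: aeq_refl]. Qed.

Let L2P f : L2 f -> L2 (P f). Proof. exact: (L2_orthproj P_proj span_L2). Qed.
Let L2S1 f : L2 f -> L2 (S1 f). Proof. exact: (L2_orthproj S1_proj (@ker_L2 _ _)). Qed.

Let P_id h z : L2 h -> aeq h (fun x => z *: v1 x) -> aeq (P h) (fun x => z *: v1 x).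
Proof.
move=> lh hz; have sp := span_v1 z.
apply: aeq_trans (ae_orthproj P_proj span_L2 lh (span_L2 sp) hz) _.
exact: (orthproj_id P_proj span_L2 sp).
Qed.

Lemma inner_vcol1_range g : L2range (oppproj P) g -> inner v1 g = 0.
Proof.
move=> [lg [f lf /aeqP gf]]; have lPf := L2P lf.
rewrite (ae_inner L2_vcol1 L2_vcol1 lg (L2B lf lPf) (aeq_refl _) gf).
have [_ h] := P_proj lf; rewrite -[RHS](h _ (span_v1 1)).
rewrite (_ : (fun x => 1 *: v1 x) = v1)//.
by apply/funext => x; rewrite scale1r.
Qed.

Lemma proj_vcol1_range g : L2range (oppproj P) g -> aeq (P g) (fun=> 0).
Proof.
move=> rg; have lg : L2 g by case: rg.
apply: (orthproj0 P_proj span_L2 lg) => h [lh [z /aeqP hz]].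
rewrite (ae_inner lh (L2Z z L2_vcol1) lg lg hz (aeq_refl _)) innerZl//; last exact: L2_vcol1.
by rewrite inner_vcol1_range// mulr0.
Qed.

(** Since g is in the range of Q, P g = 0 and QTQ g = 0 says that T g = P T g, a
    multiple of (a, c)^T; the pairing with (a, c)^T identifies the factor. *)
Lemma Top_range_S1 g : L2range S1 g -> inner v1 g = 0 /\ aeq (T g) (fun x => c0 g *: v1 x).
Proof.
move=> rg; have lg : L2 g by case: rg.
have [_ [g' [rg' /aeqP Qg'] gg']] := L2range_id S1_proj (@ker_L2 _ _) rg.
have lg' : L2 g' by case: rg'.
split.
  by rewrite (ae_inner L2_vcol1 L2_vcol1 lg lg' (aeq_refl _) gg') inner_vcol1_range.
rewrite (ae_c0 lg lg' gg'); apply: aeq_trans (aeT lg lg' gg') _.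
have lT := L2T lg'.
have lO : L2 (oppproj P g') by apply: L2B => //; exact: L2P.
have lTO := L2T lO.
have Og : aeq (oppproj P g') g'.
  by apply: ae_plane_sub (proj_vcol1_range rg') => x; rewrite /oppproj => ->; rewrite subr0.
have TP : aeq (T g') (P (T g')).
  apply: aeq_trans (aeT lg' lO (aeq_sym Og)) _.
  apply: aeq_trans (ae_orthproj P_proj span_L2 lTO lT (aeT lO lg' Og)).
  by apply: ae_plane_sub Qg' => x /eqP; rewrite /QTQ {1}/oppproj subr_eq0 => /eqP.
have [lPT [z /aeqP Pz]] := orthproj_mem P_proj lT.
have Tz := aeq_trans TP Pz.
suff -> : c0 g' = z by [].
rewrite /Defs.c0 (ae_inner L2_vcol1 L2_vcol1 lT (L2Z z L2_vcol1) (aeq_refl _) Tz).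
by rewrite innerZ ?mulfK ?inner_vcol1_neq0//; exact: L2_vcol1.
Qed.

(** By symmetry <T h, T h> = <h, T (T h)>. *)
Lemma ae_Top0 h : L2 h -> aeq h (fun=> 0) -> aeq (T h) (fun=> 0).
Proof.
move=> lh h0; have lT := L2T lh; apply: inner_eq0 => //.
by rewrite -(adjT lh lT); exact: (inner0l lh (L2T lT) h0).
Qed.

Let conj_mul_eq0 (z b : R[i]) : b != 0 -> 0 = Num.conj z * (z * b) -> z = 0.
Proof.
move=> b0 /esym /eqP; rewrite mulf_eq0 conjC_eq0 mulf_eq0 (negbTE b0) orbF orbb.
by move=> /eqP.
Qed.

(** Let h = P T S1 g, which is c0 (a, c)^T. If T1 g = S1 T h vanishes, then
    0 = <g, T h> = <T g, h> = |c0|^2 |(a, c)^T|^2. *)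
Lemma T1op_eq0 g : L2range S1 g -> aeq (T1op m lam B P S1 g) (fun=> 0) <-> c0 g = 0.
Proof.
move=> rg; have lg : L2 g by case: rg.
have [_ Tg] := Top_range_S1 rg.
have [S1g [g' Mg' gg']] := L2range_id S1_proj (@ker_L2 _ _) rg.
have lg' := ker_L2 Mg'; have lS1g := L2S1 lg; have lT := L2T lS1g; have lTg := L2T lg.
have TS1g : aeq (T (S1 g)) (fun x => c0 g *: v1 x) := aeq_trans (aeT lS1g lg S1g) Tg.
have lh := L2P lT; have hc := P_id lT TS1g; have lY := L2T lh.
have lc := L2Z (c0 g) L2_vcol1.
split=> [SY0|c00].
- have := inner_orthproj S1_proj (@ker_L2 _ _) Mg' lY.
  rewrite (inner0r lg' (L2S1 lY) SY0) -(ae_inner lg lg' lY lY gg' (aeq_refl _)) adjT//.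
  rewrite (ae_inner lTg lc lh lc Tg hc) innerZl//; last exact: L2_vcol1.
  rewrite innerZ; [|exact: L2_vcol1|exact: L2_vcol1].
  exact: conj_mul_eq0 inner_vcol1_neq0.
- have h0 : aeq (P (T (S1 g))) (fun=> 0).
    by apply: ae_plane_sub hc => x; rewrite c00 scale0r.
  apply: (orthproj0 S1_proj (@ker_L2 _ _) lY) => f Mf.
  by rewrite (inner0r (ker_L2 Mf) lY)//; exact: ae_Top0.
Qed.

Lemma L2range_S2 phi : L2range S1 phi -> L2range S2 phi <-> c0 phi = 0.
Proof.
move=> rphi; have lphi : L2 phi by case: rphi.
split=> [[_ [f lf /aeqP phif]]|c00].
- have [rS2 /aeqP T0] := orthproj_mem S2_proj lf.
  have lS2 : L2 (S2 f) by case: rS2.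
  by rewrite (ae_c0 lphi lS2 phif); exact/(T1op_eq0 rS2).
- apply: (L2range_mem S2_proj (@ker_L2 _ _)); split => //.
  by apply/aeqP/(T1op_eq0 rphi).
Qed.

End spectral_subspaces.

(** * Decay of the potential *)

Section taxicab.
Context (R : realType).
Local Notation Re := (@complex.Re R).
Local Notation Im := (@complex.Im R).

(** Equivalent to the modulus, and additive over the real and imaginary parts, for
    which the estimates are available. *)
Definition nrm1 (z : R[i]) : R := `|Re z| + `|Im z|.
Definition vnrm (y : 'cV[R[i]]_2) : R := \sum_i nrm1 (y i 0).
Definition mnrm (c : 'M[R[i]]_2) : R := \sum_i \sum_j nrm1 (c i j).

Lemma nrm1_ge0 z : 0 <= nrm1 z.
Proof. by rewrite addr_ge0. Qed.

Lemma vnrm_ge0 y : 0 <= vnrm y.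
Proof. by rewrite sumr_ge0// => i _; exact: nrm1_ge0. Qed.

Lemma mnrm_ge0 c : 0 <= mnrm c.
Proof. by rewrite sumr_ge0// => i _; rewrite sumr_ge0// => j _; exact: nrm1_ge0. Qed.

Lemma nrm1D z1 z2 : nrm1 (z1 + z2) <= nrm1 z1 + nrm1 z2.
Proof.
rewrite /nrm1 ReD ImD.
have := ler_normD (Re z1) (Re z2); have := ler_normD (Im z1) (Im z2); lra.
Qed.

Lemma nrm1M z1 z2 : nrm1 (z1 * z2) <= nrm1 z1 * nrm1 z2.
Proof.
rewrite /nrm1 ReM ImM.
have := ler_normB (Re z1 * Re z2) (Im z1 * Im z2).
have := ler_normD (Re z1 * Im z2) (Im z1 * Re z2); rewrite !normrM; lra.
Qed.

Lemma nrm1N z : nrm1 (- z) = nrm1 z.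
Proof. by rewrite /nrm1 ReN ImN !normrN. Qed.

Lemma nrm1_conj z : nrm1 (Num.conj z) = nrm1 z.
Proof. by rewrite /nrm1 Re_conj Im_conj normrN. Qed.

Lemma nrm1_le_vnrm (y : 'cV[R[i]]_2) i : nrm1 (y i 0) <= vnrm y.
Proof. by rewrite /vnrm (bigD1 i)//= lerDl sumr_ge0// => j _; exact: nrm1_ge0. Qed.

Lemma vnrmD y1 y2 : vnrm (y1 + y2) <= vnrm y1 + vnrm y2.
Proof. by rewrite /vnrm -big_split ler_sum// => i _; rewrite mxE nrm1D. Qed.

Lemma vnrmN y : vnrm (- y) = vnrm y.
Proof. by apply: eq_bigr => i _; rewrite mxE nrm1N. Qed.

Lemma vnrm_mulmx c (y : 'cV[R[i]]_2) (t : R) : (forall j, nrm1 (y j 0) <= t) -> vnrm (c *m y) <= mnrm c * t.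
Proof.
move=> yt; rewrite /vnrm /mnrm mulr_suml ler_sum// => i _; rewrite mxE.
rewrite mulr_suml; apply: (@le_trans _ _ (\sum_j nrm1 (c i j * y j 0))).
  by rewrite !sum2; exact: nrm1D.
by apply: ler_sum => j _; apply: (le_trans (nrm1M _ _)); rewrite ler_wpM2l ?nrm1_ge0.
Qed.

Lemma Re_le_nrm1 z : `|Re z| <= nrm1 z. Proof. by rewrite lerDl. Qed.
Lemma Im_le_nrm1 z : `|Im z| <= nrm1 z. Proof. by rewrite lerDr. Qed.

End taxicab.

Section zero_mean_decay.
Context (R : realType).
Variable eps : R.
Hypothesis eps_gt0 : 0 < eps.
Local Notation mu := (plane_measure R).
Local Notation w := (@japanese R).
Local Notation Re := (@complex.Re R).
Local Notation Im := (@complex.Im R).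
Local Notation Om := (Omega eps).
Local Notation SW := (plane_schur eps_gt0).
Local Notation dens := (weighted_density mu Om w).
Local Notation cdens := (cdens eps).
Local Notation vdens := (vdens eps).
Local Notation vfun := (R * R -> 'cV[R[i]]_2).
Variable m : R.
Implicit Types (u : vfun).

Lemma cpotential_relker (f : R * R -> R[i]) : cdens f -> cintegrable f -> cintegral f = 0 ->
  {ae leb2 R, forall x, cpotential (@lnker R) f x = cpotential (@relker R) f x}.
Proof.
move=> [f1 f2] [i1 i2] f0.
have main (g : R * R -> R) : dens g -> (leb2 R).-integrable setT (fun x => (g x)%:E) ->
    \int[leb2 R]_x g x = 0 ->
    {ae leb2 R, forall x, potential mu (@lnker R) g x = potential mu (@relker R) g x}.
  move=> dg ig g0; have := ae_integrable_kernel SW (dominated_lnker R) dg.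
  apply: ae_plane_sub => x ix; rewrite /potential /relker.
  under [RHS]eq_Rintegral do rewrite mulrBl.
  have il : (leb2 R).-integrable setT (fun y => (ln (w x) * g y)%:E).
    by under eq_fun do rewrite EFinM; exact: integrableZl.
  rewrite [RHS]RintegralB//.
  by rewrite RintegralZl// [X in _ - _ * X](_ : _ = 0)// mulr0 subr0.
have := ae_plane_and (main _ f1 i1 (congr1 Re f0)) (main _ f2 i2 (congr1 Im f0)).
by apply: ae_plane_sub => x [e1 e2]; apply: complex_eq.
Qed.

Definition relative_kernel (k : R * R -> R * R -> R) : Prop :=
  (exists j, k = @gradker R j) \/ k = @relker R.

Lemma relative_kernel_le k : relative_kernel k -> mkernel k /\ forall x y,
  `|k x y| <= 2 * w y * sker x y ^+ 4 /\ w x * `|k x y| <= 3 * w y ^+ 2 * sker x y ^+ 4.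
Proof.
have s0 (x y : R * R) : 0 <= sker x y ^+ 4 by rewrite exprn_ge0// (le_trans ler01)// sker_ge1.
case=> [[j ->]|->]; split.
- exact: mkernel_gradker.
- move=> x y; split.
  + apply: (le_trans (normr_gradker_le_sker j x y)).
    by rewrite ler_peMl ?s0//; have := japanese_ge1 y; lra.
  + apply: (le_trans (gradker_decay j x y)); rewrite ler_wpM2r ?s0// ler_wpM2r ?sqr_ge0//; lra.
- exact: mkernel_relker.
- exact: normr_relker_mul_le.
Qed.

Definition calG0_const : R := mnrm (grad_coef R 0) + mnrm (grad_coef R 1) + mnrm (ln_coef m).

Lemma calG0_const_ge0 : 0 <= calG0_const.
Proof. by rewrite !addr_ge0// mnrm_ge0. Qed.

(** The logarithm only meets the first component of u, through I1, and that
    component has integral 0; so relker may replace lnker. *)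
Lemma calG0_relative u : vdens u -> cintegrable (fun x => u x 0 0) ->
    cintegral (fun x => u x 0 0) = 0 ->
  {ae leb2 R, forall x, forall t : R,
    (forall k j, relative_kernel k -> nrm1 (cpotential k (fun y => u y j 0) x) <= t) ->
    vnrm (calG0 m u x) <= calG0_const * t}.
Proof.
move=> du iu u0.
have := ae_plane_and (calG0_vpotential eps_gt0 m du) (cpotential_relker (du 0) iu u0).
apply: ae_plane_sub => x [-> ln_rel] t kt.
have -> : vpotential (@lnker R) (ln_coef m) u x = vpotential (@relker R) (ln_coef m) u x.
  apply/matrixP => i j; rewrite ord1 !vpotentialE !sum2 ln_rel; congr (_ + _).
  by rewrite /ln_coef !mxE andbF mulr0 !mul0r.
have vk k c : relative_kernel k -> vnrm (vpotential k c u x) <= mnrm c * t.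
  by move=> rk; apply: vnrm_mulmx => j; rewrite mxE; exact: kt.
rewrite /calG0_const !mulrDl.
apply: (le_trans (vnrmD _ _)); apply: lerD; last by apply: vk; right.
apply: (le_trans (vnrmD _ _)); apply: lerD; apply: vk; left.
- by exists 0.
- by exists 1.
Qed.

Lemma weighted_density_normr (f : R * R -> R) : dens f -> dens (fun x => `|f x|).
Proof.
move=> [mf df]; split; first exact: measurableT_comp.
apply: (eq_ind _ (density mu Om) df).
by apply/funext => x; rewrite /weighted normr_id.
Qed.

Lemma dens_vnrm u : vdens u -> dens (fun x => vnrm (u x)).
Proof.
move=> du; rewrite (_ : (fun x => _) = fun x => nrm1 (u x 0 0) + nrm1 (u x 1 0)); last first.
  by apply/funext => x; rewrite /vnrm sum2.
have d i : dens (fun x => nrm1 (u x i 0)).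
  by case: (du i) => d1 d2; apply: weighted_densityD; exact: weighted_density_normr.
exact: (weighted_densityD (d 0) (d 1)).
Qed.

(** The potential is at first bounded only by the possibly unbounded function
    smear 4 of w |u|. The assumed inequality, which comes from phi = U v psi,
    makes w |u| satisfy the integral inequality of density_smear4_bounded. Hence
    smear 4 is bounded, u decays pointwise, and potential_decay applies. *)
Lemma zero_mean_decay u (C : R) : vdens u -> cintegrable (fun x => u x 0 0) ->
    cintegral (fun x => u x 0 0) = 0 -> 0 <= C ->
    {ae leb2 R, forall x, vnrm (u x) <= C * decay eps x ^+ 2 * (1 + vnrm (calG0 m u x))} ->
  exists2 D, 0 <= D & {ae leb2 R, forall x, w x * vnrm (calG0 m u x) <= D}.
Proof.
move=> du iu u0 C0 uC.
pose U x := vnrm (u x); pose a := weighted w U.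
have dU : dens U := dens_vnrm du.
have da : density mu Om a by case: dU.
have aE x : a x = w x * vnrm (u x) by rewrite /a /weighted ger0_norm// vnrm_ge0.
have mu1 j : measurable_fun setT (fun x => Re (u x j 0)) by case: (du j) => -[].
have mu2 j : measurable_fun setT (fun x => Im (u x j 0)) by case: (du j) => _ [].
have K0 := calG0_const_ge0.
have U1 x j : `|Re (u x j 0)| <= U x.
  exact: le_trans (Re_le_nrm1 _) (nrm1_le_vnrm _ _).
have U2 x j : `|Im (u x j 0)| <= U x.
  exact: le_trans (Im_le_nrm1 _) (nrm1_le_vnrm _ _).
have w0 x : 0 <= w x := ltW (japanese_gt0 x).
have U0 x : 0 <= U x := vnrm_ge0 _.
have ma : measurable_fun setT a by case: da.
have a0 x : 0 <= a x by case: da.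
(* The weak bound 2 * w y * s ^+ 4 on the kernels, with no decay in x. *)
have pot1 k (f : R * R -> R) x : relative_kernel k -> measurable_fun setT f ->
    (forall y, `|f y| <= U y) -> (`|potential mu k f x|%:E <= 2%:E * smear mu (@sker R) 4 a x)%E.
  move=> /relative_kernel_le[mk kC] mf fU.
  have kx y := (kC x y).1.
  apply: (le_trans (normr_potential_le SW mk mf (ler0n _ 2) kx)).
  apply: lee_wpmul2l => //; apply: (le_smear SW) => //.
  - by apply: measurable_funM; [exact: measurable_japanese|exact: measurableT_comp].
  - by move=> y; rewrite /weighted mulr_ge0.
  - move=> y; rewrite ler_wpM2l ?exprn_ge0 ?(le_trans ler01) ?sker_ge1//.
    by rewrite /a /weighted ler_wpM2l// (ger0_norm (U0 y)).
have s0 x : (0 <= smear mu (@sker R) 4 a x)%E := smear_ge0 SW 4 x a0.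
have smear_fin x : (smear mu (@sker R) 4 a x < +oo)%E -> smear mu (@sker R) 4 a x \is a fin_num.
  by rewrite ge0_fin_numE.
have bound1 : {ae leb2 R, forall x,
    (smear mu (@sker R) 4 a x < +oo)%E /\
    vnrm (calG0 m u x) <= calG0_const * (4 * fine (smear mu (@sker R) 4 a x))}.
  have := ae_plane_and (ae_smear4_lty SW da) (calG0_relative du iu u0).
  apply: ae_plane_sub => x [soo ht]; split=> //; apply: ht => k j rk.
  have sf := smear_fin x soo.
  have p1 := pot1 k _ x rk (mu1 j) (fun y => U1 y j).
  have p2 := pot1 k _ x rk (mu2 j) (fun y => U2 y j).
  move: p1 p2; rewrite -(fineK sf) -EFinM !lee_fin /nrm1 /cpotential /=; lra.
pose C1 := C * (1 + 4 * calG0_const).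
have C10 : 0 <= C1 by rewrite mulr_ge0// addr_ge0// mulr_ge0.
(* The inequality for u in terms of its own smeared modulus. *)
have ubound : {ae leb2 R, forall x, (smear mu (@sker R) 4 a x < +oo)%E /\
    vnrm (u x) <= C1 * decay eps x ^+ 2 * (1 + fine (smear mu (@sker R) 4 a x))}.
  have := ae_plane_and uC bound1; apply: ae_plane_sub => x [uCx [soo Gx]]; split=> //.
  have {}s0 := fine_ge0 (s0 x).
  apply: (le_trans uCx).
  have key : 1 + vnrm (calG0 m u x) <=
      (1 + 4 * calG0_const) * (1 + fine (smear mu (@sker R) 4 a x)).
    move: Gx s0 K0; set s := fine _; set G := vnrm _; set K := calG0_const => Gx s0 K0.
    by rewrite mulrDl mul1r mulrDr mulr1 -mulrA; move: Gx s0 K0; lra.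
  have Cd : 0 <= C * decay eps x ^+ 2 by rewrite mulr_ge0 ?sqr_ge0.
  apply: (le_trans (ler_wpM2l Cd key)); apply: le_of_eq.
  by rewrite /C1; ring.
clearbody C1.
have abound : {ae mu, forall z, ((a z)%:E <= C1%:E * ((Om z)%:E * (1 + smear mu (@sker R) 4 a z)))%E}.
  apply: ae_plane_sub ubound => x [soo ux].
  have sf := smear_fin x soo.
  rewrite -(fineK sf) -EFinD -!EFinM lee_fin aE.
  move: ux (fine_ge0 (s0 x)); set s := fine _ => ux s0'.
  have d0 := sqr_ge0 (decay eps x).
  apply: (le_trans (ler_wpM2l (w0 x) ux)).
  have dO : w x * decay eps x ^+ 2 <= Om x.
    rewrite -sqr_japanese_decay exprMn ler_wpM2r// ler_eXnr//.
    exact: japanese_ge1.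
  have Cs : 0 <= C1 * (1 + s) by rewrite mulr_ge0 ?addr_ge0.
  by move: (ler_wpM2l Cs dO); lra.
have [C' sC'] := density_smear4_bounded SW da C10 abound.
(* Now smear 4 is bounded, and u decays like Om / w ^+ 2. *)
have wU : {ae mu, forall y, w y ^+ 2 * `|U y| <= C1 * (1 + `|C'|) * Om y}.
  apply: ae_plane_sub ubound => x [soo ux].
  have sf := smear_fin x soo.
  have := sC' x; rewrite -(fineK sf) lee_fin.
  move: ux (fine_ge0 (s0 x)); set s := fine _ => ux s0' sC.
  have d0 := sqr_ge0 (decay eps x).
  rewrite (ger0_norm (U0 x)) -sqr_japanese_decay exprMn mulrCA.
  rewrite ler_wpM2l ?sqr_ge0//; apply: (le_trans ux).
  have Cd := mulr_ge0 C10 d0; rewrite [leRHS]mulrAC ler_wpM2l// lerD2l.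
  exact: le_trans sC (ler_norm _).
have K2 : 0 <= C1 * (1 + `|C'|) by rewrite mulr_ge0// addr_ge0.
pose D := 3 * (C1 * (1 + `|C'|)) * schur_const eps.
(* The strong bound 3 * w y ^+ 2 * s ^+ 4 on w x times the kernels. *)
have pot2 k (f : R * R -> R) x : relative_kernel k -> measurable_fun setT f ->
    (forall y, `|f y| <= U y) -> w x * `|potential mu k f x| <= D.
  move=> /relative_kernel_le[mk kC] mf fU.
  apply: (potential_decay SW mk mf) => //.
  - apply: ae_plane_sub wU => y; apply: le_trans; rewrite ler_wpM2l ?sqr_ge0//.
    by rewrite (ger0_norm (U0 y)).
  - by move=> y z; exact: (kC y z).2.
have D0 : 0 <= D.
  apply: le_trans (pot2 (@relker R) (fun=> 0) 0 _ _ _); first by rewrite mulr_ge0.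
  - by right.
  - exact: measurable_cst.
  - by move=> y; rewrite normr0.
have D2 : 0 <= 2 * D by rewrite mulr_ge0.
exists (calG0_const * (2 * D)); first exact: (mulr_ge0 K0 D2).
apply: ae_plane_sub (calG0_relative du iu u0) => x hx.
rewrite mulrC -ler_pdivlMr ?japanese_gt0// -mulrA; apply: hx => k j rk.
have p1 := pot2 k _ x rk (mu1 j) (fun y => U1 y j).
have p2 := pot2 k _ x rk (mu2 j) (fun y => U2 y j).
rewrite ler_pdivlMr ?japanese_gt0// mulrC mulrDr; move: p1 p2; rewrite /cpotential /=; lra.
Qed.

End zero_mean_decay.

(** * Integrability at infinity *)

Section integrability_at_infinity.
Context (R : realType).
Local Notation w := (@japanese R).

Lemma decaying_Lfun (f : R * R -> R) (D : R) (p : \bar R) : measurable_fun [set: R * R] f ->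
  0 <= D -> {ae leb2 R, forall x, w x * `|f x| <= D} -> (2%:E < p)%E -> f \in Lfun (leb2 R) p.
Proof.
move=> mf D0 fD p2; rewrite inE; apply/andP; rewrite !inE /=; split => //.
have {}fD : {ae leb2 R, forall x, `|f x| <= D / w x}.
  by apply: ae_plane_sub fD => x; rewrite mulrC -ler_pdivlMr ?japanese_gt0.
rewrite /finite_norm unlock; case: p p2 => [r| |]//; rewrite ?lte_fin => r2.
- have r0 : 0 <= r by move: r2; lra.
  apply: poweR_lty; apply: (@le_lt_trans _ _ (\int[leb2 R]_x ((D `^ r)%:E * (w x `^ (- r))%:E))%E).
    apply: ae_ge0_le_integral => //.
    + by move=> x _; exact: poweR_ge0.
    + under eq_fun do rewrite abse_EFin poweR_EFin; apply/measurable_EFinP.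
      by apply: (measurableT_comp (measurable_powR _)); exact: measurableT_comp.
    + by move=> x _; rewrite -EFinM lee_fin mulr_ge0 ?powR_ge0.
    + apply/measurable_EFinP/measurable_funM => //.
      by apply: (measurableT_comp (measurable_powR _)); exact: measurable_japanese.
    + apply: ae_plane_sub fD => x fx _; rewrite abse_EFin poweR_EFin -EFinM lee_fin.
      have w0 := ltW (japanese_gt0 x).
      have -> : w x `^ (- r) = (w x)^-1 `^ r by rewrite -powR_inv1// -powRrM mulN1r.
      have wV : 0 <= (w x)^-1 by rewrite invr_ge0.
      by rewrite -powRM// ge0_ler_powR ?nnegrE// mulr_ge0.
  rewrite ge0_integralZl//; last 3 first.
  + apply/measurable_EFinP.
    by apply: (measurableT_comp (measurable_powR _)); exact: measurable_japanese.
  + by move=> x _; rewrite lee_fin powR_ge0.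
  + by rewrite lee_fin powR_ge0.
  rewrite lte_mul_pinfty ?lee_fin ?powR_ge0//.
  exact: le_lt_trans (integral_japanese_le r2) (ltry _).
- case: ifP => // _; apply: (@le_lt_trans _ _ D%:E); last exact: ltry.
  apply/ess_supP; apply: ae_plane_sub fD => x fx; rewrite /= lee_fin (le_trans fx)//.
  by rewrite ler_pdivrMr ?japanese_gt0// ler_peMr// japanese_ge1.
Qed.

Lemma leb2_setT : leb2 R setT = +oo%E.
Proof.
apply/eqyP => A A0; have A1 : 0 <= A + 1 by rewrite addr_ge0 ?ltW.
apply: (@le_trans _ _ (leb2 R (square (0 : R * R) (A + 1)))).
  by rewrite leb2_square// lee_fin; move: A0; nra.
by apply: le_measure; rewrite ?inE//; exact: measurable_square.
Qed.

(** The plane has infinite measure. *)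
Lemma cst_Lfun_eq0 (c : R) : cst c \in Lfun (leb2 R) 3%:E -> c = 0.
Proof.
move=> /(Lfun_integrable (ler1n _ 3)) /integrableP[_].
under eq_integral do rewrite gee0_abs ?lee_fin ?powR_ge0//.
have -> : (\int[leb2 R]_x (`|cst c x| `^ 3)%:E = (`|c| `^ 3)%:E * leb2 R setT)%E.
  exact: (@integral_cst _ _ R (leb2 R) setT measurableT (`|c| `^ 3)%:E).
rewrite leb2_setT.
have [->//|c0] := eqVneq c 0.
by rewrite gt0_muley// lte_fin powR_gt0 ?normr_gt0.
Qed.

End integrability_at_infinity.

Section resonance.
Context (R : realType).
Variables (m eps : R) (lam : 'I_2 -> R * R -> R) (B : R * R -> 'M[R[i]]_2).
Hypothesis eps_gt0 : 0 < eps.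
Hypothesis lam_meas : forall j, measurable_fun [set: R * R] (lam j).
Hypothesis v_meas : forall i j, cmeasurable (fun x => vmx lam B x i j).
Hypothesis v_decay : exists C : R, forall i j x,
  `|vmx lam B x i j| <= (C * japanese x `^ (- 2 - eps))%:C.
Local Notation w := (@japanese R).
Local Notation Re := (@complex.Re R).
Local Notation Im := (@complex.Im R).
Local Notation c0 := (c0 m lam B).
Local Notation psi_of := (psi_of m lam B).
Variable phi : R * R -> 'cV[R[i]]_2.
Hypothesis phi_L2 : Lp2 2%:E phi.

Lemma mnrm_vmx_le : exists2 C, 0 <= C & forall x, mnrm (vmx lam B x) <= C * decay eps x.
Proof.
have [C hC] := v_decay; exists (8 * `|C|); first by rewrite mulr_ge0.
move=> x; have h i j : nrm1 (vmx lam B x i j) <= 2 * `|C| * decay eps x.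
  have /Re_le_normc[h1 h2] := hC i j x.
  have hd : C * decay eps x <= `|C| * decay eps x.
    by rewrite ler_wpM2r ?ler_norm// ltW// decay_gt0.
  by move: h1 h2 hd; rewrite /nrm1 /decay; lra.
have := h 0 0; have := h 0 1; have := h 1 0; have := h 1 1.
by rewrite /mnrm !sum2; lra.
Qed.

Lemma mnrm_adj (M : 'M[R[i]]_2) : mnrm (M^t* ) = mnrm M.
Proof.
rewrite /mnrm exchange_big; apply: eq_bigr => i _; apply: eq_bigr => j _.
by rewrite mxE mxE nrm1_conj.
Qed.

Lemma vnrm_mulmx_le (M : 'M[R[i]]_2) (y : 'cV[R[i]]_2) : vnrm (M *m y) <= mnrm M * vnrm y.
Proof. by apply: vnrm_mulmx => j; exact: nrm1_le_vnrm. Qed.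

Lemma vnrm_Umx x (y : 'cV[R[i]]_2) : vnrm (Umx lam x *m y) = vnrm y.
Proof.
apply: eq_bigr => i _; rewrite UmxE /nrm1 ReM ImM /= !mul0r subr0 addr0 !normrM /sign1.
by case: ifP; rewrite ?normrN normr1 !mul1r.
Qed.

(** Two factors v: one in v^* phi, one in phi = U v psi. *)
Lemma vadj_bound : phi = (fun x => Umx lam x *m vmx lam B x *m psi_of phi x) %[ae leb2 R] ->
  exists2 C, 0 <= C & {ae leb2 R, forall x,
    vnrm (vadj lam B phi x) <= C * decay eps x ^+ 2 * (1 + vnrm (calG0 m (vadj lam B phi) x))}.
Proof.
move=> /aeqP phi_psi; have [C C0 vC] := mnrm_vmx_le.
pose N := vnrm (c0 phi *: delta_mx 0 0).
have N0 : 0 <= N := vnrm_ge0 _.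
exists (C ^+ 2 * (1 + N)); first by rewrite mulr_ge0 ?sqr_ge0// addr_ge0.
apply: ae_plane_sub phi_psi => x phix; rewrite /vadj.
set G := vnrm (calG0 _ _ _).
have G0 : 0 <= G := vnrm_ge0 _.
have d0 : 0 <= C * decay eps x by rewrite mulr_ge0// ltW// decay_gt0.
have psiG : vnrm (psi_of phi x) <= N + G.
  by rewrite /Defs.psi_of (le_trans (vnrmD _ _))// vnrmN.
have phiG : vnrm (phi x) <= C * decay eps x * (N + G).
  rewrite phix -mulmxA vnrm_Umx; apply: (le_trans (vnrm_mulmx_le _ _)).
  by apply: ler_pM => //; [exact: mnrm_ge0|exact: vnrm_ge0].
have : vnrm ((vmx lam B x)^t* *m phi x) <= C * decay eps x * (C * decay eps x * (N + G)).
  apply: (le_trans (vnrm_mulmx_le _ _)); rewrite mnrm_adj.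
  by apply: ler_pM => //; [exact: mnrm_ge0|exact: vnrm_ge0].
move=> /le_trans; apply; rewrite mulrA -expr2 exprMn.
have -> : C ^+ 2 * (1 + N) * decay eps x ^+ 2 * (1 + G) =
  C ^+ 2 * decay eps x ^+ 2 * ((1 + N) * (1 + G)) by ring.
rewrite (ler_wpM2l (mulr_ge0 (sqr_ge0 C) (sqr_ge0 (decay eps x))))//.
by rewrite mulrDl mul1r mulrDr mulr1; have := mulr_ge0 N0 G0; lra.
Qed.

Hypothesis phi_orth : inner (vcol1 lam B) phi = 0.
Hypothesis phi_psi : phi = (fun x => Umx lam x *m vmx lam B x *m psi_of phi x) %[ae leb2 R].

Local Notation u := (vadj lam B phi).

Lemma vcol1_dot x : ((vcol1 lam B x)^t* *m phi x) 0 0 = u x 0 0.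
Proof.
by rewrite vadjE dotE; apply: eq_bigr => j _; rewrite [in LHS]mxE.
Qed.

Lemma calG0_decay : exists2 D, 0 <= D & {ae leb2 R, forall x, w x * vnrm (calG0 m u x) <= D}.
Proof.
have [C C0 uC] := vadj_bound phi_psi.
have uE : (fun x => u x 0 0) = (fun x => ((vcol1 lam B x)^t* *m phi x) 0 0).
  by apply/funext => x; rewrite vcol1_dot.
apply: (zero_mean_decay eps_gt0 (vdens_vadj v_meas v_decay phi_L2) _ _ C0 uC).
- by rewrite uE; apply: cintegrable_Lp2 => //; exact: (L2_vcol1 eps_gt0 v_meas v_decay).
- by rewrite uE.
Qed.

Lemma vmeasurable_calG0_vadj : vmeasurable (calG0 m u).
Proof. exact: (vmeasurable_calG0 eps_gt0 m (vdens_vadj v_meas v_decay phi_L2)). Qed.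

Lemma calG0_Lp2 (p : \bar R) : (2%:E < p)%E -> Lp2 p (calG0 m u).
Proof.
move=> p2 i; have [D D0 GD] := calG0_decay; have [m1 m2] := vmeasurable_calG0_vadj i.
split.
- apply: (decaying_Lfun m1 D0 _ p2); apply: ae_plane_sub GD => x; apply: le_trans.
  rewrite (ler_wpM2l (ltW (japanese_gt0 x)))//.
  exact: le_trans (Re_le_nrm1 _) (nrm1_le_vnrm _ _).
- apply: (decaying_Lfun m2 D0 _ p2); apply: ae_plane_sub GD => x; apply: le_trans.
  rewrite (ler_wpM2l (ltW (japanese_gt0 x)))//.
  exact: le_trans (Im_le_nrm1 _) (nrm1_le_vnrm _ _).
Qed.

Lemma psi_Lp2 (p : \bar R) : c0 phi = 0 -> (2%:E < p)%E -> Lp2 p (psi_of phi).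
Proof.
move=> c00 p2 i; have p1 : (1 <= p)%E by apply: (le_trans _ (ltW p2)); rewrite lee_fin ler1n.
have [G1 G2] := calG0_Lp2 p2 i.
have psiE x : psi_of phi x i 0 = - calG0 m u x i 0.
  by rewrite /Defs.psi_of c00 scale0r sub0r mxE.
split.
- rewrite (_ : (fun x => _) = - (fun x => Re (calG0 m u x i 0))).
    exact: (@Lfun_oppr_closed _ _ R (leb2 R) p _ G1).
  by apply/funext => x; rewrite psiE ReN.
- rewrite (_ : (fun x => _) = - (fun x => Im (calG0 m u x i 0))).
    exact: (@Lfun_oppr_closed _ _ R (leb2 R) p _ G2).
  by apply/funext => x; rewrite psiE ImN.
Qed.

(** c0 (1, 0)^T is the sum of psi and of a potential that is in L^3. *)
Lemma psi_L3_c0 : Lp2 3%:E (psi_of phi) -> c0 phi = 0.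
Proof.
move=> L3; have p2 : (2%:E < 3%:E :> \bar R)%E by rewrite lte_fin ltr_nat.
have p1 : (1 <= 3%:E :> \bar R)%E by rewrite lee_fin ler1n.
have [G1 G2] := calG0_Lp2 p2 0; have [P1 P2] := L3 0.
have psiE x : c0 phi = psi_of phi x 0 0 + calG0 m u x 0 0.
  by rewrite /Defs.psi_of !mxE eqxx mulr1 subrK.
have [_ addL] := @Lfun_addr_closed _ _ R (leb2 R) _ p1.
apply: complex_eq; apply: cst_Lfun_eq0.
- rewrite (_ : cst _ = (fun x => Re (psi_of phi x 0 0)) + (fun x => Re (calG0 m u x 0 0))).
    exact: addL.
  by apply/funext => x; exact: etrans (congr1 Re (psiE x)) (ReD _ _).
- rewrite (_ : cst _ = (fun x => Im (psi_of phi x 0 0)) + (fun x => Im (calG0 m u x 0 0))).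
    exact: addL.
  by apply/funext => x; exact: etrans (congr1 Im (psiE x)) (ImD _ _).
Qed.

End resonance.

Theorem lemma7p6 (R : realType) (m : R) (V : R * R -> 'M[R[i]]_2)
    (lam : 'I_2 -> R * R -> R) (B : R * R -> 'M[R[i]]_2) (eps : R)
    (P S1 S2 : (R * R -> 'cV[R[i]]_2) -> (R * R -> 'cV[R[i]]_2))
    (phi : R * R -> 'cV[R[i]]_2)
    (m_gt0 : 0 < m)
    (V_sa : forall x, V x \is hermsymmx)
    (B_unitary : forall x, B x \is unitarymx)
    (V_diag : forall x,
       V x = (B x)^t* *m diag_mx (\row_j (lam j x)%:C) *m B x)
    (lam_meas : forall j, measurable_fun [set: R * R] (lam j))
    (v_meas : forall i j, cmeasurable (fun x => vmx lam B x i j))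
    (ac_neq0 : ~ (vcol1 lam B = (fun=> 0) %[ae leb2 R]))
    (eps_gt0 : 0 < eps)
    (v_decay : exists C : R, forall i j x,
       `|vmx lam B x i j| <= (C * japanese x `^ (- 2 - eps))%:C)
    (P_proj : is_orthproj (L2span (vcol1 lam B)) P)
    (S1_proj : is_orthproj (ker_on (oppproj P) (QTQ m lam B P)) S1)
    (S2_proj : is_orthproj (ker_on S1 (T1op m lam B P S1)) S2)
    (phi_S1 : L2range S1 phi)
    (phi_psi : phi = (fun x => Umx lam x *m vmx lam B x *m psi_of m lam B phi x)
                 %[ae leb2 R]) :
  (L2range S2 phi <->
     forall p : \bar R, (2%:E < p)%E -> Lp2 p (psi_of m lam B phi)) /\
  (L2range S2 phi <-> c0 m lam B phi = 0).
Proof.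
have phi_L2 : Lp2 2%:E phi by case: phi_S1.
have S2_c0 : L2range S2 phi <-> c0 m lam B phi = 0.
  exact: (L2range_S2 eps_gt0 lam_meas v_meas v_decay ac_neq0 P_proj S1_proj S2_proj phi_S1).
have [phi_orth _] := Top_range_S1 eps_gt0 lam_meas v_meas v_decay ac_neq0 P_proj S1_proj phi_S1.
split=> //; split=> [/S2_c0 c00 p p2|psi_Lp].
  exact: (psi_Lp2 eps_gt0 v_meas v_decay phi_L2 phi_orth phi_psi c00 p2).
apply/S2_c0; apply: (psi_L3_c0 eps_gt0 v_meas v_decay phi_L2 phi_orth phi_psi).
(* Any finite exponent above 2 serves. *)
by apply: psi_Lp; rewrite lte_fin ltr_nat.
Qed.
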